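(* Assume: (A1) $\sup_{i,j}\|X_{ij}\|=O(\sqrt{p_n})$; (A2) the unknown parameter $\beta_n$ belongs to a compact subset $\mathcal{B}\subseteq\mathbb{R}^{p_n}$, the true value $\beta_{n0}$ lies in the interior of $\mathcal{B}$, and there are constants $b_1,b_2$ (not depending on $n$) with $0<b_1\le\pi_{ij}(\beta_{n0})\le b_2<1$ for all $i,j$, where $\pi_{ij}(\beta)=\exp(X_{ij}^T\beta)/[1+\exp(X_{ij}^T\beta)]$; (A3) there are positive constants $b_3,b_4$ with $b_3\le\lambda_{\min}\big(n^{-1}\sum_{i=1}^nX_i^TX_i\big)\le\lambda_{\max}\big(n^{-1}\sum_{i=1}^nX_i^TX_i\big)\le b_4$; (A4) the common true correlation matrix $R_0$ has eigenvalues bounded away from $0$ and $+\infty$, and the estimated working correlation matrix $\widehat R$ satisfies $\|\widehat R^{-1}-\overline R^{-1}\|=O_p(\sqrt{p_n/n})$, where $\overline R$ is a constant positive definite matrix with eigenvalues bounded away from $0$ and $+\infty$ ($\overline R$ is not required to equal $R_0$); (A5) there exist a finite constant $M_1>0$ and some $\delta>0$ such that $E\big(\|A_i^{-1/2}(\beta_{n0})(Y_i-\mu_i(\beta_{n0}))\|^{2+\delta}\big)\le M_1$ for all $i$; (A6) for each $\Delta>0$, with $B_n=\{\beta_n:\|\beta_n-\beta_{n0}\|\le\Delta\sqrt{p_n/n}\}$, the quantities $\dot\mu(X_{ij}^T\beta_n)$, $1\le i\le n$, $1\le j\le m$, are uniformly bounded away from $0$ and $\infty$ on $B_n$, and $\ddot\mu(X_{ij}^T\beta_n)$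 and $\mu^{(3)}(X_{ij}^T\beta_n)$, $1\le i\le n$, $1\le j\le m$, are uniformly bounded by a finite positive constant $M_2$ on $B_n$. Suppose $n^{-1}p_n^2=o(1)$. Then the generalized estimating equation $$\sum_{i=1}^nX_i^TA_i^{1/2}(\beta_n)\widehat R^{-1}A_i^{-1/2}(\beta_n)\big(Y_i-\mu_i(\beta_n)\big)=0$$ has a root $\widehat\beta_n$ such that $\|\widehat\beta_n-\beta_{n0}\|=O_p(\sqrt{p_n/n})$. Furthermore, if $n^{-1}p_n^3=o(1)$, then for all $\alpha_n\in\mathbb{R}^{p_n}$ with $\|\alpha_n\|=1$, $$\alpha_n^T\,\overline M_n^{-1/2}(\beta_{n0})\,\overline H_n(\beta_{n0})\,(\widehat\beta_n-\beta_{n0})\to N(0,1)\quad\text{in distribution.}$$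
   Context: Setting: the number of clusters $n\to\infty$, the cluster size $m<\infty$ is a fixed integer, and the number of covariates $p_n\to\infty$ as $n\to\infty$. For each $n$, each cluster $i=1,\dots,n$ and each $j=1,\dots,m$, one observes a (not necessarily binary) real response $Y_{ij}$ and a covariate vector $X_{ij}\in\mathbb{R}^{p_n}$ (covariates are treated as fixed: all moments and probabilities are conditional on them; dependence on $n$ is suppressed). $Y_i=(Y_{i1},\dots,Y_{im})^T$, and $X_i=(X_{i1},\dots,X_{im})^T$ is the $m\times p_n$ matrix with rows $X_{ij}^T$. $Y_1,\dots,Y_n$ are independent; components of one $Y_i$ may be dependent. A known real function $\mu$ is given, with derivatives $\dot\mu,\ddot\mu,\mu^{(3)}$. The first two marginal moments are modelled by $\mu_{ij}(\beta_n):=E_{\beta_n}(Y_{ij})=\mu(X_{ij}^T\beta_n)$ and $\sigma_{ij}^2(\beta_n):=\mathrm{Var}_{\beta_n}(Y_{ij})=\dot\mu(X_{ij}^T\beta_n)$; the true parameter value is $\beta_{n0}$, i.e. $E(Y_{ij})=\mu_{ij}(\beta_{n0})$ and $\mathrm{Var}(Y_{ij})=\sigma^2_{ij}(\beta_{n0})$. All $Y_i$ have the same $m\times m$ true correlation matrix $R_0$. $A_i(\beta_n)=\mathrm{diag}(\sigma_{i1}^2(\beta_n),\dots,\sigma_{im}^2(\beta_n))$ and $\mu_i(\beta_n)=(\mu_{i1}(\beta_n),\dots,\mu_{im}(\beta_n))^T$. $\widehat R$ is an estimated $m\times m$ working correlation matrix (random, and not depending on the argument $\beta_n$ of the estimating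 equation). Define $$\overline M_n(\beta_n)=\sum_{i=1}^nX_i^TA_i^{1/2}(\beta_n)\overline R^{-1}R_0\overline R^{-1}A_i^{1/2}(\beta_n)X_i,\qquad \overline H_n(\beta_n)=\sum_{i=1}^nX_i^TA_i^{1/2}(\beta_n)\overline R^{-1}A_i^{1/2}(\beta_n)X_i.$$ ''Has a root $\widehat\beta_n$ with $\|\widehat\beta_n-\beta_{n0}\|=O_p(\sqrt{p_n/n})$'' means: for every $\epsilon>0$ there is $\Delta>0$ such that for all large $n$, with probability at least $1-\epsilon$, the equation has a root within distance $\Delta\sqrt{p_n/n}$ of $\beta_{n0}$; the asymptotic normality is for such a sequence of roots. $\overline M_n^{-1/2}$ is the inverse of the symmetric positive definite square root. $\|\cdot\|$ is the Euclidean norm for vectors and the Frobenius norm for matrices; $\lambda_{\min},\lambda_{\max}$ denote smallest and largest eigenvalues. *)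

(* Defs.v *)
From mathcomp Require Export all_boot all_order all_algebra.
From mathcomp Require Export all_classical all_reals all_analysis.

Set Implicit Arguments.
Unset Strict Implicit.
Unset Printing Implicit Defensive.

Import Order.TTheory GRing.Theory Num.Theory numFieldNormedType.Exports.

Local Open Scope classical_set_scope.
Local Open Scope ring_scope.

Section Matrices.
Context {R : realType}.

(* The library norm on matrices is the sup norm. This one is the Frobenius
   norm, hence the Euclidean norm on column vectors. *)
Definition enorm m n (A : 'M[R]_(m, n)) : R :=
  Num.sqrt (\sum_i \sum_j A i j ^+ 2).

(* For a symmetric matrix of positive size the spectrum is finite and nonempty,
   so the infimum and the supremum are attained. *)
Definition lambda_min n (S : 'M[R]_n) : R := inf [set a | eigenvalue S a].
Definition lambda_max n (S : 'M[R]_n) : R := sup [set a | eigenvalue S a].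

Definition posdefmx n (S : 'M[R]_n) : Prop :=
  S^T = S /\ forall v : 'cV[R]_n, v != 0 -> 0 < (v^T *m S *m v) ord0 ord0.

(* The symmetric positive definite square root, which exists and is unique
   when M is symmetric positive definite; 0 by default. *)
Definition sqrtmx n (M : 'M[R]_n) : 'M[R]_n :=
  xget 0 [set S | posdefmx S /\ S *m S = M].

End Matrices.

Section Probability.
Context {R : realType}.

(* The inner probability of E is at least r: the equivalence with r <= P E
   holds when E is measurable, but E is arbitrary here. *)
Definition prob_ge d (T : measurableType d) (P : probability T R)
    (E : set T) (r : R) : Prop :=
  exists A : set T, [/\ measurable A, A `<=` E & (r%:E <= P A)%E].

Definition is_Op (d : nat -> measure_display)
    (T : forall n, measurableType (d n)) (P : forall n, probability (T n) R)
    (Z : forall n, T n -> R) (a : nat -> R) : Prop :=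
  forall eps : R, 0 < eps -> exists2 K : R, 0 < K &
    \forall n \near \oo, prob_ge (P n) [set w | `|Z n w| <= K * a n] (1 - eps).

(* Convergence of the distribution functions at every continuity point of the
   limiting one, i.e. at every t that is not an atom of nu. *)
Definition cvg_in_distribution (d : nat -> measure_display)
    (T : forall n, measurableType (d n)) (P : forall n, probability (T n) R)
    (Z : forall n, T n -> R) (nu : set R -> \bar R) : Prop :=
  forall t : R, nu [set t] = 0%E ->
    P n [set w | Z n w <= t] @[n --> \oo] --> nu [set x | x <= t].

(* g_sigma_preimage (Y i) is the sigma-algebra generated by the random vector
   (Y i j)_j. As events A i = setT are allowed, the product rule over all the
   indices gives it over every subfamily. *)
Definition independent_vectors d (T : measurableType d) (P : probability T R)
    (n m : nat) (Y : 'I_n -> 'I_m -> T -> R) : Prop :=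
  forall A : 'I_n -> set T,
    (forall i, g_sigma_preimage (Y i) (A i)) ->
    P (\bigcap_(i in [set: 'I_n]) A i) = (\prod_(i < n) P (A i))%E.

Definition correlation d (T : measurableType d) (P : probability T R)
    (U V : T -> R) : R :=
  fine (covariance P U V) /
    (Num.sqrt (fine 'V_P[U]) * Num.sqrt (fine 'V_P[V])).

End Probability.

Section EstimatingEquation.
Context {R : realType}.
Variables (mu : R -> R) (m p : nat).

Definition linpred (X : 'M[R]_(m, p)) (b : 'cV[R]_p) (j : 'I_m) : R :=
  (X *m b) j ord0.

Definition logistic (t : R) : R := expR t / (1 + expR t).

Definition meanvec (X : 'M[R]_(m, p)) (b : 'cV[R]_p) : 'cV[R]_m :=
  \col_j mu (linpred X b j).

(* A_i(b)^(1/2) and A_i(b)^(-1/2), for A_i(b) = diag of the marginal variances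
   mu'(X_ij^T b). *)
Definition Ahalf (X : 'M[R]_(m, p)) (b : 'cV[R]_p) : 'M[R]_m :=
  diag_mx (\row_j Num.sqrt (mu^`()%classic (linpred X b j))).
Definition Ainvhalf (X : 'M[R]_(m, p)) (b : 'cV[R]_p) : 'M[R]_m :=
  diag_mx (\row_j (Num.sqrt (mu^`()%classic (linpred X b j)))^-1).

Definition gee_score n (X : 'I_n -> 'M[R]_(m, p)) (W : 'M[R]_m)
    (y : 'I_n -> 'cV[R]_m) (b : 'cV[R]_p) : 'cV[R]_p :=
  \sum_(i < n) (X i)^T *m Ahalf (X i) b *m invmx W *m Ainvhalf (X i) b
    *m (y i - meanvec (X i) b).

Definition Mbar n (X : 'I_n -> 'M[R]_(m, p)) (Rbar R0 : 'M[R]_m)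
    (b : 'cV[R]_p) : 'M[R]_p :=
  \sum_(i < n) (X i)^T *m Ahalf (X i) b *m invmx Rbar *m R0 *m invmx Rbar
    *m Ahalf (X i) b *m X i.

Definition Hbar n (X : 'I_n -> 'M[R]_(m, p)) (Rbar : 'M[R]_m)
    (b : 'cV[R]_p) : 'M[R]_p :=
  \sum_(i < n) (X i)^T *m Ahalf (X i) b *m invmx Rbar *m Ahalf (X i) b *m X i.

End EstimatingEquation.

(* Main.v *)
Require Import Defs.
From mathcomp Require Import all_boot all_order all_algebra.
From mathcomp Require Import all_classical all_reals all_analysis.
From mathcomp Require Import measurable_realfun zify ring lra.

Set Implicit Arguments.
Unset Strict Implicit.
Unset Printing Implicit Defensive.

Import Order.TTheory GRing.Theory Num.Theory numFieldNormedType.Exports.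

Local Open Scope classical_set_scope.
Local Open Scope ring_scope.

(** Write S(b) for the estimating function with the estimated working matrix, b0
    for the true parameter, H and M for the matrices Hbar and Mbar at b0, and
    r = Delta * sqrt (p / n).

    The core is one deterministic estimate ([score_expand]): on the ball of radius r
    around b0,
      | v^T (S b - S b' + H (b - b')) | <= kappa * sqrt n * p * |v| * |b - b'|.
    To get it, S is split into the m^2 sums [pair_score] over clusters in which one
    residual multiplies a ratio of standard deviations sqrt mu' at two coordinates. In
    each sum the ratio is expanded to first order at b0, with a Lipschitz remainder
    ([weight_expand], [mean_expand]). The residuals multiply either fixed slopes, where
    independence makes the Frobenius norm of the sum of order sqrt n * p, or
    remainders of relative size |x| * r, where the crude weighted Gram bound
    sum |residual| (x^T u)^2 <= C n |u|^2 suffices; the means contribute - H. Both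
    facts hold on an event whose complement has probability at most 4 m^2 / theta, by
    second moments and Markov's inequality ([score_good_event]). The working matrix
    enters through its entries only, which multiply the sums, so its randomness is
    harmless.

    Existence of a root. As H >= h n with h > 0 ([Hbar_coercive]) and p^2 / n -> 0, the
    estimate makes b |-> b + H^-1 S b a contraction by 1/2 of the ball, and |S b0| is of
    order sqrt (n p), so that the ball is mapped into itself once Delta is large. The
    fixed point is a root ([contraction_fixpoint], [score_root]). The constant in the bound
    on S b0 must not depend on Delta; it uses the bounds on mu' at b0 alone.

    Asymptotic normality. Put v = M^(-1/2) alpha, so that |v| = O(1 / sqrt n). At a root
    b the same estimate with b' = b0 gives v^T H (b - b0) = v^T S b0 up to
    O(sqrt (p^3 / n)), and replacing the estimated working matrix by its limit in S b0
    costs O(p / sqrt n) ([good_linearization]). What is left is a sum of independent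
    centred terms of total variance v^T M v = 1, each of which is a vector of norm
    O(sqrt (p / n)) times a Pearson residual with a bounded moment of order 2 + delta.

    The central limit theorem is proved by Stein's method: for a ramp h,
    the equation F' - x F = h - E h(N) has a solution with F, F' bounded and F'
    Lipschitz ([stein_solution], from Mills' ratio), and a leave-one-out argument
    bounds |E (F' W - W F W)| by a truncated third moment ([stein_bound]). The resulting
    bounds on distribution functions are uniform over all rows ([clt_bound]), which is
    what a triangular array needs.

    Square roots of positive definite matrices and the comparison of quadratic forms
    with the extreme eigenvalues come from minimising a quadratic form on
    the unit sphere ([rayleigh_min], [psd_sqrt]). *)

(** * Euclidean geometry of column vectors *)

Section Euclid.
Context {R : realType}.

Definition dot p (u v : 'cV[R]_p) : R := \sum_k u k ord0 * v k ord0.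

Lemma dotC p (u v : 'cV[R]_p) : dot u v = dot v u.
Proof. by apply: eq_bigr => k _; rewrite mulrC. Qed.

Lemma dotDl p (u v w : 'cV[R]_p) : dot (u + v) w = dot u w + dot v w.
Proof. by rewrite -big_split/=; apply: eq_bigr => k _; rewrite mxE mulrDl. Qed.

Lemma dotZl p a (u w : 'cV[R]_p) : dot (a *: u) w = a * dot u w.
Proof. by rewrite mulr_sumr; apply: eq_bigr => k _; rewrite mxE mulrA. Qed.

Lemma dotNl p (u w : 'cV[R]_p) : dot (- u) w = - dot u w.
Proof. by rewrite -scaleN1r dotZl mulN1r. Qed.

Lemma dotBl p (u v w : 'cV[R]_p) : dot (u - v) w = dot u w - dot v w.
Proof. by rewrite dotDl dotNl. Qed.

Lemma dotDr p (u v w : 'cV[R]_p) : dot w (u + v) = dot w u + dot w v.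
Proof. by rewrite !(dotC w) dotDl. Qed.

Lemma dotZr p a (u w : 'cV[R]_p) : dot w (a *: u) = a * dot w u.
Proof. by rewrite !(dotC w) dotZl. Qed.

Lemma dotNr p (u w : 'cV[R]_p) : dot w (- u) = - dot w u.
Proof. by rewrite !(dotC w) dotNl. Qed.

Lemma dotBr p (u v w : 'cV[R]_p) : dot w (u - v) = dot w u - dot w v.
Proof. by rewrite !(dotC w) dotBl. Qed.

Lemma dot0l p (w : 'cV[R]_p) : dot 0 w = 0.
Proof. by rewrite -(scale0r 0) dotZl mul0r. Qed.

Lemma dot_sumr p (I : Type) (r : seq I) (P : pred I) (F : I -> 'cV[R]_p) w :
  dot w (\sum_(i <- r | P i) F i) = \sum_(i <- r | P i) dot w (F i).
Proof.
apply: (big_morph (dot w)) => [x y|]; first exact: dotDr.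
by rewrite dotC dot0l.
Qed.

Lemma dot_ge0 p (u : 'cV[R]_p) : 0 <= dot u u.
Proof. by apply: sumr_ge0 => k _; rewrite -expr2 sqr_ge0. Qed.

Lemma dot_eq0 p (u : 'cV[R]_p) : dot u u = 0 -> u = 0.
Proof.
move=> /eqP; rewrite psumr_eq0 => [/allP u0|k _]; last by rewrite -expr2 sqr_ge0.
apply/matrixP => k j; rewrite ord1 mxE.
by have := u0 k (mem_index_enum _); rewrite -expr2 sqrf_eq0 => /eqP.
Qed.

Lemma dotE p (u v : 'cV[R]_p) : (u^T *m v) ord0 ord0 = dot u v.
Proof. by rewrite mxE; apply: eq_bigr => k _; rewrite mxE. Qed.

Lemma dot_trmx m p (A : 'M[R]_(m, p)) u v : dot u (A *m v) = dot (A^T *m u) v.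
Proof. by rewrite -!dotE trmx_mul trmxK mulmxA. Qed.

Lemma sqr_enorm p (u : 'cV[R]_p) : enorm u ^+ 2 = dot u u.
Proof.
rewrite /enorm sqr_sqrtr; last by do 2 (apply: sumr_ge0 => ? _); rewrite sqr_ge0.
by apply: eq_bigr => k _; rewrite big_ord1 expr2.
Qed.

Lemma enormE p (u : 'cV[R]_p) : enorm u = Num.sqrt (dot u u).
Proof. by rewrite -sqr_enorm sqrtr_sqr ger0_norm ?sqrtr_ge0. Qed.

Lemma enorm_ge0 m p (u : 'M[R]_(m, p)) : 0 <= enorm u.
Proof. exact: sqrtr_ge0. Qed.

Lemma sqr_enorm_mx m p (A : 'M[R]_(m, p)) :
  enorm A ^+ 2 = \sum_i \sum_j A i j ^+ 2.
Proof. by rewrite /enorm sqr_sqrtr//; do 2 (apply: sumr_ge0 => ? _); rewrite sqr_ge0. Qed.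

Lemma enorm_eq0 p (u : 'cV[R]_p) : enorm u = 0 -> u = 0.
Proof. by move=> u0; apply: dot_eq0; rewrite -sqr_enorm u0 expr0n. Qed.

Lemma enorm0 p : enorm (0 : 'cV[R]_p) = 0.
Proof. by rewrite enormE dot0l sqrtr0. Qed.

Lemma enormZ p a (u : 'cV[R]_p) : enorm (a *: u) = `|a| * enorm u.
Proof.
by rewrite !enormE dotZl dotZr mulrA -expr2 sqrtrM ?sqr_ge0// sqrtr_sqr.
Qed.

Lemma enormN p (u : 'cV[R]_p) : enorm (- u) = enorm u.
Proof. by rewrite -scaleN1r enormZ normrN1 mul1r. Qed.

Lemma enormB p (u v : 'cV[R]_p) : enorm (u - v) = enorm (v - u).
Proof. by rewrite -enormN opprB. Qed.

(** The quadratic is evaluated at its vertex. All the Cauchy-Schwarz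
    inequalities of this file are instances. *)
Lemma discriminant_le (a b c : R) : 0 <= a -> 0 <= c ->
  (forall s, 0 <= a + s * b *+ 2 + s ^+ 2 * c) -> b ^+ 2 <= a * c.
Proof.
move=> a0; rewrite le_eqVlt => /orP[/eqP <- H|c0 H].
  (* here the quadratic is affine in [s], with value [- a - 2] at the chosen [s] *)
  rewrite mulr0; have [->|b0] := eqVneq b 0; first by rewrite expr0n.
  have := H (- (a + 1) / b); rewrite mulr0 addr0 divfK//.
  by move=> Ha; exfalso; lra.
have := H (- b / c); rewrite -(pmulr_rge0 _ c0).
have -> : c * (a + - b / c * b *+ 2 + (- b / c) ^+ 2 * c) = a * c - b ^+ 2.
  by field; rewrite gt_eqF.
by rewrite subr_ge0.
Qed.

Lemma sum_weighted_CS (I : finType) (w x y : I -> R) : (forall i, 0 <= w i) ->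
  (\sum_i w i * x i * y i) ^+ 2 <=
  (\sum_i w i * x i ^+ 2) * (\sum_i w i * y i ^+ 2).
Proof.
move=> w0; apply: discriminant_le.
- by apply: sumr_ge0 => i _; rewrite mulr_ge0 ?sqr_ge0.
- by apply: sumr_ge0 => i _; rewrite mulr_ge0 ?sqr_ge0.
move=> s; rewrite mulr_sumr -sumrMnl mulr_sumr -!big_split/=.
apply: sumr_ge0 => i _.
have -> : w i * x i ^+ 2 + s * (w i * x i * y i) *+ 2 + s ^+ 2 * (w i * y i ^+ 2)
  = w i * (x i + s * y i) ^+ 2 by ring.
by rewrite mulr_ge0 ?sqr_ge0.
Qed.

Lemma sum_CS_le (I : finType) (w x y : I -> R) (a b : R) :
  (forall i, 0 <= w i) -> 0 <= a -> 0 <= b ->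
  \sum_i w i * x i ^+ 2 <= a ^+ 2 -> \sum_i w i * y i ^+ 2 <= b ^+ 2 ->
  \sum_i w i * `|x i| * `|y i| <= a * b.
Proof.
move=> w0 a0 b0 xa yb.
rewrite -ler_sqr ?nnegrE ?mulr_ge0//; last first.
  by apply: sumr_ge0 => i _; rewrite !mulr_ge0.
apply: (le_trans (sum_weighted_CS _ _ w0)); rewrite exprMn ler_pM//.
- by apply: sumr_ge0 => i _; rewrite mulr_ge0 ?sqr_ge0.
- by apply: sumr_ge0 => i _; rewrite mulr_ge0 ?sqr_ge0.
- by under eq_bigr do rewrite real_normK ?num_real//.
- by under eq_bigr do rewrite real_normK ?num_real//.
Qed.

Lemma dot_CS p (u v : 'cV[R]_p) : `|dot u v| <= enorm u * enorm v.
Proof.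
apply: (@le_trans _ _ (\sum_k 1 * `|u k ord0| * `|v k ord0|)).
  apply: (le_trans (ler_norm_sum _ _ _)); apply: ler_sum => k _.
  by rewrite mul1r normrM.
apply: sum_CS_le => //; rewrite ?enorm_ge0// sqr_enorm.
- by apply: ler_sum => k _; rewrite mul1r expr2.
- by apply: ler_sum => k _; rewrite mul1r expr2.
Qed.

Lemma enormD p (u v : 'cV[R]_p) : enorm (u + v) <= enorm u + enorm v.
Proof.
rewrite -ler_sqr ?nnegrE ?addr_ge0 ?enorm_ge0// sqrrD !sqr_enorm.
rewrite dotDl !dotDr (dotC v u).
have := dot_CS u v; have := ler_norm (dot u v); rewrite mulr2n; lra.
Qed.

(** Duality, with [v = z] as the test vector. It turns bounds on bilinear forms,
    where a sum over clusters can be split, into bounds on norms. *)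
Lemma enorm_le_dot p (z : 'cV[R]_p) K : 0 <= K ->
  (forall v, `|dot v z| <= K * enorm v) -> enorm z <= K.
Proof.
move=> K0 H; have := H z; rewrite -sqr_enorm ger0_norm ?sqr_ge0// expr2.
have [-> //|z0] := eqVneq (enorm z) 0.
by rewrite ler_pM2r// lt_neqAle eq_sym z0 enorm_ge0.
Qed.

Lemma ler_dist_enorm p (u v : 'cV[R]_p) : `|enorm u - enorm v| <= enorm (u - v).
Proof.
have h (a b : 'cV[R]_p) : enorm a - enorm b <= enorm (a - b).
  by rewrite lerBlDr; apply: le_trans (enormD _ _); rewrite subrK.
by rewrite ler_norml h andbT lerNl opprB enormB h.
Qed.

Lemma enorm_mulmx m p (A : 'M[R]_(m, p)) (u : 'cV[R]_p) :
  enorm (A *m u) <= enorm A * enorm u.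
Proof.
rewrite -ler_sqr ?nnegrE ?mulr_ge0 ?enorm_ge0// exprMn sqr_enorm sqr_enorm_mx.
rewrite mulr_suml; apply: ler_sum => i _; rewrite -expr2 mxE.
have := @sum_weighted_CS _ (fun=> 1) (A i) (fun j => u j ord0) (fun=> ler01).
rewrite sqr_enorm.
under eq_bigr do rewrite mul1r.
under [X in _ <= X * _]eq_bigr do rewrite mul1r.
by under [X in _ <= _ * X]eq_bigr do rewrite mul1r expr2.
Qed.

Lemma bilin_enorm m p (A : 'M[R]_(m, p)) v u :
  `|dot v (A *m u)| <= enorm A * enorm v * enorm u.
Proof.
apply: (le_trans (dot_CS _ _)); rewrite (mulrC (enorm A)) -mulrA.
by rewrite ler_wpM2l ?enorm_ge0 ?enorm_mulmx.
Qed.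

Lemma outer_dot p (a a' : 'cV[R]_p) v u : dot v ((a *m a'^T) *m u) = dot a v * dot a' u.
Proof.
rewrite -mulmxA (mx11_scalar (a'^T *m u)) mul_mx_scalar dotE dotZr.
by rewrite (dotC v a) mulrC.
Qed.

Lemma entry_le_enorm m p (A : 'M[R]_(m, p)) i j : `|A i j| <= enorm A.
Proof.
rewrite -ler_sqr ?nnegrE ?enorm_ge0// real_normK ?num_real// sqr_enorm_mx.
rewrite (bigD1 i)//= (bigD1 j)//= -addrA lerDl addr_ge0//.
  by apply: sumr_ge0 => ? _; rewrite sqr_ge0.
by do 2 (apply: sumr_ge0 => ? _); rewrite sqr_ge0.
Qed.

End Euclid.

(** * Minimisation over a compact annulus *)

Section Compact.
Context {R : realType}.

Lemma continuous_enorm_rV p (b0 : 'cV[R]_p) :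
  continuous (fun w : 'rV[R]_p => enorm (w^T - b0)).
Proof.
have h k : continuous (fun w : 'rV[R]_p => (w^T - b0) k ord0).
  have -> : (fun w : 'rV[R]_p => (w^T - b0) k ord0) = (fun w => w ord0 k - b0 k ord0).
    by apply/funext => w; rewrite !mxE.
  move=> w; exact: (@continuousB R R 'rV[R]_p _ _ w (@coord_continuous R 1 p ord0 k w)
    (@cst_continuous _ _ (b0 k ord0) w)).
have -> : (fun w : 'rV[R]_p => enorm (w^T - b0)) =
    Num.sqrt \o (fun w : 'rV[R]_p => \sum_k (w^T - b0) k ord0 * (w^T - b0) k ord0).
  by apply/funext => w; rewrite enormE.
move=> w; apply: continuous_comp; last exact: sqrt_continuous.
apply: (@continuous_big R _ +%R 0 xpredT); first exact: add_continuous.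
move=> k _ x; exact: (@continuousM R 'rV[R]_p _ _ x (h k x) (h k x)).
Qed.

(** Compactness in several dimensions enters through this lemma: an annulus of inner
    radius 0 is a ball, and with both radii equal to 1 it is the unit sphere. The
    topology on row vectors comes from the sup norm, hence the comparison of the two
    norms in the proof. *)
Lemma annulus_min p (b0 : 'cV[R]_p) c r (g : 'cV[R]_p -> R) (L : R) :
  (exists b, c <= enorm (b - b0) <= r) -> 0 <= L ->
  (forall b b', enorm (b - b0) <= r -> enorm (b' - b0) <= r ->
     `|g b - g b'| <= L * enorm (b - b')) ->
  exists2 b, c <= enorm (b - b0) <= r &
    forall b', c <= enorm (b' - b0) <= r -> g b <= g b'.
Proof.
move=> [bb hbb] L0 gL.
pose A := [set w : 'rV[R]_p | c <= enorm (w^T - b0) <= r].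
have cA : compact A.
  apply: bounded_closed_compact.
    exists (r + enorm b0); split; first by rewrite num_real.
    move=> M HM w /andP[_ wr].
    rewrite /= [X in X <= _]/Num.Def.normr /= mx_normrE.
    have M0 : 0 <= M.
      by apply: le_trans (ltW HM); rewrite addr_ge0 ?enorm_ge0// (le_trans _ wr) ?enorm_ge0.
    apply/bigmax_leP; split => // -[i j] _ /=; rewrite ord1.
    apply: (le_trans _ (ltW HM)).
    have -> : w ord0 j = w^T j ord0 by rewrite mxE.
    apply: (le_trans (entry_le_enorm _ _ _)).
    rewrite -[w^T](subrK b0); apply: (le_trans (enormD _ _)).
    by rewrite lerD2r.
  have -> : A = (fun w : 'rV[R]_p => enorm (w^T - b0)) @^-1` `[c, r]%classic.
    by apply/seteqP; split => w /=; rewrite in_itv.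
  apply: preimage_closed; first by move=> x _; exact: continuous_enorm_rV.
  exact: interval_closed.
have := @EVT_min_rV R p (fun w => g w^T) A.
case => //.
- by exists bb^T; rewrite /A/= trmxK.
- apply/subspace_continuousP => x Ax; apply/cvgrPdist_le => e e0.
  have /cvgrPdist_le/(_ (e / (L + 1))) := @continuous_enorm_rV p x^T x.
  have L1 : 0 < L + 1 by lra.
  rewrite divr_gt0// => /(_ isT); rewrite subrr enorm0 => H.
  rewrite near_withinE; apply: filterS H => w Hw Aw.
  apply: (le_trans (gL _ _ _ _)); [by case/andP: Ax|by case/andP: Aw|].
  move: Hw; rewrite sub0r normrN ger0_norm ?enorm_ge0// ler_pdivlMr// mulrC enormB => Hw.
  by apply: le_trans Hw; rewrite ler_wpM2r ?enorm_ge0//; lra.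
- move=> w; rewrite inE => Aw Hw; exists w^T => // b' Hb'.
  by have := Hw b'^T; rewrite trmxK; apply; rewrite inE /A/= trmxK.
Qed.

End Compact.

(** * Contractions, Rayleigh quotients and square roots of matrices *)

Section Spectral.
Context {R : realType}.

(** The residual [enorm (Phi b - b)] has a minimiser on the ball, and its image under
    [Phi] has a residual at most half as large: the minimum is 0. *)
Lemma contraction_fixpoint p (b0 : 'cV[R]_p) r (Phi : 'cV[R]_p -> 'cV[R]_p) :
  0 <= r -> (forall b, enorm (b - b0) <= r -> enorm (Phi b - b0) <= r) ->
  (forall b b', enorm (b - b0) <= r -> enorm (b' - b0) <= r ->
     enorm (Phi b - Phi b') <= 2^-1 * enorm (b - b')) ->
  exists2 b, enorm (b - b0) <= r & Phi b = b.
Proof.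
move=> r0 Pb Pc.
have [||b b' Hb Hb'|b /andP[_ Hb] bmin] :=
    @annulus_min R p b0 0 r (fun b => enorm (Phi b - b)) 2.
- by exists b0; rewrite subrr enorm0 lexx r0.
- by lra.
- apply: (le_trans (ler_dist_enorm _ _)).
  have -> : Phi b - b - (Phi b' - b') = (Phi b - Phi b') + - (b - b').
    by apply/matrixP => i j; rewrite !mxE; ring.
  apply: (le_trans (enormD _ _)).
  rewrite enormN; have := Pc _ _ Hb Hb'; have := enorm_ge0 (b - b').
  lra.
exists b => //.
have := bmin (Phi b); rewrite enorm_ge0 (Pb _ Hb) => /(_ isT).
have := Pc _ _ (Pb _ Hb) Hb; have := enorm_ge0 (Phi b - b) => h1 h2 h3.
have h0 : enorm (Phi b - b) = 0 by lra.
by apply/eqP; rewrite -subr_eq0; apply/eqP/enorm_eq0.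
Qed.

Definition quad n (S : 'M[R]_n) (u : 'cV[R]_n) := dot u (S *m u).

Lemma quadE n (S : 'M[R]_n) u : (u^T *m S *m u) ord0 ord0 = quad S u.
Proof. by rewrite -mulmxA dotE. Qed.

Lemma symmx_dot n (S : 'M[R]_n) u v : S^T = S -> dot u (S *m v) = dot v (S *m u).
Proof. by move=> sS; rewrite dot_trmx sS dotC. Qed.

Lemma quadZ n (S : 'M[R]_n) a u : quad S (a *: u) = a ^+ 2 * quad S u.
Proof. by rewrite /quad -scalemxAr dotZl dotZr mulrA expr2. Qed.

Lemma quadD n (S : 'M[R]_n) u v : S^T = S ->
  quad S (u + v) = quad S u + dot u (S *m v) *+ 2 + quad S v.
Proof.
move=> sS; rewrite /quad mulmxDr dotDl !dotDr (symmx_dot v u sS) mulr2n; ring.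
Qed.

Lemma quad0 n (S : 'M[R]_n) : quad S 0 = 0.
Proof. exact: dot0l. Qed.

Lemma psd_CS n (S : 'M[R]_n) x y : S^T = S -> (forall u, 0 <= quad S u) ->
  (dot x (S *m y)) ^+ 2 <= quad S x * quad S y.
Proof.
move=> sS S0; apply: discriminant_le => // s.
have := S0 (x + s *: y); rewrite quadD// quadZ -scalemxAr dotZr.
by rewrite (mulrC _ (quad S y)).
Qed.

(** A minimiser [v] of the quadratic form on the unit sphere is an eigenvector:
    [B = S - l] is positive semidefinite with [quad B v = 0], so that
    [dot (B v) (B v) ^+ 2 <= quad B (B v) * quad B v = 0]. *)
Lemma rayleigh_min n (S : 'M[R]_n) : (0 < n)%N -> S^T = S ->
  exists v l, [/\ dot v v = 1, S *m v = l *: v &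
    forall u, l * dot u u <= quad S u].
Proof.
move=> n0 sS; case: n => // n in S n0 sS *.
have [||b b' Hb Hb'|v /andP[v1 v1'] vmin] :=
    @annulus_min R n.+1 0 1 1 (quad S) (enorm S *+ 2).
- exists (delta_mx ord0 ord0); rewrite subr0 enormE /dot.
  rewrite (bigD1 ord0)//= !mxE eqxx mul1r big1 ?addr0 ?sqrtr1 ?lexx// => k /negbTE k0.
  by rewrite mxE k0 mul0r.
- by rewrite mulrn_wge0// enorm_ge0.
- rewrite !subr0 in Hb Hb'.
  have -> : quad S b - quad S b' = dot (b - b') (S *m b) + dot b' (S *m (b - b')).
    by rewrite /quad mulmxBr dotBl dotBr; ring.
  apply: (le_trans (ler_normD _ _)); rewrite mulr2n mulrDl.
  apply: lerD; apply: (le_trans (bilin_enorm _ _ _)).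
    by rewrite ler_piMr// mulr_ge0 ?enorm_ge0.
  by rewrite ler_wpM2r ?enorm_ge0// ler_piMr ?enorm_ge0.
rewrite !subr0 in v1 v1'.
have vv : dot v v = 1.
  by rewrite -sqr_enorm (_ : enorm v = 1) ?expr1n //; lra.
pose l := quad S v.
have lmin u : l * dot u u <= quad S u.
  have [->|u0] := eqVneq u 0; first by rewrite dot0l mulr0 quad0.
  have nu : 0 < enorm u.
    rewrite lt_neqAle enorm_ge0 andbT eq_sym; apply: contraNneq u0.
    by move/enorm_eq0 ->.
  have := vmin ((enorm u)^-1 *: u).
  rewrite subr0 enormZ ger0_norm ?invr_ge0 ?enorm_ge0// mulVf ?gt_eqF// lexx => /(_ isT).
  by rewrite quadZ exprVn mulrC ler_pdivlMr ?exprn_gt0// sqr_enorm.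
exists v, l; split => //.
pose B := S - l%:M.
have sB : B^T = B by rewrite /B raddfB/= sS tr_scalar_mx.
have BE u : B *m u = S *m u - l *: u by rewrite mulmxBl mul_scalar_mx.
have qB u : quad B u = quad S u - l * dot u u by rewrite /quad BE dotBr dotZr.
have qB0 u : 0 <= quad B u by rewrite qB subr_ge0.
apply/eqP; rewrite -subr_eq0 -BE; apply/eqP/dot_eq0.
have := psd_CS (B *m v) v sB qB0.
rewrite (qB v) vv mulr1 subrr mulr0 => H; apply/eqP; rewrite -sqrf_eq0.
by rewrite eq_le H sqr_ge0.
Qed.

Lemma rayleigh_max n (S : 'M[R]_n) : (0 < n)%N -> S^T = S ->
  exists v l, [/\ dot v v = 1, S *m v = l *: v &
    forall u, quad S u <= l * dot u u].
Proof.
move=> n0 sS; have [|v [l [v1 Sv lmin]]] := @rayleigh_min n (- S) n0.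
  by rewrite raddfN/= sS.
exists v, (- l); split => // [|u].
  by rewrite scaleNr -Sv mulNmx opprK.
by have := lmin u; rewrite /quad mulNmx dotNr; lra.
Qed.

Lemma eigenvalue_symE n (S : 'M[R]_n) a : S^T = S -> eigenvalue S a ->
  exists2 v : 'cV[R]_n, 0 < dot v v & S *m v = a *: v.
Proof.
move=> sS /eigenvalueP[v Sv v0]; exists v^T.
  rewrite lt_neqAle dot_ge0 andbT eq_sym; apply: contraNneq v0 => /dot_eq0.
  by move=> /(congr1 trmx); rewrite trmxK trmx0 => ->.
by have /(congr1 trmx) := Sv; rewrite trmx_mul linearZ/= sS.
Qed.

Lemma eigenvalue_sym n (S : 'M[R]_n) a (v : 'cV[R]_n) : S^T = S ->
  dot v v = 1 -> S *m v = a *: v -> eigenvalue S a.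
Proof.
move=> sS v1 Sv; apply/eigenvalueP; exists v^T.
  by have /(congr1 trmx) := Sv; rewrite trmx_mul linearZ/= sS.
apply/eqP => /(congr1 trmx); rewrite trmxK trmx0 => v0.
by move: v1; rewrite v0 dot0l => /eqP; rewrite eq_sym oner_eq0.
Qed.

(** The minimal Rayleigh quotient is an eigenvalue and bounds all the others from
    below, hence is the infimum of the spectrum. In dimension 0 both sides vanish. *)
Lemma lambda_min_le n (S : 'M[R]_n) u : S^T = S ->
  lambda_min S * dot u u <= quad S u.
Proof.
move=> sS; have [n0|n0] := posnP n.
  have -> : u = 0 by apply/matrixP => i; have := ltn_ord i; rewrite [X in (_ < X)%N]n0.
  by rewrite dot0l mulr0 quad0.
have [v [l [v1 Sv lmin]]] := rayleigh_min n0 sS.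
suff -> : lambda_min S = l by [].
apply/eqP; rewrite eq_le; apply/andP; split.
  apply: ge_inf; last exact: eigenvalue_sym Sv.
  exists l => a /eigenvalue_symE[//|w w0 Sw].
  by have := lmin w; rewrite /quad Sw dotZr ler_pM2r.
apply: lb_le_inf; first by exists l; exact: eigenvalue_sym Sv.
move=> a /eigenvalue_symE[//|w w0 Sw].
by have := lmin w; rewrite /quad Sw dotZr ler_pM2r.
Qed.

Lemma lambda_max_ge n (S : 'M[R]_n) u : S^T = S ->
  quad S u <= lambda_max S * dot u u.
Proof.
move=> sS; have [n0|n0] := posnP n.
  have -> : u = 0 by apply/matrixP => i; have := ltn_ord i; rewrite [X in (_ < X)%N]n0.
  by rewrite dot0l mulr0 quad0.
have [v [l [v1 Sv lmax]]] := rayleigh_max n0 sS.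
suff -> : lambda_max S = l by [].
apply/eqP; rewrite eq_le; apply/andP; split; last first.
  apply: ub_le_sup; last exact: eigenvalue_sym Sv.
  exists l => a /eigenvalue_symE[//|w w0 Sw].
  by have := lmax w; rewrite /quad Sw dotZr ler_pM2r.
apply: ge_sup; first by exists l; exact: eigenvalue_sym Sv.
move=> a /eigenvalue_symE[//|w w0 Sw].
by have := lmax w; rewrite /quad Sw dotZr ler_pM2r.
Qed.

(** Deflation, by induction on the rank: subtracting [l v v^T] for a top unit
    eigenvector [v] leaves a positive semidefinite matrix that kills [v]. Its square
    root [S] also kills [v], which is why the inclusion of kernels is part of the
    induction, and [S + sqrt l v v^T] then squares to [M]. *)
Lemma psd_sqrt n (M : 'M[R]_n) : M^T = M -> (forall u, 0 <= quad M u) ->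
  exists S : 'M[R]_n, [/\ S^T = S, forall u, 0 <= quad S u, S *m S = M &
     forall u : 'cV[R]_n, M *m u = 0 -> S *m u = 0].
Proof.
have [k] := ubnP (\rank M); elim: k M => // k IH M rM sM M0.
have [->|Mn0] := eqVneq M 0.
  exists 0; split => [||//|u _]; rewrite ?trmx0 ?mulmx0 ?mul0mx// => u.
  by rewrite /quad mul0mx dotC dot0l.
have n0 : (0 < n)%N.
  case: n M Mn0 {rM sM M0 IH} => // M /eqP[].
  by apply/matrixP => -[].
have [v [l [v1 Mv lmax]]] := rayleigh_max n0 sM.
have l0 : 0 < l.
  rewrite ltNge; apply: contra_neqN Mn0 => l0.
  have q0 u : quad M u = 0.
    apply/eqP; rewrite eq_le M0 andbT (le_trans (lmax u))//.
    by rewrite mulr_le0_ge0 ?dot_ge0.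
  apply/matrixP => i j; rewrite mxE.
  have := psd_CS (delta_mx i ord0) (delta_mx j ord0) sM M0.
  rewrite !q0 mulr0 -colE => H.
  have /eqP : (dot (delta_mx i ord0) (col j M)) ^+ 2 = 0.
    by apply/eqP; rewrite eq_le H sqr_ge0.
  rewrite sqrf_eq0 /dot (bigD1 i)//= big1 ?addr0 => [|a /negbTE ai].
    by rewrite !mxE !eqxx mul1r => /eqP.
  by rewrite mxE ai mul0r.
(* the orthogonal projector on the line of [v] *)
pose V := v *m v^T.
have sV : V^T = V by rewrite trmx_mul trmxK.
have VE u : V *m u = dot v u *: v.
  rewrite -mulmxA (mx11_scalar (v^T *m u)) mul_mx_scalar; congr (_ *: _).
  by rewrite dotE.
pose M' := M - l *: V.
have M'E u : M' *m u = M *m u - (l * dot v u) *: v.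
  by rewrite mulmxBl -scalemxAl VE scalerA.
have sM' : M'^T = M' by rewrite /M' raddfB/= linearZ/= sM sV.
have M'v : M' *m v = 0 by rewrite M'E v1 mulr1 Mv subrr.
have M'0 u : 0 <= quad M' u.
  have -> : quad M' u = quad M (u - dot v u *: v).
    rewrite quadD// -!scaleNr quadZ -scalemxAr dotZr Mv dotZr /quad Mv dotZr v1.
    by rewrite M'E dotBr dotZr (dotC u v); ring.
  exact: M0.
have kM u : M *m u = 0 -> dot v u = 0.
  move=> Mu; have := symmx_dot v u sM; rewrite Mu Mv dotZr dotC dot0l => /esym/eqP.
  by rewrite mulf_eq0 gt_eqF//= dotC => /eqP.
have rM' : (\rank M' < k)%N.
  apply: leq_trans (_ : (\rank M' < \rank M)%N) _; last by [].
  have : (kermx M < kermx M')%MS.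
    rewrite ltmxE; apply/andP; split.
      apply/sub_kermxP/row_matrixP => i; rewrite row_mul row0.
      have Ki : M *m (row i (kermx M))^T = 0.
        by rewrite -{1}sM -trmx_mul -row_mul mulmx_ker row0 trmx0.
      apply: trmx_inj; rewrite trmx_mul sM' M'E Ki (kM _ Ki).
      by rewrite mulr0 scale0r subr0 trmx0.
    apply/negP => H.
    have vk : (v^T <= kermx M')%MS.
      by apply/sub_kermxP; rewrite -sM' -trmx_mul M'v trmx0.
    have /sub_kermxP := submx_trans vk H.
    move=> /(congr1 trmx); rewrite trmx_mul trmxK sM Mv trmx0 => /(congr1 (dot v)).
    rewrite dotZr v1 mulr1 dotC dot0l => l00.
    by rewrite l00 ltxx in l0.
  move/rank_ltmx; rewrite !mxrank_ker => H.
  have := rank_leq_row M; have := rank_leq_row M'; lia.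
have [S [sS S0 SS kS]] := IH _ rM' sM' M'0.
have Sv : S *m v = 0 by exact: kS.
pose q := Num.sqrt l.
exists (S + q *: V); split.
- by rewrite raddfD/= linearZ/= sS sV.
- move=> u; rewrite /quad mulmxDl dotDr -scalemxAl dotZr VE dotZr (dotC u v).
  by rewrite addr_ge0 ?S0// mulr_ge0 ?sqrtr_ge0// -expr2 sqr_ge0.
- have SV : S *m V = 0 by rewrite mulmxA Sv mul0mx.
  have VS : V *m S = 0 by apply: trmx_inj; rewrite trmx_mul sS sV SV trmx0.
  have VV : V *m V = V.
    rewrite -{1}/V -mulmxA (mulmxA v^T) (mx11_scalar (v^T *m v)) dotE v1.
    by rewrite mul1mx.
  rewrite mulmxDl !mulmxDr SS -!scalemxAr -!scalemxAl SV VS VV !scaler0 addr0 add0r.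
  by rewrite scalerA -expr2 sqr_sqrtr ?ltW// /M' subrK.
- move=> u Mu; rewrite mulmxDl -scalemxAl VE (kM _ Mu) scale0r scaler0 addr0.
  by apply: kS; rewrite M'E Mu (kM _ Mu) mulr0 scale0r subr0.
Qed.

(** The chosen square root exists, so the default value is not reached; it is definite
    because [S u = 0] would give [M u = S (S u) = 0]. *)
Lemma sqrtmxP n (M : 'M[R]_n) : posdefmx M ->
  posdefmx (sqrtmx M) /\ sqrtmx M *m sqrtmx M = M.
Proof.
move=> [sM Mpos].
have M0 u : 0 <= quad M u.
  have [->|u0] := eqVneq u 0; first by rewrite quad0.
  by rewrite -quadE ltW// Mpos.
have [S [sS S0 SS kS]] := psd_sqrt sM M0.
rewrite /sqrtmx; case: xgetP => [T -> //|/(_ S)]; case.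
split => //; split => // u u0; rewrite quadE lt_neqAle S0 andbT eq_sym.
apply/eqP => Su; have := psd_CS (S *m u) u sS S0.
rewrite Su mulr0 => H.
have /eqP : (dot (S *m u) (S *m u)) ^+ 2 = 0 by apply/eqP; rewrite eq_le H sqr_ge0.
rewrite sqrf_eq0 => /eqP/dot_eq0 Su0.
have := Mpos _ u0; rewrite quadE /quad -SS -mulmxA Su0 mulmx0 dotC dot0l.
by rewrite ltxx.
Qed.

Lemma unitmx_of_ker0 n (H : 'M[R]_n) : (forall z : 'cV[R]_n, H *m z = 0 -> z = 0) ->
  H \in unitmx.
Proof.
move=> H0; rewrite -unitmx_tr -row_free_unit -kermx_eq0; apply/eqP/row_matrixP => i.
rewrite row0; apply: trmx_inj; rewrite trmx0; apply: H0.
by rewrite -{1}[H]trmxK -trmx_mul -row_mul mulmx_ker row0 trmx0.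
Qed.

Lemma posdef_unitmx n (S : 'M[R]_n) : posdefmx S -> S \in unitmx.
Proof.
move=> [sS S0]; apply: unitmx_of_ker0 => z Sz.
apply/eqP/negPn/negP => /S0; rewrite quadE /quad Sz dotC dot0l.
by rewrite ltxx.
Qed.

(** Whitening: [M^(-1/2) a] has unit [M]-norm when [a] is a unit vector. *)
Lemma quad_sqrtmx_inv n (M : 'M[R]_n) (a : 'cV[R]_n) : posdefmx M ->
  quad M (invmx (sqrtmx M) *m a) = dot a a.
Proof.
move=> pM; have [pS SS] := sqrtmxP pM.
have uS := posdef_unitmx pS.
rewrite /quad -{2}SS -mulmxA mulKVmx// dot_trmx; case: pS => -> _.
by rewrite mulKVmx.
Qed.

Lemma sqrtmx_inv_sym n (M : 'M[R]_n) : posdefmx M ->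
  (invmx (sqrtmx M))^T = invmx (sqrtmx M).
Proof. by move=> pM; have [[sS _] _] := sqrtmxP pM; rewrite trmx_inv sS. Qed.

End Spectral.

(** * Expectation of real functions *)

Section Expectation.
Context d (T : measurableType d) (R : realType) (P : probability T R).

Implicit Types f g : T -> R.

Definition integ (f : T -> R) : Prop := P.-integrable [set: T] (EFin \o f).
Definition Ex (f : T -> R) : R := \int[P]_w f w.

Lemma integ_measurable f : integ f -> measurable_fun setT f.
Proof. by move=> /measurable_int/measurable_EFinP. Qed.

Lemma integ_le f g : measurable_fun setT f -> (forall w, `|f w| <= `|g w|) ->
  integ g -> integ f.
Proof.
move=> mf fg; apply: le_integrable => //; first exact/measurable_EFinP.
by move=> w _; rewrite /= lee_fin.
Qed.

Lemma integ_cst k : integ (cst k).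
Proof. exact: finite_measure_integrable_cst. Qed.

Lemma integ_bounded f K : measurable_fun setT f -> (forall w, `|f w| <= K) -> integ f.
Proof.
move=> mf fK; apply: (integ_le mf _ (integ_cst K)) => w.
exact: le_trans (fK w) (ler_norm _).
Qed.

Lemma integD f g : integ f -> integ g -> integ (fun w => f w + g w).
Proof. by move=> If Ig; exact: (integrableD measurableT If Ig). Qed.

Lemma integZ k f : integ f -> integ (fun w => k * f w).
Proof. by move=> If; exact: (integrableZl measurableT k If). Qed.

Lemma integN f : integ f -> integ (fun w => - f w).
Proof. by move=> If; exact: (integrableN If). Qed.

Lemma integB f g : integ f -> integ g -> integ (fun w => f w - g w).
Proof. by move=> If Ig; apply: integD => //; exact: integN. Qed.

Lemma integ_norm f : integ f -> integ (fun w => `|f w|).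
Proof. by move=> If; exact: integrable_norm. Qed.

Lemma integ_sum (I : Type) (r : seq I) (Q : pred I) (F : I -> T -> R) :
  (forall i, Q i -> integ (F i)) -> integ (fun w => \sum_(i <- r | Q i) F i w).
Proof.
move=> IF; rewrite /integ.
have -> : EFin \o (fun w => \sum_(i <- r | Q i) F i w) =
    (fun w => \sum_(i <- r | Q i) (F i w)%:E)%E.
  by apply/funext => w; rewrite /= sumEFin.
exact: integrable_sum.
Qed.

Lemma ExD f g : integ f -> integ g -> Ex (fun w => f w + g w) = Ex f + Ex g.
Proof. by move=> If Ig; exact: RintegralD. Qed.

Lemma ExB f g : integ f -> integ g -> Ex (fun w => f w - g w) = Ex f - Ex g.
Proof. by move=> If Ig; exact: RintegralB. Qed.

Lemma ExZ k f : integ f -> Ex (fun w => k * f w) = k * Ex f.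
Proof. by move=> If; exact: RintegralZl. Qed.

Lemma Ex_cst k : Ex (fun=> k) = k.
Proof.
rewrite /Ex Rintegral_cst// -[RHS]mulr1; congr (_ * _).
by rewrite -[RHS]/(fine 1%E); congr fine; exact: probability_setT.
Qed.

Lemma Ex_sum (I : Type) (r : seq I) (Q : pred I) (F : I -> T -> R) :
  (forall i, Q i -> integ (F i)) ->
  Ex (fun w => \sum_(i <- r | Q i) F i w) = \sum_(i <- r | Q i) Ex (F i).
Proof.
move=> IF; elim: r => [|i r IH].
  by rewrite big_nil; under [LHS]eq_Rintegral do rewrite big_nil; exact: Ex_cst.
rewrite big_cons -IH; case: ifPn => Qi; last first.
  by apply: eq_Rintegral => w _; rewrite big_cons (negbTE Qi).
rewrite -ExD; [|exact: IF|exact: integ_sum].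
by apply: eq_Rintegral => w _; rewrite big_cons Qi.
Qed.

Lemma le_Ex f g : integ f -> integ g -> (forall w, f w <= g w) -> Ex f <= Ex g.
Proof. by move=> If Ig fg; apply: le_Rintegral => // w _; exact: fg. Qed.

Lemma Ex_ge0 f : (forall w, 0 <= f w) -> 0 <= Ex f.
Proof. by move=> f0; apply: Rintegral_ge0 => w _; exact: f0. Qed.

Lemma norm_Ex f : integ f -> `|Ex f| <= Ex (fun w => `|f w|).
Proof. by move=> If; exact: le_normr_Rintegral. Qed.

Lemma norm_Ex_le f g : integ f -> integ g -> (forall w, `|f w| <= g w) ->
  `|Ex f| <= Ex g.
Proof.
move=> If Ig fg; apply: (le_trans (norm_Ex If)).
by apply: le_Ex => //; exact: integ_norm.
Qed.

Lemma eq_Ex f g : f =1 g -> Ex f = Ex g.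
Proof. by move=> /funext ->. Qed.

Lemma ExE f : integ f -> (\int[P]_w (f w)%:E)%E = (Ex f)%:E.
Proof. by move=> If; rewrite /Ex /Rintegral fineK//; exact: integrable_fin_num. Qed.

(** A difference of extended reals is a real number only when both terms are, so the
    integrals of the positive and negative parts are finite. This is how the moment
    equations of the model yield integrability. *)
Lemma integral_fin_integ f r : measurable_fun setT f ->
  (\int[P]_w (f w)%:E)%E = r%:E -> integ f /\ Ex f = r.
Proof.
move=> mf fr; split; last by rewrite /Ex /Rintegral fr.
have mF : measurable_fun setT (EFin \o f) by exact/measurable_EFinP.
apply/integrableP; split => //.
have -> : (\int[P]_x `|(EFin \o f) x| =
    \int[P]_x ((EFin \o f)^\+ x + (EFin \o f)^\- x))%E.
  by apply: eq_integral => x _; rewrite -[LHS]/((abse \o (EFin \o f)) x) fune_abse.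
rewrite ge0_integralD//; [|exact: measurable_funepos|exact: measurable_funeneg].
rewrite integralE in fr; move: fr.
have : (0 <= \int[P]_x (EFin \o f)^\+ x)%E by exact: integral_ge0.
have : (0 <= \int[P]_x (EFin \o f)^\- x)%E by exact: integral_ge0.
case: (\int[P]_x (EFin \o f)^\+ x)%E => [a||]; case: (\int[P]_x (EFin \o f)^\- x)%E => [b||] //=.
by move=> _ _ _; rewrite -?EFinD ltry.
Qed.

Lemma markov_ge f (a b : R) : integ f -> (forall w, 0 <= f w) -> 0 < a -> Ex f <= a * b ->
  (P [set w | (a <= f w)%R] <= b%:E)%E.
Proof.
move=> If f0 a0 fb; have mf := integ_measurable If.
have mA : measurable [set w | a <= f w].
  rewrite -[X in measurable X]setTI.
  have -> : [set w | a <= f w] = f @^-1` `[a, +oo[%classic.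
    by apply/seteqP; split => w /=; rewrite in_itv/= andbT.
  exact: mf.
have : Ex (fun w => a * \1_[set w | a <= f w] w) <= Ex f.
  apply: le_Ex => //.
    by apply: integZ; exact: integrable_indic.
  move=> w; rewrite indicE; case: (boolP (w \in _)) => [|_].
    by rewrite inE mulr1.
  by rewrite mulr0.
rewrite ExZ; last exact: integrable_indic.
have -> : Ex (\1_[set w | a <= f w]) = fine (P [set w | a <= f w]).
  by rewrite /Ex /Rintegral integral_indic// setIT.
move=> H; rewrite -[P _]fineK ?fin_num_measure// lee_fin.
by have := le_trans H fb; rewrite ler_pM2l.
Qed.

(** [|f| <= 1 + f^2]. *)
Lemma integ_sq f : measurable_fun setT f -> integ (fun w => f w ^+ 2) -> integ f.
Proof.
move=> mf f2; apply: (@integ_le _ (fun w => 1 + f w ^+ 2)) => //.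
  move=> w; rewrite [leRHS]ger0_norm ?addr_ge0 ?sqr_ge0//.
  rewrite -[f w ^+ 2]real_normK ?num_real//.
  have := sqr_ge0 (`|f w| - 1); have := normr_ge0 (f w); nra.
by apply: integD => //; exact: integ_cst.
Qed.

Lemma integ_mul f g : measurable_fun setT f -> measurable_fun setT g ->
  integ (fun w => f w ^+ 2) -> integ (fun w => g w ^+ 2) ->
  integ (fun w => f w * g w).
Proof.
move=> mf mg f2 g2; apply: (integ_le _ _ (integD f2 g2)).
  exact: measurable_funM.
move=> w; rewrite [leRHS]ger0_norm ?addr_ge0 ?sqr_ge0// normrM.
rewrite -[f w ^+ 2]real_normK ?num_real// -[g w ^+ 2]real_normK ?num_real//.
by have := sqr_ge0 (`|f w| - `|g w|); have := normr_ge0 (f w); have := normr_ge0 (g w); nra.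
Qed.

Lemma integ_sqD f g : measurable_fun setT f -> measurable_fun setT g ->
  integ (fun w => f w ^+ 2) -> integ (fun w => g w ^+ 2) ->
  integ (fun w => (f w + g w) ^+ 2).
Proof.
move=> mf mg f2 g2.
have -> : (fun w => (f w + g w) ^+ 2) =
    (fun w => (f w ^+ 2 + 2 * (f w * g w)) + g w ^+ 2).
  by apply/funext => w; ring.
by apply: integD => //; apply: integD => //; apply: integZ; exact: integ_mul.
Qed.

Lemma integ_sqZ k f : integ (fun w => f w ^+ 2) -> integ (fun w => (k * f w) ^+ 2).
Proof. by move=> f2; under eq_fun do rewrite exprMn; exact: integZ. Qed.

Lemma integ_sq_sum (I : Type) (r : seq I) (Q : pred I) (F : I -> T -> R) :
  (forall i, measurable_fun setT (F i)) ->
  (forall i, integ (fun w => F i w ^+ 2)) ->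
  integ (fun w => (\sum_(i <- r | Q i) F i w) ^+ 2).
Proof.
move=> mF F2; elim: r => [|i r IH].
  by under eq_fun do rewrite big_nil expr0n; exact: integ_cst.
under eq_fun do rewrite big_cons.
case: (Q i) => //; apply: integ_sqD => //.
under eq_fun do rewrite big_mkcond.
apply: measurable_sum => j; case: (Q j) => //; exact: measurable_cst.
Qed.

Definition indep2 (U V : T -> R) : Prop := forall A B : set R,
  measurable A -> measurable B ->
  P ((U @^-1` A) `&` (V @^-1` B)) = (P (U @^-1` A) * P (V @^-1` B))%E.

Section Product.
Variables U V : T -> R.
Hypotheses (mU : measurable_fun setT U) (mV : measurable_fun setT V).
Hypothesis UV : indep2 U V.
Hypotheses (IU : integ U) (IV : integ V).

Let gU : {mfun T >-> R} := mfun_Sub (mem_set mU).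
Let gV : {mfun T >-> R} := mfun_Sub (mem_set mV).
Let mUV : measurable_fun setT (fun w => (U w, V w)).
Proof. exact: measurable_fun_pair. Qed.
Let gUV : {mfun T >-> (R * R)%type} := mfun_Sub (mem_set mUV).

Let lawE (X : set (R * R)) : measurable X ->
  (distribution P gU \x distribution P gV)%E X = distribution P gUV X.
Proof. by move=> mX; apply: product_measure_unique. Qed.

Let g (z : R * R) := (z.1 * z.2)%:E.
Let mg : measurable_fun setT g.
Proof.
apply/measurable_EFinP; apply: measurable_funM.
  exact: measurable_fst.
exact: measurable_snd.
Qed.

Let lint (W : {mfun T >-> R}) : integ W ->
  (distribution P W).-integrable setT (EFin : R -> \bar R).
Proof.
move=> IW; apply/integrableP; split.
  by apply/measurable_EFinP; exact: measurable_id.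
rewrite (ge0_integral_distribution W)//.
  by case/integrableP : IW.
apply: measurableT_comp => //; apply/measurable_EFinP; exact: measurable_id.
Qed.

Let iprod : (distribution P gU \x distribution P gV)%E.-integrable setT g.
Proof.
apply/(integrable12ltyP _ _ mg).
have := @lint gU IU; have := @lint gV IV.
move=> /integrableP[_ V1] /integrableP[_ U1].
have mE : measurable_fun [set: R] (fun y : R => `|y%:E|)%E.
  by apply: measurableT_comp => //; apply/measurable_EFinP; exact: measurable_id.
pose I := (\int[distribution P gV]_y `|y%:E|)%E.
have I0 : (0 <= I)%E by exact: integral_ge0.
have -> : (\int[distribution P gU]_x \int[distribution P gV]_y `|g (x, y)| =
    \int[distribution P gU]_x (`|x%:E| * I))%E.
  apply: eq_integral => x _; rewrite -ge0_integralZl//.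
  by apply: eq_integral => y _; rewrite /g/= normrM EFinM.
rewrite ge0_integralZr//.
by rewrite lte_mul_pinfty ?integral_ge0// ge0_fin_numE// integral_ge0.
Qed.

Lemma indep2_integ : integ (fun w => U w * V w).
Proof.
apply/integrableP; split; first by apply/measurable_EFinP; exact: measurable_funM.
have -> : (\int[P]_x `|(U x * V x)%R%:E| =
    \int[P]_x ((fun z => `|g z|) \o gUV) x)%E by [].
rewrite -(ge0_integral_distribution gUV)//; last exact: measurableT_comp.
have /integrableP[_] := iprod.
congr (_ < _)%E; apply: eq_measure_integral => A mA _; exact: lawE.
Qed.

(** Independence says that the law of the pair is the product of the laws; Fubini's
    theorem then factors the integral of the coordinate product. *)
Lemma indep2_Ex : Ex (fun w => U w * V w) = Ex U * Ex V.
Proof.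
apply: EFin_inj; rewrite EFinM -!ExE//; last exact: indep2_integ.
have -> : (\int[P]_w (U w * V w)%R%:E = \int[P]_x (g \o gUV) x)%E by [].
rewrite -(@integral_distribution _ _ _ _ _ P gUV g)//; last exact: indep2_integ.
have -> : (\int[distribution P gUV]_y g y =
   \int[distribution P gU \x distribution P gV]_y g y)%E.
  by apply: eq_measure_integral => A mA _; exact/esym/lawE.
rewrite -integral12_prod_meas1//.
have lE (W : {mfun T >-> R}) : integ W ->
    (\int[distribution P W]_y y%:E = \int[P]_w (W w)%:E)%E.
  by move=> IW; rewrite (@integral_distribution _ _ _ _ _ P W)//.
rewrite /fubini_F.
have -> : (\int[distribution P gU]_x \int[distribution P gV]_y g (x, y) =
    \int[distribution P gU]_x (x%:E * (Ex V)%:E))%E.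
  apply: eq_integral => x _; rewrite -(ExE IV) -(lE gV)// -integralZl//.
  exact: (@lint gV IV).
rewrite integralZr//; last exact: (@lint gU IU).
by rewrite (lE gU)// !ExE.
Qed.

End Product.
End Expectation.

(** * Independent sequences and second moments *)

Section Independence.
Context d (T : measurableType d) (R : realType) (P : probability T R).
Implicit Types f g : T -> R.

Definition indep_seq n (U : 'I_n -> T -> R) : Prop :=
  forall B : 'I_n -> set R, (forall i, measurable (B i)) ->
  P (\bigcap_(i in [set: 'I_n]) (U i @^-1` B i)) =
  (\prod_(i < n) P (U i @^-1` B i))%E.

Lemma preim_measurable f (B : set R) : measurable_fun setT f -> measurable B ->
  measurable (f @^-1` B).
Proof. by move=> mf mB; rewrite -[_ @^-1` _]setTI; exact: mf. Qed.

Section Group.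
Variables (n : nat) (U : 'I_n -> T -> R).
Hypotheses (mU : forall i, measurable_fun setT (U i)) (iU : indep_seq U).

Let cyl (C : 'I_n -> set R) := \bigcap_(k in [set: 'I_n]) (U k @^-1` C k).

Let mcyl C : (forall k, measurable (C k)) -> measurable (cyl C).
Proof.
move=> mC; apply: fin_bigcap_measurable => [|k _]; first exact: finite_finset.
exact: preim_measurable.
Qed.

Lemma indep_seq_pair i k : i != k -> indep2 P (U i) (U k).
Proof.
move=> ik A B mA mB.
(* an event on two coordinates is a product event with the other factors full *)
pose C j := if j == i then A else if j == k then B else setT.
have mC j : measurable (C j) by rewrite /C; case: eqP => // _; case: eqP.
have -> : (U i @^-1` A) `&` (U k @^-1` B) = cyl C.
  apply/seteqP; split => [w [Aw Bw] j _|w Cw]/=.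
    by rewrite /C; case: eqP => [-> //|_]; case: eqP => [-> //|_].
  split; first by have := Cw i Logic.I; rewrite /C/= eqxx.
  by have := Cw k Logic.I; rewrite /C/= eqxx eq_sym (negbTE ik).
rewrite iU// (bigD1 i)//= (bigD1 k) 1?eq_sym//= big1 => [|j /andP[ji jk]].
  by rewrite /C eqxx eq_sym (negbTE ik) eqxx mule1.
by rewrite /C (negbTE ji) (negbTE jk) preimage_setT probability_setT.
Qed.

Section OneOut.
Variable i : 'I_n.

Let G : set (set T) :=
  [set A | exists C, [/\ forall k, measurable (C k), C i = setT & A = cyl C]].

Let setIG : setI_closed G.
Proof.
move=> _ _ [C [mC Ci ->]] [D [mD Di ->]]; exists (fun k => C k `&` D k); split.
- by move=> k; exact: measurableI.
- by rewrite Ci Di setTI.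
- apply/seteqP; split => [w [Cw Dw] k _|w CDw]; first by split; [exact: Cw|exact: Dw].
  by split=> k kT; have [] := CDw k kT.
Qed.

Let GT : G setT.
Proof.
exists (fun=> setT); split => //.
by apply/seteqP; split.
Qed.

Let GU k : k != i -> measurable_fun [set: g_sigma_algebraType G] (U k : g_sigma_algebraType G -> R).
Proof.
move=> ki _ B mB; rewrite setTI; apply: sub_sigma_algebra.
exists (fun j => if j == k then B else setT); split.
- by move=> j; case: eqP.
- by rewrite eq_sym (negbTE ki).
- apply/seteqP; split => [w Bw j _|w]/=; first by case: eqP => // ->.
  by move=> /(_ k Logic.I); rewrite /= eqxx.
Qed.

(** The cylinders over the coordinates other than [i] form a pi-system [G], on which
    independence from [U i] is the product rule. It extends to the sigma-algebra
    generated by [G], for which the sum of the other coordinates is measurable. *)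
Lemma indep_seq_others : indep2 P (U i) (fun w => \sum_(k | k != i) U k w).
Proof.
move=> B V mB mV.
have mD := preim_measurable (mU i) mB.
have mW : measurable_fun [set: g_sigma_algebraType G]
    ((fun w => \sum_(k | k != i) U k w) : g_sigma_algebraType G -> R).
  under eq_fun do rewrite big_mkcond.
  apply: measurable_sum => k; have [_|ki] := eqVneq k i; first exact: measurable_cst.
  exact: GU.
have GW : <<s G >> ((fun w => \sum_(k | k != i) U k w) @^-1` V).
  by have := mW measurableT V mV; rewrite setTI.
have PD0 : (0 <= fine (P (U i @^-1` B)))%R by rewrite fine_ge0.
pose r : {nonneg R} := NngNum PD0.
have Gm : G `<=` measurable by move=> _ [C [mC _ ->]]; exact: mcyl.
have := @g_sigma_algebra_measure_unique _ R T G Gm (fun=> setT) (fun=> GT) _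
  (mrestr P mD) (mscale r P) setIG _ _ _ GW.
have rE : (r%:num%:E = P (U i @^-1` B))%E.
  by rewrite -[RHS]fineK ?fin_num_measure.
move=> H; rewrite setIC -rE; apply: H => //; first exact: bigcup_const.
- move=> _ [C [mC Ci ->]].

  (* [C i] is full, so the intersection is the cylinder with [B] in position [i] *)
  pose C' k := if k == i then B else C k.
  have E : cyl C `&` U i @^-1` B = cyl C'.
    apply/seteqP; split => [w [Cw Bw] k _|w CBw]/=.
      by rewrite /C'; case: eqP => [->|_] //; exact: Cw.
    split=> [k kT|].
      have := CBw k kT; rewrite /C'/=; case: eqP => [-> _|//].
      by rewrite /= Ci.
    by have := CBw i Logic.I; rewrite /C'/= eqxx.
  transitivity (P (cyl C')); first by congr (P _).
  transitivity (P (U i @^-1` B) * P (cyl C))%E; last by rewrite -rE.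
  rewrite !iU//; last by move=> k; rewrite /C'; case: eqP.
  rewrite (bigD1 i)//= {1}/C' eqxx [in RHS](bigD1 i)//= Ci preimage_setT probability_setT mul1e.
  by congr (_ * _)%E; apply: eq_bigr => k /negbTE; rewrite /C' => ->.
- by move=> _; apply: (le_lt_trans (probability_le1 P _)); [exact: measurableI|exact: ltry].
Qed.

End OneOut.
End Group.

Section SecondMoment.
Variables (n : nat) (U : 'I_n -> T -> R).
Hypotheses (mU : forall i, measurable_fun setT (U i)) (iU : indep_seq U).
Hypothesis U2 : forall i, integ P (fun w => U i w ^+ 2).
Hypothesis U0 : forall i, Ex P (U i) = 0.

Lemma Ex_sq_sum (c : 'I_n -> R) :
  Ex P (fun w => (\sum_i U i w * c i) ^+ 2) = \sum_i Ex P (fun w => U i w ^+ 2) * c i ^+ 2.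
Proof.
have IU i : integ P (U i) by exact: integ_sq.
have Iij i j : integ P (fun w => c i * c j * (U i w * U j w)).
  by apply: integZ; exact: integ_mul.
rewrite (@eq_Ex _ _ _ _ _ (fun w => \sum_i \sum_j c i * c j * (U i w * U j w))); last first.
  move=> w; rewrite expr2 mulr_suml; apply: eq_bigr => i _.
  by rewrite mulr_sumr; apply: eq_bigr => j _; ring.
rewrite Ex_sum; last by move=> i _; exact: integ_sum.
apply: eq_bigr => i _; rewrite Ex_sum// (bigD1 i)//= big1 ?addr0 => [|j ji].
  rewrite ExZ; last exact: integ_mul.
  by rewrite mulrC -expr2; congr (_ * _); apply: eq_Ex => w; rewrite expr2.
rewrite ExZ; last exact: integ_mul.
by rewrite indep2_Ex// ?U0 ?mul0r ?mulr0//; apply: indep_seq_pair => //; rewrite eq_sym.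
Qed.

Lemma integ_sq_sum_mx p q (A : 'I_n -> 'M[R]_(p, q)) :
  integ P (fun w => enorm (\sum_i U i w *: A i) ^+ 2).
Proof.
under eq_fun do rewrite sqr_enorm_mx.
apply: integ_sum => a _; apply: integ_sum => b _.
have -> : (fun w => (\sum_i U i w *: A i) a b ^+ 2) =
    (fun w => (\sum_i A i a b * U i w) ^+ 2).
  apply/funext => w; rewrite summxE; congr (_ ^+ 2); apply: eq_bigr => i _.
  by rewrite mxE mulrC.
apply: integ_sq_sum => i; first exact: measurable_funM.
exact: integ_sqZ.
Qed.

(** The cross terms vanish, so Frobenius norms add up like variances. *)
Lemma Ex_sq_sum_mx p q (A : 'I_n -> 'M[R]_(p, q)) :
  Ex P (fun w => enorm (\sum_i U i w *: A i) ^+ 2) =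
  \sum_i Ex P (fun w => U i w ^+ 2) * enorm (A i) ^+ 2.
Proof.
have E w a b : (\sum_i U i w *: A i) a b = \sum_i U i w * A i a b.
  by rewrite summxE; apply: eq_bigr => i _; rewrite mxE.
rewrite (@eq_Ex _ _ _ _ _ (fun w => \sum_a \sum_b (\sum_i U i w * A i a b) ^+ 2)); last first.
  by move=> w; rewrite sqr_enorm_mx; do 2 (apply: eq_bigr => ? _); rewrite E.
have I a b : integ P (fun w => (\sum_i U i w * A i a b) ^+ 2).
  apply: integ_sq_sum => i; first exact: measurable_funM.
  under eq_fun do rewrite mulrC; exact: integ_sqZ.
rewrite Ex_sum; last by move=> a _; exact: integ_sum.
under eq_bigr do rewrite Ex_sum//.
under [RHS]eq_bigr do rewrite sqr_enorm_mx mulr_sumr.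
rewrite [RHS]exchange_big/=; apply: eq_bigr => a _.
under [RHS]eq_bigr do rewrite mulr_sumr.
rewrite [RHS]exchange_big/=; apply: eq_bigr => b _.
exact: Ex_sq_sum.
Qed.

End SecondMoment.

(** The generating family of the sigma-algebra in which the product rule for random
    vectors is stated. *)
Definition gen_sigma m (Z : 'I_m -> T -> R) : set (set T) :=
  \big[setU/set0]_(j < m) preimage_set_system setT (Z j) measurable.

Definition adapted m (Z : 'I_m -> T -> R) f : Prop :=
  measurable_fun [set: g_sigma_algebraType (gen_sigma Z)]
    (f : g_sigma_algebraType (gen_sigma Z) -> R).

Lemma adapted_coord m (Z : 'I_m -> T -> R) j : adapted Z (Z j).
Proof.
move=> _ B mB; rewrite setTI; apply: sub_sigma_algebra.
rewrite /gen_sigma (bigD1 j)//=; left.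
by exists B => //; rewrite setTI.
Qed.

Lemma independent_vectors_seq n m (Y : 'I_n -> 'I_m -> T -> R) (U : 'I_n -> T -> R) :
  independent_vectors P Y -> (forall i, adapted (Y i) (U i)) -> indep_seq U.
Proof.
move=> iY aU B mB; apply: iY => i.
by have := aU i measurableT (B i) (mB i); rewrite setTI.
Qed.

End Independence.

(** * Gaussian tails and Mills ratio *)

Section Mills.
Context {R : realType}.
Local Notation mu := (@lebesgue_measure R).
Local Notation phi := (@normal_pdf R 0 1).
Local Notation c := (@normal_peak R 1).

Lemma phiE x : phi x = c * expR (- (x ^+ 2 / 2)).
Proof.
rewrite normal_pdfE ?oner_neq0// /normal_fun subr0 expr1n mulNr.
by rewrite -[1 *+ 2]/(2%:R).
Qed.

Lemma phi_peak_gt0 : 0 < c.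
Proof. by rewrite normal_peak_gt0 ?oner_neq0. Qed.

Lemma phi_gt0 x : 0 < phi x.
Proof. by rewrite phiE mulr_gt0 ?phi_peak_gt0 ?expR_gt0. Qed.

Lemma phi_neq0 x : phi x != 0.
Proof. by rewrite gt_eqF ?phi_gt0. Qed.

Lemma phiN x : phi (- x) = phi x.
Proof. by rewrite !phiE sqrrN. Qed.

Global Instance is_derive_phi x : is_derive x (1 : R) phi (- x * phi x).
Proof.
have -> : phi = (fun x => c * expR (- (x ^+ 2 / 2))) by apply/funext => y; exact: phiE.
by apply: is_derive_eq; rewrite /GRing.scale/=; field.
Qed.

Lemma continuous_phi : continuous phi.
Proof. exact: continuous_normal_pdf (oner_neq0 _). Qed.

Definition tail x := \int[mu]_(t in `[x, +oo[) phi t.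

Lemma integrable_phi (A : set R) : measurable A -> mu.-integrable A (EFin \o phi).
Proof.
move=> mA; apply: (@integrableS _ _ _ mu setT) => //.
exact: (integrable_normal_pdf 0 1).
Qed.

Lemma continuous_tail_integrand (x : R) : 0 < x ->
  {within `[x, +oo[, continuous (fun t => phi t * (1 + t^-1 ^+ 2))}.
Proof.
move=> x0; apply: continuous_in_subspaceT => t; rewrite inE/= in_itv/= andbT => xt.
have t0 := lt_le_trans x0 xt.
apply: cvgM; first exact: continuous_phi.
apply: cvgD; first exact: cvg_cst.
apply: (@continuous_comp _ _ _ (fun y : R => y^-1) (fun z : R => z ^+ 2)).
  by apply: inv_continuous; rewrite gt_eqF.
exact: sqr_continuous.
Qed.

(** As [phi' t = - t * phi t], the function [- phi t / t] is a primitive of the integrand.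
    The factor [1 + t^-2] lies between 1 and its value at [x], which brackets the tail. *)
Lemma phi_tail_identity (x : R) : 0 < x ->
  (\int[mu]_(t in `[x, +oo[) (phi t * (1 + t^-1 ^+ 2))%:E = (phi x / x)%:E)%E.
Proof.
move=> x0.
pose F t := - (phi t * t^-1).
have dF (t : R) : 0 < t -> is_derive t (1 : R) F (phi t * (1 + t^-1 ^+ 2)).
  move=> t0; have tn0 : t != 0 by rewrite gt_eqF.
  have dV := is_deriveV tn0 (is_derive_id t 1).
  apply: is_derive_eq.
  by rewrite /GRing.scale/=; field.
have cF (t : R) : 0 < t -> {for t, continuous F}.
  move=> t0; apply: differentiable_continuous; apply/derivable1_diffP.
  exact: (@ex_derive _ _ _ _ _ _ _ (dF t t0)).
rewrite (@ge0_continuous_FTC2y R _ F _ 0)//.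
- by rewrite /F EFinN oppeK add0e.
- move=> t xt; by rewrite mulr_ge0 ?(ltW (phi_gt0 _))// addr_ge0 ?sqr_ge0.
- exact: continuous_tail_integrand.
- apply/cvgrPdist_le => e e0; near=> t.
  have t0 : 0 < t by near: t; exact: nbhs_pinfty_gt.
  rewrite sub0r opprK ger0_norm; last by rewrite mulr_ge0 ?invr_ge0 ?(ltW (phi_gt0 _))// ltW.
  rewrite ler_pdivrMr//; apply: (le_trans (normal_pdf_ub _ _ (oner_neq0 _))).
  rewrite mulrC -ler_pdivrMr//; near: t; exact: nbhs_pinfty_ge.
- by move=> t xt; exact: (@ex_derive _ _ _ _ _ _ _ (dF t (lt_trans x0 xt))).
- apply: cvg_at_right_filter; exact: cF.
- move=> t; rewrite in_itv/= andbT => xt.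
  by rewrite derive1E; exact: (@derive_val _ _ _ _ _ _ _ (dF t (lt_trans x0 xt))).
Unshelve. all: by end_near. Qed.

Lemma tail_ub x : 0 < x -> tail x <= phi x / x.
Proof.
move=> x0; rewrite -[leRHS]/(fine (phi x / x)%:E) -phi_tail_identity//.
rewrite /tail /Rintegral; apply: fine_le.
- exact: integrable_fin_num (integrable_phi _).
- by rewrite phi_tail_identity.
- apply: ge0_le_integral => //.
  + by move=> t _; rewrite lee_fin ltW ?phi_gt0.
  + by apply/measurable_EFinP; apply: measurable_funTS; exact: measurable_normal_pdf.
  + apply/measurable_EFinP; apply: subspace_continuous_measurable_fun => //.
    exact: continuous_tail_integrand.
  + by move=> t _; rewrite lee_fin ler_peMr ?(ltW (phi_gt0 _))// lerDl sqr_ge0.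
Qed.

Lemma tail_lb x : 0 < x -> phi x / x <= tail x * (1 + x^-1 ^+ 2).
Proof.
move=> x0; rewrite -[leLHS]/(fine (phi x / x)%:E) -phi_tail_identity//.
have I := @integrable_phi `[x, +oo[%classic (measurable_itv _).
rewrite /tail -RintegralZr// /Rintegral; apply: fine_le.
- by rewrite phi_tail_identity.
- apply: integrable_fin_num => //; exact: (integrableZr _ (1 + x^-1 ^+ 2) I).
- apply: ge0_le_integral => //.
  + by move=> t _; rewrite lee_fin mulr_ge0 ?(ltW (phi_gt0 _))// addr_ge0// sqr_ge0.
  + apply/measurable_EFinP; apply: subspace_continuous_measurable_fun => //.
    exact: continuous_tail_integrand.
  + apply/measurable_EFinP; apply: measurable_funTS; apply: measurable_funM => //.
    exact: measurable_normal_pdf.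
  + move=> t; rewrite /= in_itv/= andbT => xt; rewrite lee_fin ler_wpM2l ?(ltW (phi_gt0 _))//.
    have t0 : 0 < t by exact: lt_le_trans xt.
    have tx : t^-1 <= x^-1 by rewrite lef_pV2 ?posrE.
    by rewrite lerD2l ler_sqr// nnegrE invr_ge0 ltW.
Qed.

Lemma tail_ge0 x : 0 <= tail x.
Proof. by apply: Rintegral_ge0 => t _; exact: normal_pdf_ge0. Qed.

(** With [M] the ratio of the tail to the density, the tail identity gives
    [x M <= 1 <= M (x + x^-1)]. The last bound is what keeps the derivative of
    [x * F x] bounded for the solution [F] of Stein's equation. *)
Lemma mills x : 1 <= x ->
  [/\ 0 <= tail x / phi x, tail x / phi x <= 1, x * (tail x / phi x) <= 1 &
     x * (1 - x * (tail x / phi x)) <= 1].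
Proof.
move=> x1; have x0 : 0 < x by exact: lt_le_trans x1.
set M := tail x / phi x.
have M0 : 0 <= M by rewrite divr_ge0 ?tail_ge0 ?(ltW (phi_gt0 _)).
have xM : x * M <= 1.
  rewrite /M mulrA ler_pdivrMr ?phi_gt0// mul1r mulrC -ler_pdivlMr//.
  exact: tail_ub.
split => //; first by apply: le_trans xM; rewrite ler_peMl.
have : 1 <= M * (x + x^-1).
  have px : 0 < phi x / x by rewrite divr_gt0 ?phi_gt0.
  rewrite -(ler_pM2l px) mulr1.
  have -> : phi x / x * (M * (x + x^-1)) = tail x * (1 + x^-1 ^+ 2).
    by rewrite /M; field; rewrite phi_neq0 gt_eqF.
  exact: tail_lb.
move=> H.
have x_le1 : x^-1 <= 1 by rewrite invf_le1.
have xV : x * x^-1 = 1 by rewrite divff ?gt_eqF.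
have xV0 : 0 <= x^-1 by rewrite invr_ge0 ltW.
have h1 : x - x * (M * x) <= M * (x * x^-1).
  have := ler_wpM2l (ltW x0) H; rewrite mulr1 => h.
  have -> : M * (x * x^-1) = x * (M * (x + x^-1)) - x * (M * x) by ring.
  by rewrite lerD2r.
rewrite xV mulr1 in h1; rewrite mulrBr mulr1 (mulrC x M).
apply: (le_trans h1); apply: le_trans xM; exact: ler_peMl.
Qed.

End Mills.

(** * Stein's equation for Lipschitz cut-offs *)

Section MeanValue.
Context {R : realType}.

(** The intermediate point is located by minimum and maximum, so that no order between
    [x] and [y] is imposed. *)
Lemma mean_value (F F' : R -> R) (x y : R) :
  (forall z, Num.min x y <= z <= Num.max x y -> is_derive z (1 : R) F (F' z)) ->
  exists2 z, Num.min x y <= z <= Num.max x y & F x - F y = F' z * (x - y).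
Proof.
wlog xy : x y / y <= x.
  move=> H; have /orP[] := le_total y x => yx; first exact: H.
  rewrite minC maxC => dF; have [z zI E] := H _ _ yx dF.
  by exists z => //; rewrite -opprB E -mulrN opprB.
rewrite min_r// max_l// => dF.
have cF : {within `[y, x], continuous F}.
  apply: continuous_in_subspaceT => z; rewrite inE/= in_itv/= => zI.
  apply: differentiable_continuous; apply/derivable1_diffP.
  exact: (@ex_derive _ _ _ _ _ _ _ (dF z zI)).
have [z|z zI E] := @MVT_segment R F F' y x xy _ cF.
  by rewrite in_itv/= => /andP[/ltW yz /ltW zx]; apply: dF; rewrite yz zx.
by exists z.
Qed.

Lemma lipschitz_of_derive (F F' : R -> R) (K : R) :
  (forall z, is_derive z (1 : R) F (F' z)) -> (forall z, `|F' z| <= K) ->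
  forall x y, `|F x - F y| <= K * `|x - y|.
Proof.
move=> dF F'K x y; have [z _ ->] := @mean_value F F' x y (fun z _ => dF z).
by rewrite normrM ler_wpM2r.
Qed.

Lemma bounded_of_tails (q : R -> R) (B K : R) : continuous q ->
  (forall x, B <= `|x| -> `|q x| <= K) -> exists K', forall x, `|q x| <= K'.
Proof.
move=> cq qK.
have [c _ cmax] : exists2 c, c \in `[- `|B|, `|B|] &
    forall t, t \in `[- `|B|, `|B|] -> `|q t| <= `|q c|.
  apply: EVT_max; first by have := normr_ge0 B; lra.
  apply: continuous_subspaceT => x; apply: continuous_comp; first exact: cq.
  exact: norm_continuous.
exists (Num.max K `|q c|) => x; rewrite le_max.
case: (leP B `|x|) => [/qK -> //|xB]; rewrite cmax ?orbT// in_itv/= -ler_norml.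
by apply: (le_trans (ltW xB)); exact: ler_norm.
Qed.

Lemma lipschitz_continuous (h : R -> R) (L : R) :
  (forall x y, `|h x - h y| <= L * `|x - y|) -> continuous h.
Proof.
move=> hL x; apply/cvgrPdist_le => e e0.
have L0 : 0 <= L by have := hL 1 0; rewrite subr0 normr1 mulr1; apply: le_trans.
have L1 : 0 < L + 1 by rewrite ltr_wpDl.
near=> y; apply: (le_trans (hL _ _)).
apply: (@le_trans _ _ ((L + 1) * `|x - y|)).
  by rewrite ler_wpM2r// lerDl.
rewrite mulrC -ler_pdivlMr//; near: y.
by apply: (@cvgr_dist_le _ _ _ _ _ id x) => //; rewrite divr_gt0.
Unshelve. all: by end_near. Qed.

End MeanValue.

Section Stein.
Context {R : realType}.
Local Notation mu := (@lebesgue_measure R).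
Local Notation phi := (@normal_pdf R 0 1).
Variables (h : R -> R) (a b L : R).
Hypotheses (h01 : forall x, 0 <= h x <= 1) (h1 : forall x, x <= a -> h x = 1)
  (h0 : forall x, b <= x -> h x = 0)
  (hL : forall x y, `|h x - h y| <= L * `|x - y|).

Let ch : continuous h. Proof. exact: lipschitz_continuous hL. Qed.

Let mh : measurable_fun setT h. Proof. exact: continuous_measurable_fun. Qed.
Let mphi : measurable_fun setT phi. Proof. exact: measurable_normal_pdf. Qed.

Definition gauss_mean := \int[mu]_t (h t * phi t).
Local Notation Nh := gauss_mean.

Let Ihphi (A : set R) : measurable A -> mu.-integrable A (EFin \o (fun t => h t * phi t)).
Proof.
move=> mA; have := integrable_phi mA; apply: le_integrable => //.
  by apply/measurable_EFinP/measurable_funTS; exact: measurable_funM.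
move=> t _; rewrite /= lee_fin normrM ler_piMl//.
by have /andP[H0 H1] := h01 t; rewrite ger0_norm.
Qed.

Let g t := (h t - Nh) * phi t.

Let gE : g = (fun t => h t * phi t - Nh * phi t).
Proof. by apply/funext => t; rewrite /g mulrBl. Qed.

Let INphi (A : set R) : measurable A -> mu.-integrable A (EFin \o (fun t => Nh * phi t)).
Proof.
move=> mA; apply: (@integrableZl _ _ _ mu A mA Nh (EFin \o phi)).
exact: integrable_phi.
Qed.

Let Ig (A : set R) : measurable A -> mu.-integrable A (EFin \o g).
Proof.
move=> mA; rewrite gE.
exact: (@integrableB _ _ _ mu A mA (EFin \o (fun t => h t * phi t)) (EFin \o (fun t => Nh * phi t))
  (Ihphi mA) (INphi mA)).
Qed.

Let phi1 : \int[mu]_t phi t = 1.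
Proof. by rewrite /Rintegral integral_normal_pdf. Qed.

Let g0 : \int[mu]_t g t = 0.
Proof.
rewrite gE RintegralB//; [|exact: Ihphi|exact: INphi].
by rewrite RintegralZl//; [rewrite phi1 mulr1 subrr|exact: integrable_phi].
Qed.

Lemma gauss_mean01 : 0 <= Nh <= 1.
Proof.
apply/andP; split.
  apply: Rintegral_ge0 => t _; rewrite mulr_ge0 ?normal_pdf_ge0//.
  by case/andP: (h01 t).
rewrite -phi1; apply: le_Rintegral => //; [exact: Ihphi|exact: integrable_phi|].
move=> t _; rewrite ler_piMl ?normal_pdf_ge0//.
by case/andP: (h01 t).
Qed.

Let J x := \int[mu]_(t in `]-oo, x]) g t.

Let cg : continuous g.
Proof.
move=> x; apply: cvgM; last exact: continuous_phi.
by apply: cvgB; [exact: ch|exact: cvg_cst].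
Qed.

Let dJ (x : R) : is_derive x (1 : R) J (g x).
Proof.
have xx1 : x < x + 1 by rewrite ltrDl.
have cgx : {for x, continuous g} by exact: cg.
have [dJ JE] := @continuous_FTC1 R g (BInfty _ true) x (x + 1) xx1 (Ig (measurable_itv _))
  (ltNyr x) cgx.
apply: DeriveDef; first exact: dJ.
by rewrite -derive1E.
Qed.

Let J_right x : b <= x -> J x = Nh * tail x.
Proof.
move=> bx.
have := @Rintegral_itvB R g -oo%O +oo%O x (Ig (measurable_itv _)) isT isT.
rewrite set_itvNyy g0 sub0r -/(J x) => JE.
have -> : J x = - \int[mu]_(t in `]x, +oo[) g t by rewrite -JE opprK.
rewrite Rintegral_itv_obnd_cbnd; last exact: Ig.
have -> : \int[mu]_(t in `[x, +oo[) g t = \int[mu]_(t in `[x, +oo[) (- Nh * phi t).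
  apply: eq_Rintegral => t; rewrite inE/= in_itv/= andbT => xt.
  by rewrite /g h0 ?sub0r//; exact: le_trans xt.
by rewrite RintegralZl//; [rewrite mulNr opprK|exact: integrable_phi].
Qed.

Let J_left x : x <= a -> J x = (1 - Nh) * tail (- x).
Proof.
move=> xa; rewrite /J.
have -> : \int[mu]_(t in `]-oo, x]) g t = \int[mu]_(t in `]-oo, x]) ((1 - Nh) * phi t).
  apply: eq_Rintegral => t; rewrite inE/= in_itv/= => tx.
  by rewrite /g h1//; exact: le_trans xa.
rewrite RintegralZl//; last exact: integrable_phi.
congr (_ * _); rewrite /tail /Rintegral; congr fine.
rewrite -{1}(opprK x) ge0_integration_by_substitutionNy.
- by apply: eq_integral => t _; rewrite /= phiN.
- by apply: continuous_subspaceT; exact: continuous_phi.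
- by move=> t _; exact: normal_pdf_ge0.
Qed.

Let f x := J x / phi x.

Let df (x : R) : is_derive x (1 : R) f (x * f x + h x - Nh).
Proof.
have dV := is_deriveV (phi_neq0 x) (is_derive_phi x).
have dJx := dJ x.
apply: is_derive_eq.
by rewrite /GRing.scale/= /f /g; field; rewrite phi_neq0.
Qed.

Let tails x : Num.max 1 (Num.max `|a| `|b|) <= `|x| ->
  exists M N, [/\ 0 <= N <= 1 /\ 0 <= M <= 1, `|x| * M <= 1,
     `|x| * (1 - `|x| * M) <= 1,
     `|f x| = N * M & `|x * f x + h x - Nh| = N * (1 - `|x| * M)].
Proof.
rewrite !ge_max => /and3P[x1 ax bx].
have [M0 M1 M2 M3] := mills x1.
have /andP[N0 N1] := gauss_mean01.
case: (lerP 0 x) => x0.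
  rewrite (ger0_norm x0) in x1 ax bx M0 M1 M2 M3 *.
  have xb : b <= x by exact: le_trans (ler_norm _) bx.
  exists (tail x / phi x), Nh.
  have fE : f x = Nh * (tail x / phi x) by rewrite /f J_right// mulrA.
  rewrite N0 N1 M0 M1 M2 M3; split => //.
    by rewrite fE ger0_norm// mulr_ge0.
  rewrite h0// addr0 fE distrC ger0_norm; first by ring.
  by rewrite mulrCA subr_ge0 ler_piMr.
rewrite (ltr0_norm x0) in x1 ax bx M0 M1 M2 M3 *.
have xa : x <= a.
  by rewrite -lerN2; apply: le_trans ax; rewrite -normrN; exact: ler_norm.
exists (tail (- x) / phi (- x)), (1 - Nh).
have fE : f x = (1 - Nh) * (tail (- x) / phi (- x)).
  by rewrite /f J_left// phiN mulrA.
split => //; first by rewrite subr_ge0 gerBl N0 N1 M0 M1.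
  by rewrite fE ger0_norm// mulr_ge0// subr_ge0.
rewrite h1// fE ger0_norm; first by ring.
rewrite -[X in 0 <= X](_ : (1 - Nh) * (1 - - x * (tail (- x) / phi (- x))) = _).
  by rewrite mulr_ge0// subr_ge0.
by ring.
Qed.

Let cf : continuous f.
Proof.
move=> x; apply: differentiable_continuous; apply/derivable1_diffP.
exact: (@ex_derive _ _ _ _ _ _ _ (df x)).
Qed.

Let cf' : continuous (fun x : R => x * f x + h x - Nh).
Proof.
move=> x; apply: cvgB; last exact: cvg_cst.
by apply: cvgD; [apply: cvgM; [exact: cvg_id|exact: cf]|exact: ch].
Qed.

(** The solution of [F' - x F = h - E h(N)] is the integral of [(h - E h(N)) phi] up to
    [x], divided by [phi x]. It, its derivative and the derivative of [x F x] are
    bounded, by compactness on an interval outside of which [h] is constant and by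
    Mills' ratio outside of it; as [h] is Lipschitz, so is [F' x = x F x + h x - E h(N)].
    The constant is not explicit: [h] is fixed while the rows of the array vary. *)
Lemma stein_solution : exists (F F' : R -> R) (K : R),
  [/\ (forall x, is_derive x (1 : R) F (F' x)),
      (forall x, F' x = x * F x + h x - gauss_mean),
      (forall x, `|F x| <= K /\ `|F' x| <= K) &
      (forall x y, `|F' x - F' y| <= K * `|x - y|)].
Proof.
pose B := Num.max 1 (Num.max `|a| `|b|).
have [K1 K1P] : exists K, forall x, `|f x| <= K.
  apply: (@bounded_of_tails _ _ B 1 cf) => x /tails[M [N [[/andP[N0 N1] /andP[M0 M1]] _ _ -> _]]].
  by rewrite -[leRHS]mulr1; apply: ler_pM.
have [K2 K2P] : exists K, forall x, `|x * f x + h x - Nh| <= K.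
  apply: (@bounded_of_tails _ _ B 1 cf') => x /tails[M [N [[/andP[N0 N1] /andP[M0 M1]] M2 _ _ ->]]].
  rewrite -[leRHS]mulr1; apply: ler_pM => //; first by rewrite subr_ge0.
  by rewrite gerBl mulr_ge0.
have [K3 K3P] : exists K, forall x, `|f x + x * (x * f x + h x - Nh)| <= K.
  apply: (@bounded_of_tails _ _ B 2) => [x|x].
    by apply: cvgD; [exact: cf|apply: cvgM; [exact: cvg_id|exact: cf']].
  move=> /tails[M [N [[/andP[N0 N1] /andP[M0 M1]] M2 M3 E1 E2]]].
  apply: (le_trans (ler_normD _ _)); rewrite /= E1 normrM E2.
  have : N * M <= 1 * 1 by apply: ler_pM.
  have : N * (`|x| * (1 - `|x| * M)) <= 1 * 1.
    by apply: ler_pM => //; rewrite mulr_ge0// subr_ge0.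
  by rewrite mulrCA; lra.
have dG (x : R) : is_derive x (1 : R) (fun x => x * f x) (f x + x * (x * f x + h x - Nh)).
  have dfx := df x.
  by apply: is_derive_eq; rewrite /GRing.scale/=; ring.
exists f, (fun x => x * f x + h x - Nh), (Num.max K1 (Num.max K2 (K3 + L))); split => //.
  by move=> x; rewrite !le_max K1P K2P orbT.
move=> x y.
have -> : x * f x + h x - Nh - (y * f y + h y - Nh) = (x * f x - y * f y) + (h x - h y) by ring.
apply: (le_trans (ler_normD _ _)).
apply: (@le_trans _ _ ((K3 + L) * `|x - y|)).
  by rewrite mulrDl lerD// (lipschitz_of_derive dG K3P).
by rewrite ler_wpM2r// !le_max lexx !orbT.
Qed.

End Stein.

(** * Stein's bound for independent sums *)

Section SteinBound.
Context d (T : measurableType d) (R : realType) (P : probability T R).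

Lemma indep2_comp (U V : T -> R) (f g : R -> R) : indep2 P U V ->
  measurable_fun setT f -> measurable_fun setT g ->
  indep2 P (fun w => f (U w)) (fun w => g (V w)).
Proof.
move=> iUV mf mg A B mA mB.
exact: (iUV _ _ (preim_measurable mf mA) (preim_measurable mg mB)).
Qed.

Variables (n : nat) (xi : 'I_n -> T -> R).
Hypotheses (mxi : forall i, measurable_fun setT (xi i)) (ixi : indep_seq P xi).
Hypothesis xi2 : forall i, integ P (fun w => xi i w ^+ 2).
Hypothesis xi0 : forall i, Ex P (xi i) = 0.

Let W w := \sum_i xi i w.
Let Wi i w := \sum_(k | k != i) xi k w.
Let s i := Ex P (fun w => xi i w ^+ 2).
Let tr (x : R) := Num.min 1 `|x|.

(** The truncation [min 1 |xi|], in place of [|xi|], makes these third-order terms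
    finite under second moments only. *)
Definition lindeberg_sum :=
  \sum_i Ex P (fun w => xi i w ^+ 2 * Num.min 1 `|xi i w|) +
  \sum_i Ex P (fun w => xi i w ^+ 2) * Ex P (fun w => Num.min 1 `|xi i w|).

Hypothesis s1 : \sum_i s i = 1.

Variables (F F' : R -> R) (K : R).
Hypotheses (dF : forall x, is_derive x (1 : R) F (F' x))
  (FK : forall x, `|F x| <= K /\ `|F' x| <= K)
  (FL : forall x y, `|F' x - F' y| <= K * `|x - y|).

Let K0 : 0 <= K. Proof. by apply: le_trans (FK 0).1. Qed.

Let mF : measurable_fun setT F.
Proof.
apply: continuous_measurable_fun => x.
apply: differentiable_continuous; apply/derivable1_diffP.
exact: (@ex_derive _ _ _ _ _ _ _ (dF x)).
Qed.

Let mF' : measurable_fun setT F'.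
Proof. by apply: continuous_measurable_fun; exact: lipschitz_continuous FL. Qed.

Let mW : measurable_fun setT W.
Proof. by apply: measurable_sum => i; exact: mxi. Qed.

Let mWi i : measurable_fun setT (Wi i).
Proof.
rewrite /Wi; under eq_fun do rewrite big_mkcond.
apply: measurable_sum => k; have [_|ki] := eqVneq k i; first exact: measurable_cst.
exact: mxi.
Qed.

Let WE i w : W w = xi i w + Wi i w.
Proof. by rewrite /W (bigD1 i). Qed.

Let mtr : measurable_fun setT tr.
Proof. by apply: measurable_minr => //; exact: measurable_normr. Qed.

Let tr0 x : 0 <= tr x. Proof. by rewrite le_min ler01 normr_ge0. Qed.

Let Fdiff x y : `|F' x - F' y| <= 2 * K * tr (x - y).
Proof.
rewrite /tr; case: (leP 1 `|x - y|) => h.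
  rewrite mulr1 mulrDl mul1r; apply: (le_trans (ler_normB _ _)).
  by apply: lerD; [exact: (FK x).2|exact: (FK y).2].
apply: (le_trans (FL _ _)); rewrite ler_wpM2r//.
by rewrite mulrDl mul1r lerDl.
Qed.

Let Ixi i : integ P (xi i). Proof. exact: integ_sq. Qed.

Let Ibd (f : R -> R) (V : T -> R) : measurable_fun setT f -> measurable_fun setT V ->
  (forall x, `|f x| <= K) -> integ P (fun w => f (V w)).
Proof.
move=> mf mV fK; apply: (@integ_bounded _ _ _ _ _ K) => [|w]; last exact: fK.
exact: (measurableT_comp mf mV).
Qed.

Let Imul (f : R -> R) (V U : T -> R) : measurable_fun setT f -> measurable_fun setT V ->
  (forall x, `|f x| <= K) -> integ P U -> integ P (fun w => U w * f (V w)).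
Proof.
move=> mf mV fK IU.
apply: (@integ_le _ _ _ _ _ (fun w => K * U w)); last exact: integZ.
  apply: measurable_funM; first exact: integ_measurable IU.
  exact: (measurableT_comp mf mV).
by move=> w; rewrite !normrM mulrC ler_wpM2r// (ger0_norm K0).
Qed.

Let D i w := F (W w) - F (Wi i w) - xi i w * F' (Wi i w).

Let DE i w : `|xi i w * D i w| <= 2 * K * (xi i w ^+ 2 * tr (xi i w)).
Proof.
have [z zI E] := @mean_value R F F' (W w) (Wi i w) (fun z _ => dF z).
have xE : W w - Wi i w = xi i w by rewrite (WE i) addrK.
have -> : D i w = (F' z - F' (Wi i w)) * xi i w.
  by rewrite /D E xE; ring.
rewrite !normrM.
have -> : `|xi i w| * (`|F' z - F' (Wi i w)| * `|xi i w|) =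
    xi i w ^+ 2 * `|F' z - F' (Wi i w)|.
  by rewrite -[xi i w ^+ 2]real_normK ?num_real//; ring.
rewrite mulrCA; apply: ler_wpM2l; first exact: sqr_ge0.
apply: (le_trans (Fdiff _ _)); rewrite ler_wpM2l ?mulr_ge0//.
rewrite /tr le_min ge_min lexx/= ge_min; apply/orP; right.
rewrite -xE; move: zI; have /orP[] := le_total (W w) (Wi i w) => h.
  rewrite min_l// max_r// => /andP[h1 h2]; rewrite !ler0_norm ?subr_le0//; lra.
rewrite min_r// max_l// => /andP[h1 h2]; rewrite !ger0_norm ?subr_ge0//; lra.
Qed.

Let Ixi2tr i : integ P (fun w => xi i w ^+ 2 * tr (xi i w)).
Proof.
apply: (integ_le _ _ (xi2 i)).
  apply: measurable_funM; first exact: measurable_funX.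
  exact: (measurableT_comp mtr).
move=> w; rewrite normrM ler_piMr// ger0_norm//.
by rewrite /tr ge_min lexx.
Qed.

Let Itr i : integ P (fun w => tr (xi i w)).
Proof.
apply: (@integ_bounded _ _ _ _ _ 1); first exact: (measurableT_comp mtr).
by move=> w; rewrite ger0_norm// ge_min lexx.
Qed.

Let mD i : measurable_fun setT (D i).
Proof.
apply: measurable_funB; first apply: measurable_funB.
- exact: (measurableT_comp mF).
- exact: (measurableT_comp mF).
- by apply: measurable_funM => //; exact: (measurableT_comp mF').
Qed.

Let ID i : integ P (fun w => xi i w * D i w).
Proof.
apply: (@integ_le _ _ _ _ _ (fun w => 2 * K * (xi i w ^+ 2 * tr (xi i w)))).
- exact: measurable_funM.
- by move=> w; apply: (le_trans (DE i w)); exact: ler_norm.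
- exact: integZ.
Qed.

Let term i : Ex P (fun w => xi i w * F (W w)) =
  s i * Ex P (fun w => F' (Wi i w)) + Ex P (fun w => xi i w * D i w).
Proof.
have FKl x : `|F x| <= K by exact: (FK x).1.
have FKr x : `|F' x| <= K by exact: (FK x).2.
rewrite (@eq_Ex _ _ _ _ _ (fun w => (xi i w * F (Wi i w) +
    xi i w ^+ 2 * F' (Wi i w)) + xi i w * D i w)); last first.
  by move=> w; rewrite /D; ring.
have I1 : integ P (fun w => xi i w * F (Wi i w)) by exact: Imul.
have I2 : integ P (fun w => xi i w ^+ 2 * F' (Wi i w)) by exact: Imul.
rewrite ExD//; last exact: integD.
rewrite ExD//; congr (_ + _).
have iW := indep_seq_others mxi ixi i.
rewrite (@indep2_Ex _ _ _ _ (xi i) (fun w => F (Wi i w)))//; last 3 first.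
- exact: (measurableT_comp mF).
- exact: (@indep2_comp _ _ id F iW).
- exact: Ibd.
rewrite xi0 mul0r add0r.
rewrite (@indep2_Ex _ _ _ _ (fun w => xi i w ^+ 2) (fun w => F' (Wi i w)))//.
- exact: measurable_funX.
- exact: (measurableT_comp mF').
- exact: (@indep2_comp _ _ (fun x => x ^+ 2) F' iW).
- exact: Ibd.
Qed.

(** Leave one out: [W i = W - xi i] is independent of [xi i], so that
    [E (xi i * F W) = s i * E (F' (W i)) + E (xi i * D i)] with a Taylor remainder
    [|D i| <= 2 K |xi i| min(1, |xi i|)]; replacing [F' (W i)] by [F' W] costs
    [2 K min(1, |xi i|)]. Summing over [i] with [\sum_i s i = 1] gives the bound. *)
Lemma stein_bound : integ P (fun w => F' (W w) - W w * F (W w)) /\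
  `|Ex P (fun w => F' (W w) - W w * F (W w))| <= 2 * K * lindeberg_sum.
Proof.
have FKl x : `|F x| <= K by exact: (FK x).1.
have FKr x : `|F' x| <= K by exact: (FK x).2.
have IF' : integ P (fun w => F' (W w)) by exact: Ibd.
have IxF i : integ P (fun w => xi i w * F (W w)) by exact: Imul.
have WFE : (fun w => W w * F (W w)) = (fun w => \sum_i xi i w * F (W w)).
  by apply/funext => w; rewrite {1}/W mulr_suml.
have IWF : integ P (fun w => W w * F (W w)) by rewrite WFE; exact: integ_sum.
split; first exact: integB.
rewrite ExB// WFE Ex_sum//.
have -> : Ex P (fun w => F' (W w)) = \sum_i s i * Ex P (fun w => F' (W w)).
  by rewrite -mulr_suml s1 mul1r.
rewrite -sumrB.
apply: (le_trans (ler_norm_sum _ _ _)).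
rewrite /lindeberg_sum -big_split/= mulr_sumr; apply: ler_sum => i _.
have s0 : 0 <= s i by apply: Ex_ge0 => w; exact: sqr_ge0.
have IF'i : integ P (fun w => F' (Wi i w)) by exact: Ibd.
have -> : s i * Ex P (fun w => F' (W w)) - Ex P (fun w => xi i w * F (W w)) =
    s i * Ex P (fun w => F' (W w) - F' (Wi i w)) - Ex P (fun w => xi i w * D i w).
  by rewrite term ExB//; ring.
apply: (le_trans (ler_normB _ _)); rewrite addrC mulrDr; apply: lerD.
  rewrite normrM (ger0_norm s0) mulrCA ler_wpM2l//.
  rewrite -(ExZ (2 * K)); last exact: Itr.
  apply: norm_Ex_le => //; [exact: integB|by apply: integZ; exact: Itr|].
  by move=> w; have := Fdiff (W w) (Wi i w); rewrite [in X in X -> _](WE i) addrK -WE.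
rewrite -(ExZ (2 * K)); last exact: Ixi2tr.
apply: norm_Ex_le => //; by apply: integZ; exact: Ixi2tr.
Qed.

End SteinBound.

(** * Normal approximation of distribution functions *)

Section NormalCdf.
Context {R : realType}.
Local Notation mu := (@lebesgue_measure R).
Local Notation phi := (@normal_pdf R 0 1).

Definition normal_cdf (t : R) : R := \int[mu]_(x in `]-oo, t]) phi x.

Lemma normal_cdfE t : normal_prob 0 1 [set x : R | x <= t] = (normal_cdf t)%:E.
Proof.
have -> : [set x : R | x <= t] = `]-oo, t]%classic.
  by apply/seteqP; split => x /=; rewrite in_itv.
by rewrite /normal_cdf /Rintegral fineK//; exact: integrable_fin_num (integrable_phi _).
Qed.

Lemma normal_cdf_lip s t : s <= t -> normal_cdf t <= normal_cdf s + normal_peak 1 * (t - s).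
Proof.
move=> st; rewrite addrC -lerBlDr.
have -> : normal_cdf t - normal_cdf s = \int[mu]_(x in `]s, t]) phi x.
  by apply: Rintegral_itvB => //; exact: integrable_phi.
have muE : lebesgue_measure (`]s, t]%classic : set R) = (t - s)%:E.
  rewrite lebesgue_measure_itv/= lte_fin; case: ltP => [_|ts]; first by rewrite EFinB.
  by rewrite (le_anti (introT andP (conj st ts))) subrr.
have -> : normal_peak 1 * (t - s) = \int[mu]_(x in `]s, t]) (normal_peak 1 : R).
  rewrite Rintegral_cst//; congr (_ * _).
  by rewrite -[LHS]/(fine (t - s)%:E) -muE.
apply: le_Rintegral => //; first exact: integrable_phi.
  apply/integrableP; split; first by apply/measurable_EFinP; exact: measurable_cst.
  rewrite integral_cst//= ; apply: lte_mul_pinfty => //.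
  by apply: (@le_lt_trans _ _ (t - s)%:E); [rewrite -muE|exact: ltry].
by move=> x _; exact: normal_pdf_ub (oner_neq0 _).
Qed.

Lemma integrable_phi_patch (A : set R) : measurable A ->
  mu.-integrable setT (EFin \o (phi \_ A)).
Proof.
move=> mA.
have -> : phi \_ A = (fun x => \1_A x * phi x).
  apply/funext => x; rewrite patchE indicE.
  by case: (x \in A); rewrite ?mul1r ?mul0r.
have := @integrable_phi R setT measurableT; apply: le_integrable => //.
  apply/measurable_EFinP; apply: measurable_funM; first exact: measurable_indic.
  exact: measurable_normal_pdf.
move=> x _; rewrite /= lee_fin normrM ler_piMl// indicE.
by case: (x \in A); rewrite ?normr1 ?normr0.
Qed.

(** A Lipschitz majorant of the indicator of the half-line up to [t], and a minorant of
    the indicator of the half-line up to [t + e]. *)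
Definition ramp (t e x : R) := Num.max 0 (Num.min 1 ((t + e - x) / e)).

Section Ramp.
Variables (t e : R).
Hypothesis e0 : 0 < e.

Lemma ramp01 x : 0 <= ramp t e x <= 1.
Proof. by rewrite le_max lexx/= ge_max ler01/= ge_min lexx. Qed.

Lemma ramp1 x : x <= t -> ramp t e x = 1.
Proof.
move=> xt; rewrite /ramp.
have h : 1 <= (t + e - x) / e by rewrite ler_pdivlMr// mul1r; lra.
by rewrite (min_l h) max_r.
Qed.

Lemma ramp0 x : t + e <= x -> ramp t e x = 0.
Proof.
move=> tx; rewrite /ramp max_l// ge_min; apply/orP; right.
by rewrite pmulr_lle0 ?invr_gt0//; lra.
Qed.

Lemma ramp_lip x y : `|ramp t e x - ramp t e y| <= e^-1 * `|x - y|.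
Proof.
have H z w : ramp t e z <= ramp t e w + e^-1 * `|z - w|.
  have E : (t + e - z) / e = (t + e - w) / e + e^-1 * (w - z).
    by field; rewrite gt_eqF.
  have le1 : e^-1 * (w - z) <= e^-1 * `|z - w|.
    by rewrite ler_wpM2l ?invr_ge0 ?(ltW e0)// distrC ler_norm.
  have p0 : 0 <= e^-1 * `|z - w| by rewrite mulr_ge0 ?invr_ge0 ?(ltW e0).
  have [/andP[r0 r1] _] := (ramp01 w, ramp01 z).
  rewrite {1}/ramp ge_max addr_ge0//= ge_min.
  case: (leP 1 ((t + e - w) / e)) => hw.
    by apply/orP; left; rewrite /ramp (min_l hw) max_r// lerDl.
  apply/orP; right; rewrite E; apply: lerD => //.
  by rewrite /ramp (min_r (ltW hw)) le_max lexx orbT.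
rewrite ler_norml; apply/andP; split; last by rewrite lerBlDl; exact: H.
by rewrite lerNl opprB lerBlDl distrC; exact: H.
Qed.

Let mramp : measurable_fun setT (ramp t e).
Proof. by apply: continuous_measurable_fun; exact: lipschitz_continuous ramp_lip. Qed.

Lemma gauss_mean_ramp_ub : gauss_mean (ramp t e) <= normal_cdf (t + e).
Proof.
rewrite /normal_cdf Rintegral_mkcond; apply: le_Rintegral => //.
- have := @integrable_phi R setT measurableT; apply: le_integrable => //.
    by apply/measurable_EFinP; apply: measurable_funM => //; exact: measurable_normal_pdf.
  move=> x _; rewrite /= lee_fin normrM ler_piMl//.
  by have /andP[r0 r1] := ramp01 x; rewrite ger0_norm.
- by apply: integrable_phi_patch; exact: measurable_itv.
- move=> x _; rewrite patchE; case: ifPn => [_|].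
    rewrite ler_piMl ?normal_pdf_ge0//; by case/andP: (ramp01 x).
  by rewrite notin_setE/= in_itv/= => /negP; rewrite -ltNge => /ltW/ramp0 ->; rewrite mul0r.
Qed.

Lemma gauss_mean_ramp_lb : normal_cdf t <= gauss_mean (ramp t e).
Proof.
rewrite /normal_cdf Rintegral_mkcond; apply: le_Rintegral => //.
- by apply: integrable_phi_patch; exact: measurable_itv.
- have := @integrable_phi R setT measurableT; apply: le_integrable => //.
    by apply/measurable_EFinP; apply: measurable_funM => //; exact: measurable_normal_pdf.
  move=> x _; rewrite /= lee_fin normrM ler_piMl//.
  by have /andP[r0 r1] := ramp01 x; rewrite ger0_norm.
- move=> x _; rewrite patchE; case: ifPn => [|_].
    by rewrite inE/= in_itv/= => xt; rewrite ramp1// mul1r.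
  by rewrite mulr_ge0 ?normal_pdf_ge0//; case/andP: (ramp01 x).
Qed.

(** The constant comes from the solution of Stein's equation for this ramp, hence
    serves all probability spaces and all rows. *)
Lemma stein_ramp : exists2 K : R, 0 <= K &
  forall d (T : measurableType d) (P : probability T R) n (xi : 'I_n -> T -> R),
    (forall i, measurable_fun setT (xi i)) -> indep_seq P xi ->
    (forall i, integ P (fun w => xi i w ^+ 2)) -> (forall i, Ex P (xi i) = 0) ->
    \sum_i Ex P (fun w => xi i w ^+ 2) = 1 ->
    `|Ex P (fun w => ramp t e (\sum_i xi i w)) - gauss_mean (ramp t e)|
      <= K * lindeberg_sum P xi.
Proof.
have [F [F' [K [dF F'E FK FL]]]] := stein_solution ramp01 ramp1 ramp0 ramp_lip.
exists (2 * K); first by rewrite mulr_ge0// (le_trans _ (FK 0).1).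
move=> d T P n xi mxi ixi xi2 xi0 s1.
have [I H] := stein_bound mxi ixi xi2 xi0 s1 dF FK FL.
apply: le_trans H; rewrite -[X in _ - X](@Ex_cst _ _ _ P) -ExB; last 2 first.
- apply: (@integ_bounded _ _ _ _ _ 1) => [|w].
    by apply: (measurableT_comp mramp); apply: measurable_sum => i; exact: mxi.
  by have /andP[r0 r1] := ramp01 (\sum_i xi i w); rewrite ger0_norm.
- exact: integ_cst.
rewrite le_eqVlt; apply/orP; left; apply/eqP; congr `|_|; apply: eq_Ex => w.
by rewrite F'E; ring.
Qed.

End Ramp.

(** The indicator of the half-line up to [t] lies between the ramps from [t - e] to [t]
    and from [t] to [t + e]. Bounds that are uniform in the row are what a
    triangular array needs. *)
Lemma clt_bound (t e : R) : 0 < e -> exists2 K : R, 0 <= K &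
  forall d (T : measurableType d) (P : probability T R) n (xi : 'I_n -> T -> R),
    (forall i, measurable_fun setT (xi i)) -> indep_seq P xi ->
    (forall i, integ P (fun w => xi i w ^+ 2)) -> (forall i, Ex P (xi i) = 0) ->
    \sum_i Ex P (fun w => xi i w ^+ 2) = 1 ->
    normal_cdf (t - e) - K * lindeberg_sum P xi <=
      fine (P [set w | \sum_i xi i w <= t]) <=
    normal_cdf (t + e) + K * lindeberg_sum P xi.
Proof.
move=> e0; have [K1 K10 H1] := stein_ramp t e0; have [K2 K20 H2] := stein_ramp (t - e) e0.
exists (Num.max K1 K2); first by rewrite le_max K10.
move=> d T P n xi mxi ixi xi2 xi0 s1.
have L0 : 0 <= lindeberg_sum P xi.
  have m0 (x : R) : 0 <= Num.min 1 `|x| by rewrite le_min ler01 normr_ge0.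
  apply: addr_ge0; apply: sumr_ge0 => i _.
    by apply: Ex_ge0 => w; rewrite mulr_ge0 ?sqr_ge0.
  by apply: mulr_ge0; apply: Ex_ge0 => w //; exact: sqr_ge0.
have mW : measurable_fun setT (fun w => \sum_i xi i w).
  by apply: measurable_sum => i; exact: mxi.
set A := [set w | _].
have mA : measurable A.
  rewrite (_ : A = (fun w => \sum_i xi i w) @^-1` `]-oo, t]); first exact: preim_measurable.
  by apply/seteqP; split => w; rewrite /A/= in_itv.
have PA : fine (P A) = Ex P (\1_A) by rewrite /Ex /Rintegral integral_indic// setIT.
have Iind : integ P (\1_A) by exact: integrable_indic.
have Ir s : integ P (fun w => ramp s e (\sum_i xi i w)).
  apply: (@integ_bounded _ _ _ _ _ 1) => [|w].
    apply: (measurableT_comp _ mW); apply: continuous_measurable_fun.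
    exact: lipschitz_continuous (ramp_lip s e0).
  by have /andP[r0 r1] := ramp01 s e (\sum_i xi i w); rewrite ger0_norm.
have up : fine (P A) <= Ex P (fun w => ramp t e (\sum_i xi i w)).
  rewrite PA; apply: le_Ex => // w; rewrite indicE.
  case: (boolP (w \in A)) => [|_]; first by rewrite inE => /(ramp1 e0) ->.
  by case/andP: (ramp01 t e (\sum_i xi i w)).
have lo : Ex P (fun w => ramp (t - e) e (\sum_i xi i w)) <= fine (P A).
  rewrite PA; apply: le_Ex => // w; rewrite indicE.
  case: (boolP (w \in A)) => [_|]; first by case/andP: (ramp01 (t - e) e (\sum_i xi i w)).
  rewrite notin_setE => /negP; rewrite -ltNge => /ltW tw.
  by rewrite ramp0// subrK.
have := H1 _ _ P _ xi mxi ixi xi2 xi0 s1; rewrite ler_norml => /andP[_ B1].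
have := H2 _ _ P _ xi mxi ixi xi2 xi0 s1; rewrite ler_norml => /andP[B2 _].
have M1 : K1 * lindeberg_sum P xi <= Num.max K1 K2 * lindeberg_sum P xi.
  by rewrite ler_wpM2r// le_max lexx.
have M2 : K2 * lindeberg_sum P xi <= Num.max K1 K2 * lindeberg_sum P xi.
  by rewrite ler_wpM2r// le_max lexx orbT.
have G1 := gauss_mean_ramp_ub t e0; have G2 := gauss_mean_ramp_lb (t - e) e0.
by apply/andP; split; lra.
Qed.

End NormalCdf.

(** * Expansion of ratios of standard deviations *)

Section WeightExpansion.
Context {R : realType}.

Lemma norm_div_le (a b A B : R) : 0 < B -> B <= b -> `|a| <= A -> `|a / b| <= A / B.
Proof.
move=> B0 Bb aA; have b0 := lt_le_trans B0 Bb.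
rewrite normrM normfV (gtr0_norm b0) ler_pM ?invr_ge0 ?(ltW b0)//.
by rewrite lef_pV2 ?posrE.
Qed.

Lemma norm_mul_le (a b A B : R) : `|a| <= A -> `|b| <= B -> `|a * b| <= A * B.
Proof. by move=> aA bB; rewrite normrM ler_pM. Qed.

Variables (m0 m1 m2 m3 : R -> R).
Hypotheses (d0 : forall x, is_derive x (1 : R) m0 (m1 x))
  (d1 : forall x, is_derive x (1 : R) m1 (m2 x))
  (d2 : forall x, is_derive x (1 : R) m2 (m3 x)).
Variables (c C M : R).
Hypotheses (c0 : 0 < c) (M0 : 0 <= M).

(** The situation in which the expansions below hold; the functions stand for the
    first three derivatives of the mean function. *)
Definition tame (x0 r : R) := forall z, `|z - x0| <= r ->
  [/\ c <= m1 z <= C, `|m2 z| <= M & `|m3 z| <= M].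

Definition sd x := Num.sqrt (m1 x).

Let between (x0 r x y z : R) : `|x - x0| <= r -> `|y - x0| <= r ->
  Num.min x y <= z <= Num.max x y -> `|z - x0| <= r.
Proof.
move=> /ler_normlP[x1 x2] /ler_normlP[y1 y2] /andP[zmin zmax]; apply/ler_normlP.
move: zmin zmax; rewrite ge_min le_max => /orP[] h1 /orP[] h2; split; lra.
Qed.

Let increment (f f' : R -> R) (x0 r K x y : R) : (forall z, is_derive z (1 : R) f (f' z)) ->
  (forall z, `|z - x0| <= r -> `|f' z| <= K) ->
  `|x - x0| <= r -> `|y - x0| <= r -> `|f x - f y| <= K * `|x - y|.
Proof.
move=> df fK xr yr; have [z zI ->] := @mean_value R f f' x y (fun z _ => df z).
by rewrite normrM ler_wpM2r// fK//; exact: between zI.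
Qed.

Let q := Num.sqrt c.
Let q0 : 0 < q. Proof. by rewrite sqrtr_gt0. Qed.
Let Q := Num.sqrt C.

Section OnePoint.
Variables (x0 r rho x y : R).
Hypotheses (tx : tame x0 r) (r_rho : r <= rho).
Hypotheses (xr : `|x - x0| <= r) (yr : `|y - x0| <= r).

Let r0 : 0 <= r. Proof. exact: le_trans xr. Qed.
Let x0r : `|x0 - x0| <= r. Proof. by rewrite subrr normr0. Qed.

Lemma sd_bounds z : `|z - x0| <= r -> q <= sd z <= Q.
Proof. by move=> /tx[/andP[h1 h2] _ _]; rewrite !ler_wsqrtr. Qed.

Lemma sqr_sd z : `|z - x0| <= r -> sd z ^+ 2 = m1 z.
Proof.
by move=> /tx[/andP[h1 h2] _ _]; rewrite sqr_sqrtr// (le_trans (ltW c0)).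
Qed.

Lemma sd_gt0 z : `|z - x0| <= r -> 0 < sd z.
Proof. by move=> /sd_bounds/andP[h _]; exact: lt_le_trans h. Qed.

Definition sd_slope := M / (2 * q).

Lemma sd_slope_ge0 : 0 <= sd_slope.
Proof. by rewrite divr_ge0// mulr_ge0// ltW. Qed.

Lemma sd_lip z w : `|z - x0| <= r -> `|w - x0| <= r ->
  `|sd z - sd w| <= sd_slope * `|z - w|.
Proof.
move=> zr wr.
have E : (sd z + sd w) * (sd z - sd w) = m1 z - m1 w.
  by rewrite -!sqr_sd//; ring.
have /andP[qz _] := sd_bounds zr; have /andP[qw _] := sd_bounds wr.
have s0 : 0 < sd z + sd w by rewrite addr_gt0// sd_gt0.
have I : `|m1 z - m1 w| <= M * `|z - w|.
  by apply: (@increment m1 m2 x0 r) => // v /tx[].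
rewrite /sd_slope mulrAC ler_pdivlMr ?mulr_gt0//; apply: le_trans I.
rewrite -E normrM (gtr0_norm s0) mulrC ler_wpM2r//; lra.
Qed.

(** Lipschitz constant, per unit of radius, of [sd] minus its linear part. *)
Definition sd_curv := M / (2 * q) + M * sd_slope / (2 * q ^+ 2).

Lemma sd_curv_ge0 : 0 <= sd_curv.
Proof.
apply: addr_ge0; first exact: sd_slope_ge0.
by apply: divr_ge0; apply: mulr_ge0 => //; [exact: sd_slope_ge0|rewrite exprn_ge0// ltW].
Qed.

(** Derivative of [sd]. *)
Definition dsd z := m2 z / (2 * sd z).

Lemma dsd_le : `|dsd x0| <= sd_slope.
Proof.
have /andP[qx _] := sd_bounds x0r; have [_ m2x _] := tx x0r.
by apply: norm_div_le => //; rewrite ?mulr_gt0// ler_pM2l.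
Qed.

(** [sd x - sd y] is [m1 x - m1 y] divided by [sd x + sd y]; the numerator is a mean
    value of [m2], and both it and the denominator are close to their values at [x0]. *)
Lemma sd_expand : `|sd x - sd y - dsd x0 * (x - y)| <= sd_curv * rho * `|x - y|.
Proof.
have [z zI E] := @mean_value R m1 m2 x y (fun z _ => d1 z).
have zr := between xr yr zI.
have /andP[qx _] := sd_bounds xr; have /andP[qy _] := sd_bounds yr.
have /andP[qx0 _] := sd_bounds x0r.
have [_ m20 _] := tx x0r.
have s0 : 0 < sd x + sd y by rewrite addr_gt0// sd_gt0.
have s1 := sd_gt0 x0r.
have E1 : sd x - sd y = m2 z * (x - y) / (sd x + sd y).
  apply: (canRL (mulfK _)); first by rewrite gt_eqF.
  by rewrite -E -!sqr_sd//; ring.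
have -> : sd x - sd y - dsd x0 * (x - y) = ((m2 z - m2 x0) / (sd x + sd y) +
    m2 x0 * (sd x0 - sd x + (sd x0 - sd y)) / ((sd x + sd y) * (2 * sd x0))) * (x - y).
  by rewrite E1 /dsd; field; rewrite !gt_eqF.
rewrite normrM ler_wpM2r//.
have rho0 : 0 <= rho := le_trans r0 r_rho.
have I2 : `|m2 z - m2 x0| <= M * rho.
  apply: (le_trans (@increment m2 m3 x0 r M z x0 d2 _ zr x0r)).
    by move=> v /tx[].
  by rewrite ler_wpM2l// (le_trans zr).
have Id w : `|w - x0| <= r -> `|sd x0 - sd w| <= sd_slope * rho.
  move=> wr; apply: (le_trans (sd_lip x0r wr)); rewrite ler_wpM2l ?sd_slope_ge0//.
  by rewrite distrC (le_trans wr).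
have I3 : `|sd x0 - sd x + (sd x0 - sd y)| <= 2 * (sd_slope * rho).
  apply: (le_trans (ler_normD _ _)); have := Id _ xr; have := Id _ yr; lra.
apply: (le_trans (ler_normD _ _)).
have -> : sd_curv * rho = (M * rho) / (2 * q) + M * (2 * (sd_slope * rho)) / ((2 * q) * (2 * q)).
  by rewrite /sd_curv; field; rewrite gt_eqF.
have qq0 : 0 < 2 * q by rewrite mulr_gt0.
apply: lerD.
  by apply: norm_div_le => //; lra.
apply: norm_div_le; [by rewrite mulr_gt0| |exact: norm_mul_le].
by apply: ler_pM; rewrite ?(ltW qq0)//; lra.
Qed.

Definition isd z := (sd z)^-1.
(** Derivative of [isd]. *)
Definition disd z := - dsd z / sd z ^+ 2.

Lemma isd_le z : `|z - x0| <= r -> `|isd z| <= q^-1.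
Proof.
move=> zr; have /andP[qz _] := sd_bounds zr.
by have := @norm_div_le 1 (sd z) 1 q q0 qz; rewrite normr1 !mul1r; apply.
Qed.

Lemma isd_lip z w : `|z - x0| <= r -> `|w - x0| <= r ->
  `|isd z - isd w| <= sd_slope / q ^+ 2 * `|z - w|.
Proof.
move=> zr wr.
have /andP[qz _] := sd_bounds zr; have /andP[qw _] := sd_bounds wr.
have sz := sd_gt0 zr; have sw := sd_gt0 wr.
have -> : isd z - isd w = (sd w - sd z) / (sd z * sd w).
  by rewrite /isd; field; rewrite !gt_eqF.
rewrite mulrAC expr2; apply: norm_div_le; first by rewrite mulr_gt0.
  by apply: ler_pM => //; exact: ltW.
by rewrite distrC; exact: sd_lip.
Qed.

Lemma disd_le : `|disd x0| <= sd_slope / q ^+ 2.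
Proof.
have /andP[qx _] := sd_bounds x0r.
apply: norm_div_le; rewrite ?exprn_gt0// ?normrN ?dsd_le//.
by rewrite ler_sqr ?nnegrE// ltW// sd_gt0.
Qed.

Definition isd_curv := sd_curv / q ^+ 2 + sd_slope * (2 * sd_slope * Q) / q ^+ 4.

Lemma Q_ge0 : 0 <= Q. Proof. exact: sqrtr_ge0. Qed.

Lemma isd_curv_ge0 : 0 <= isd_curv.
Proof.
have q1 := ltW q0; apply: addr_ge0; apply: divr_ge0; rewrite ?exprn_ge0 ?sd_curv_ge0//.
by rewrite mulr_ge0 ?sd_slope_ge0// mulr_ge0 ?Q_ge0// mulr_ge0 ?sd_slope_ge0.
Qed.

(** Reduced to [sd_expand] by writing the difference of the inverses over the common
    denominator [sd x * sd y]. *)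
Lemma isd_expand : `|isd x - isd y - disd x0 * (x - y)| <= isd_curv * rho * `|x - y|.
Proof.
have /andP[qx Qx] := sd_bounds xr; have /andP[qy Qy] := sd_bounds yr.
have /andP[qx0 Qx0] := sd_bounds x0r.
have sx := sd_gt0 xr; have sy := sd_gt0 yr; have s0 := sd_gt0 x0r.
have rho0 : 0 <= rho := le_trans r0 r_rho.
pose e := sd x - sd y - dsd x0 * (x - y).
have -> : isd x - isd y - disd x0 * (x - y) = - e / (sd x * sd y) +
    (dsd x0 * (sd x * (sd y - sd x0) + sd x0 * (sd x - sd x0))) * (x - y) /
      (sd x * sd y * (sd x0 * sd x0)).
  by rewrite /isd /disd /e; field; rewrite !gt_eqF.
apply: (le_trans (ler_normD _ _)).
have -> : isd_curv * rho * `|x - y| = (sd_curv * rho * `|x - y|) / (q * q) +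
   (sd_slope * (Q * (sd_slope * rho) + Q * (sd_slope * rho))) * `|x - y| / (q * q * (q * q)).
  by rewrite /isd_curv; field; rewrite gt_eqF.
have qq : 0 < q * q by rewrite mulr_gt0.
have qxy : q * q <= sd x * sd y by apply: ler_pM => //; exact: ltW.
have q00 : q * q <= sd x0 * sd x0 by apply: ler_pM => //; exact: ltW.
have Id w : `|w - x0| <= r -> `|sd w - sd x0| <= sd_slope * rho.
  move=> wr; apply: (le_trans (sd_lip wr x0r)); rewrite ler_wpM2l ?sd_slope_ge0//.
  by rewrite (le_trans wr).
apply: lerD.
  by apply: norm_div_le => //; rewrite normrN; exact: sd_expand.
apply: norm_div_le; [by rewrite mulr_gt0|by apply: ler_pM => //; exact: ltW|].
apply: norm_mul_le => //; apply: norm_mul_le; first exact: dsd_le.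
apply: (le_trans (ler_normD _ _)); apply: lerD; apply: norm_mul_le => //.
- by rewrite gtr0_norm.
- exact: Id.
- by rewrite gtr0_norm.
- exact: Id.
Qed.

End OnePoint.

(** One constant that dominates all the bounds on [sd], [isd] and their expansions;
    only its independence of the sample size matters. *)
Definition weight_const := Q + q^-1 + sd_slope + sd_slope / q ^+ 2 + sd_curv + isd_curv.

Lemma weight_const_ge : [/\ Q <= weight_const, q^-1 <= weight_const &
  [/\ sd_slope <= weight_const, sd_slope / q ^+ 2 <= weight_const,
      sd_curv <= weight_const & isd_curv <= weight_const]].
Proof.
have h1 := Q_ge0; have h2 := sd_slope_ge0; have h3 := sd_curv_ge0; have h4 := isd_curv_ge0.
have h5 : 0 <= q^-1 by rewrite invr_ge0 ltW.
have h6 : 0 <= sd_slope / q ^+ 2 by rewrite divr_ge0// exprn_ge0// ltW.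
by rewrite /weight_const; split; [lra|lra|split; lra].
Qed.

Lemma weight_const_ge0 : 0 <= weight_const.
Proof. by have [h _ _] := weight_const_ge; exact: le_trans Q_ge0 h. Qed.

Section TwoPoints.
Variables (x0 rx x y z0 rz z w rho : R).
Hypotheses (tx : tame x0 rx) (tz : tame z0 rz) (xrho : rx <= rho) (zrho : rz <= rho).
Hypotheses (xr : `|x - x0| <= rx) (yr : `|y - x0| <= rx).
Hypotheses (zr : `|z - z0| <= rz) (wr : `|w - z0| <= rz).

Let x0r : `|x0 - x0| <= rx. Proof. by rewrite subrr normr0 (le_trans _ xr). Qed.
Let z0r : `|z0 - z0| <= rz. Proof. by rewrite subrr normr0 (le_trans _ zr). Qed.
Let rho0 : 0 <= rho. Proof. by apply: le_trans xrho; exact: le_trans xr. Qed.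

Let sd_le v : `|v - x0| <= rx -> `|sd v| <= weight_const.
Proof.
move=> vr; rewrite gtr0_norm; last exact: sd_gt0 vr.
have /andP[_ h] := sd_bounds tx vr; have [h' _ _] := weight_const_ge; exact: le_trans h'.
Qed.

Let isd_leK v : `|v - z0| <= rz -> `|isd v| <= weight_const.
Proof. by move=> vr; have [_ h _] := weight_const_ge; exact: le_trans (isd_le tz vr) h. Qed.

Lemma weight_le : `|sd x0 / sd z0| <= weight_const ^+ 2.
Proof. by rewrite expr2; apply: norm_mul_le; [exact: sd_le|exact: isd_leK]. Qed.

Lemma slope1_le : `|dsd x0 * isd z0| <= weight_const ^+ 2.
Proof.
rewrite expr2; apply: norm_mul_le; last exact: isd_leK.
by have [_ _ [h _ _ _]] := weight_const_ge; exact: le_trans (dsd_le tx xr) h.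
Qed.

Lemma slope2_le : `|sd x0 * disd z0| <= weight_const ^+ 2.
Proof.
rewrite expr2; apply: norm_mul_le; first exact: sd_le.
by have [_ _ [_ h _ _]] := weight_const_ge; exact: le_trans (disd_le tz zr) h.
Qed.

Let lipx u v : `|u - x0| <= rx -> `|v - x0| <= rx -> `|sd u - sd v| <= weight_const * `|u - v|.
Proof.
move=> ur vr; apply: (le_trans (sd_lip tx ur vr)); rewrite ler_wpM2r//.
by have [_ _ [h _ _ _]] := weight_const_ge.
Qed.

Let lipz u v : `|u - z0| <= rz -> `|v - z0| <= rz -> `|isd u - isd v| <= weight_const * `|u - v|.
Proof.
move=> ur vr; apply: (le_trans (isd_lip tz ur vr)); rewrite ler_wpM2r//.
by have [_ _ [_ h _ _]] := weight_const_ge.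
Qed.

(** The slopes are taken at the fixed point [(x0, z0)] and not at the moving one: they
    are deterministic, so residuals can be averaged against them. *)
Lemma weight_expand :
  `|sd x / sd z - sd y / sd w -
     (dsd x0 * isd z0 * (x - y) + sd x0 * disd z0 * (z - w))|
  <= 2 * weight_const ^+ 2 * rho * (`|x - y| + `|z - w|).
Proof.
have K0 := weight_const_ge0.
have -> : sd x / sd z - sd y / sd w -
     (dsd x0 * isd z0 * (x - y) + sd x0 * disd z0 * (z - w)) =
   ((sd x - sd y - dsd x0 * (x - y)) * isd z +
    dsd x0 * (x - y) * (isd z - isd z0)) +
   (sd y * (isd z - isd w - disd z0 * (z - w)) +
    (sd y - sd x0) * (disd z0 * (z - w))).
  by rewrite /isd; ring.
have -> : 2 * weight_const ^+ 2 * rho * (`|x - y| + `|z - w|) =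
   (weight_const * rho * `|x - y| * weight_const + weight_const * `|x - y| * (weight_const * rho)) +
   (weight_const * (weight_const * rho * `|z - w|) + weight_const * rho * (weight_const * `|z - w|)) by ring.
have [_ _ [k1 k2 k3 k4]] := weight_const_ge.
apply: (le_trans (ler_normD _ _)); apply: lerD;
  apply: (le_trans (ler_normD _ _)); apply: lerD; apply: norm_mul_le.
- apply: (le_trans (sd_expand tx xrho xr yr)).
  by rewrite ler_wpM2r// ler_wpM2r.
- exact: isd_leK.
- by apply: norm_mul_le => //; exact: le_trans (dsd_le tx xr) k1.
- apply: (le_trans (lipz zr z0r)); rewrite ler_wpM2l//; exact: le_trans zrho.
- exact: sd_le.
- apply: (le_trans (isd_expand tz zrho zr wr)).
  by rewrite ler_wpM2r// ler_wpM2r.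
- apply: (le_trans (lipx yr x0r)); rewrite ler_wpM2l//; exact: le_trans xrho.
- by apply: norm_mul_le => //; exact: le_trans (disd_le tz zr) k2.
Qed.

Let weight_lip : `|sd x / sd z - sd y / sd w| <= weight_const ^+ 2 * (`|x - y| + `|z - w|).
Proof.
have -> : sd x / sd z - sd y / sd w = (sd x - sd y) * isd z + sd y * (isd z - isd w).
  by rewrite /isd; ring.
have -> : weight_const ^+ 2 * (`|x - y| + `|z - w|) = weight_const * `|x - y| * weight_const + weight_const * (weight_const * `|z - w|).
  by ring.
apply: (le_trans (ler_normD _ _)); apply: lerD; apply: norm_mul_le.
- exact: lipx.
- exact: isd_leK.
- exact: sd_le.
- exact: lipz.
Qed.

Let weight_dev : `|sd y / sd w - sd x0 / sd z0| <= 2 * weight_const ^+ 2 * rho.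
Proof.
have -> : sd y / sd w - sd x0 / sd z0 =
   (sd y - sd x0) * isd w + sd x0 * (isd w - isd z0) by rewrite /isd; ring.
have -> : 2 * weight_const ^+ 2 * rho = weight_const * rho * weight_const + weight_const * (weight_const * rho) by ring.
apply: (le_trans (ler_normD _ _)); apply: lerD; apply: norm_mul_le.
- apply: (le_trans (lipx yr x0r)); rewrite ler_wpM2l ?weight_const_ge0//; exact: le_trans xrho.
- exact: isd_leK.
- exact: sd_le.
- apply: (le_trans (lipz wr z0r)); rewrite ler_wpM2l ?weight_const_ge0//; exact: le_trans zrho.
Qed.

Definition mean_const := weight_const ^+ 2 * C + (2 * weight_const ^+ 2 * C + weight_const ^+ 2 * M).

Let C0 : 0 <= C.
Proof. by have [/andP[h1 h2] _ _] := tx x0r; apply: le_trans h2; exact: le_trans (ltW c0) h1. Qed.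

(** Only the derivative of the mean survives to first order, because the mean
    discrepancy vanishes at [z0]; by [m1 = sd ^+ 2] its weight is [sd x0 * sd z0]. *)
Lemma mean_expand :
  `|sd x / sd z * (m0 z0 - m0 z) - sd y / sd w * (m0 z0 - m0 w) +
     sd x0 * sd z0 * (z - w)| <= mean_const * rho * (`|x - y| + `|z - w|).
Proof.
have K0 := weight_const_ge0.
have m1C v : `|v - z0| <= rz -> `|m1 v| <= C.
  move=> /tz[/andP[h1 h2] _ _]; rewrite ger0_norm//.
  by apply: le_trans h1; exact: ltW.
have [v vI E] := @mean_value R m0 m1 z w (fun z _ => d0 z).
have vr := between zr wr vI.
have E0 : sd x0 * sd z0 = sd x0 / sd z0 * m1 z0.
  have := sd_gt0 tz z0r; have := sqr_sd tz z0r => <- s0.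
  by field; rewrite gt_eqF.
have -> : sd x / sd z * (m0 z0 - m0 z) - sd y / sd w * (m0 z0 - m0 w) +
     sd x0 * sd z0 * (z - w) =
   (sd x / sd z - sd y / sd w) * (m0 z0 - m0 z) +
   ((sd x0 / sd z0 - sd y / sd w) * m1 v + sd x0 / sd z0 * (m1 z0 - m1 v)) * (z - w).
  rewrite E0.
  have -> : m0 z0 - m0 w = (m0 z0 - m0 z) + (m0 z - m0 w) by ring.
  by rewrite E; ring.
apply: (le_trans (ler_normD _ _)).
have I1 : `|(sd x / sd z - sd y / sd w) * (m0 z0 - m0 z)| <=
    weight_const ^+ 2 * (`|x - y| + `|z - w|) * (C * rho).
  apply: norm_mul_le; first exact: weight_lip.
  apply: (le_trans (@increment m0 m1 z0 rz C z0 z d0 m1C z0r zr)).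
  by rewrite ler_wpM2l// distrC (le_trans zr).
have I2 : `|((sd x0 / sd z0 - sd y / sd w) * m1 v + sd x0 / sd z0 * (m1 z0 - m1 v)) * (z - w)|
    <= (2 * weight_const ^+ 2 * rho * C + weight_const ^+ 2 * (M * rho)) * `|z - w|.
  apply: norm_mul_le => //; apply: (le_trans (ler_normD _ _)); apply: lerD.
    by apply: norm_mul_le; [rewrite distrC; exact: weight_dev|exact: m1C].
  apply: norm_mul_le; first exact: weight_le.
  apply: (le_trans (@increment m1 m2 z0 rz M z0 v d1 _ z0r vr)).
    by move=> u /tz[].
  by rewrite ler_wpM2l// distrC (le_trans vr).
apply: (le_trans (lerD I1 I2)).
have -> : mean_const * rho * (`|x - y| + `|z - w|) =
  weight_const ^+ 2 * (`|x - y| + `|z - w|) * (C * rho) +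
  (2 * weight_const ^+ 2 * rho * C + weight_const ^+ 2 * (M * rho)) * (`|x - y| + `|z - w|).
  by rewrite /mean_const; ring.
rewrite lerD2l ler_wpM2l ?lerDr//.
by rewrite addr_ge0// !mulr_ge0// exprn_ge0.
Qed.

End TwoPoints.
End WeightExpansion.

(** * The estimating function near the true parameter *)

Section Score.
Context {R : realType}.
Variables (mu : R -> R) (m p n : nat) (X : 'I_n -> 'M[R]_(m, p)).

Definition covar i j : 'cV[R]_p := (row j (X i))^T.
Local Notation x := covar.

Lemma linpredE i b j : linpred (X i) b j = dot (x i j) b.
Proof. by rewrite /linpred mxE; apply: eq_bigr => k _; rewrite !mxE. Qed.

Lemma trmx_mul_covar i (z : 'cV[R]_m) : (X i)^T *m z = \sum_j z j ord0 *: x i j.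
Proof.
apply/matrixP => l o; rewrite ord1 mxE summxE; apply: eq_bigr => j _.
by rewrite !mxE mulrC.
Qed.

Local Notation s := (sd mu^`()%classic).
Local Notation eta b i j := (dot (x i j) b).

(** What the entry [(j, k)] of the inverse working matrix multiplies in the estimating
    function. These sums do not involve the working matrix. *)
Definition pair_score (y : 'I_n -> 'cV[R]_m) j k b : 'cV[R]_p :=
  \sum_i (s (eta b i j) / s (eta b i k) * (y i k ord0 - mu (eta b i k))) *: x i j.

Lemma gee_score_pairs (W : 'M[R]_m) y b : gee_score mu X W y b =
  \sum_j \sum_k invmx W j k *: pair_score y j k b.
Proof.
rewrite /gee_score /pair_score.
under [RHS]eq_bigr do under eq_bigr do rewrite scaler_sumr.
under [RHS]eq_bigr do rewrite exchange_big/=.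
rewrite [RHS]exchange_big/=; apply: eq_bigr => i _.
rewrite -!mulmxA trmx_mul_covar; apply: eq_bigr => j _.
under [RHS]eq_bigr do rewrite scalerA.
rewrite -scaler_suml; congr (_ *: _).
rewrite /Ahalf mul_diag_mx !mxE mulr_sumr; apply: eq_bigr => k _.
rewrite /Ainvhalf mul_diag_mx !mxE !linpredE /sd.
by ring.
Qed.

Lemma Ahalf_mulX b i u j : (Ahalf mu (X i) b *m (X i *m u)) j ord0 =
  s (eta b i j) * dot (x i j) u.
Proof.
by rewrite /Ahalf mul_diag_mx mxE -/(linpred (X i) u j) mxE !linpredE.
Qed.

Lemma Ahalf_sym b i : (Ahalf mu (X i) b)^T = Ahalf mu (X i) b.
Proof. by rewrite /Ahalf tr_diag_mx. Qed.

Lemma Hbar_dot (V : 'M[R]_m) b u v : dot v (Hbar mu X V b *m u) =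
  \sum_i dot (Ahalf mu (X i) b *m (X i *m v))
    (invmx V *m (Ahalf mu (X i) b *m (X i *m u))).
Proof.
rewrite /Hbar mulmx_suml dot_sumr; apply: eq_bigr => i _.
rewrite -!mulmxA dot_trmx trmxK.
by rewrite dot_trmx Ahalf_sym.
Qed.

Lemma Hbar_pairs (V : 'M[R]_m) b u v : dot v (Hbar mu X V b *m u) =
  \sum_j \sum_k invmx V j k *
    \sum_i s (eta b i j) * s (eta b i k) * (dot (x i j) v * dot (x i k) u).
Proof.
under [RHS]eq_bigr do under eq_bigr do rewrite mulr_sumr.
under [RHS]eq_bigr do rewrite exchange_big/=.
rewrite [RHS]exchange_big/= Hbar_dot; apply: eq_bigr => i _.
apply: eq_bigr => j _; rewrite Ahalf_mulX mxE mulr_sumr; apply: eq_bigr => k _.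
by rewrite Ahalf_mulX; ring.
Qed.

Lemma Mbar_quad (V S : 'M[R]_m) b u : V^T = V ->
  quad (Mbar mu X V S b) u =
  \sum_i quad S (invmx V *m (Ahalf mu (X i) b *m (X i *m u))).
Proof.
move=> sV; rewrite /quad /Mbar mulmx_suml dot_sumr; apply: eq_bigr => i _.
rewrite -!mulmxA dot_trmx trmxK dot_trmx Ahalf_sym dot_trmx.
by rewrite trmx_inv sV.
Qed.

Lemma Mbar_sym (V S : 'M[R]_m) b : V^T = V -> S^T = S ->
  (Mbar mu X V S b)^T = Mbar mu X V S b.
Proof.
move=> sV sS; rewrite /Mbar raddf_sum/=; apply: eq_bigr => i _.
by rewrite !trmx_mul trmxK Ahalf_sym trmx_inv sV sS !mulmxA.
Qed.

Section Lipschitz.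
Variables (m2 m3 : R -> R).
Hypotheses (d0 : forall z, is_derive z (1 : R) mu (mu^`()%classic z))
  (d1 : forall z, is_derive z (1 : R) (mu^`()%classic) (m2 z))
  (d2 : forall z, is_derive z (1 : R) m2 (m3 z)).
Variables (c C M : R).
Hypotheses (c0 : 0 < c) (C0 : 0 <= C) (M0 : 0 <= M).
Variables (b0 : 'cV[R]_p) (r Xb G Ge Phi T0 : R) (y : 'I_n -> 'cV[R]_m).
Hypotheses (r0 : 0 <= r) (Xb0 : 0 <= Xb).
Hypothesis tameX : forall i j,
  tame (mu^`()%classic) m2 m3 c C M (eta b0 i j) (r * enorm (x i j)).
Hypothesis normX : forall i j, enorm (x i j) <= Xb.
Hypothesis G0 : 0 <= G.
Hypothesis gram : forall j u, \sum_i dot (x i j) u ^+ 2 <= G * dot u u.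

Local Notation eps i k := (y i k ord0 - mu (eta b0 i k)).
Local Notation slope1 i j k := (dsd mu^`()%classic m2 (eta b0 i j) * isd mu^`()%classic (eta b0 i k)).
Local Notation slope2 i j k := (s (eta b0 i j) * disd mu^`()%classic m2 (eta b0 i k)).

Hypothesis Ge0 : 0 <= Ge.
Hypothesis abs_gram : forall j k u, \sum_i `|eps i k| * dot (x i j) u ^+ 2 <= Ge * dot u u.
Hypothesis Phi1 : forall j k,
  enorm (\sum_i (eps i k * slope1 i j k) *: (x i j *m (x i j)^T)) <= Phi.
Hypothesis Phi2 : forall j k,
  enorm (\sum_i (eps i k * slope2 i j k) *: (x i j *m (x i k)^T)) <= Phi.
Hypothesis start : forall j k, enorm (pair_score y j k b0) <= T0.

Let K := weight_const c C M.
Let L := mean_const c C M.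
Let rho := r * Xb.

(** [2 * Phi] bounds the residuals against the fixed slopes, the second term the residuals
    against the remainders of the weights, the third one the remainders of the means. *)
Definition score_slack := 2 * Phi + 4 * K ^+ 2 * rho * Ge + 2 * L * rho * G.

Local Notation Hjk j k v u :=
  (\sum_i s (eta b0 i j) * s (eta b0 i k) * (dot (x i j) v * dot (x i k) u)).

Let etar i j b : enorm (b - b0) <= r -> `|eta b i j - eta b0 i j| <= r * enorm (x i j).
Proof.
move=> br; rewrite -dotBr; apply: (le_trans (dot_CS _ _)).
by rewrite mulrC ler_wpM2r// enorm_ge0.
Qed.

Let rX i j : r * enorm (x i j) <= rho.
Proof. by rewrite ler_wpM2l. Qed.

Let sum_le (w : 'I_n -> R) j k u v Q : (forall i, 0 <= w i) -> 0 <= Q ->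
  (forall j u, \sum_i w i * dot (x i j) u ^+ 2 <= Q * dot u u) ->
  \sum_i w i * `|dot (x i j) u| * `|dot (x i k) v| <= Q * (enorm u * enorm v).
Proof.
move=> w0 Q0 H.
have -> : Q * (enorm u * enorm v) = (Num.sqrt Q * enorm u) * (Num.sqrt Q * enorm v).
  by rewrite mulrACA -expr2 sqr_sqrtr.
apply: sum_CS_le; rewrite ?mulr_ge0 ?sqrtr_ge0 ?enorm_ge0//.
  by rewrite exprMn sqr_sqrtr// sqr_enorm.
by rewrite exprMn sqr_sqrtr// sqr_enorm.
Qed.

Let fro_le (w : 'I_n -> R) j k v u :
  enorm (\sum_i w i *: (x i j *m (x i k)^T)) <= Phi ->
  `|\sum_i w i * (dot (x i j) v * dot (x i k) u)| <= Phi * (enorm v * enorm u).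
Proof.
move=> H.
have -> : \sum_i w i * (dot (x i j) v * dot (x i k) u) =
    dot v ((\sum_i w i *: (x i j *m (x i k)^T)) *m u).
  rewrite mulmx_suml dot_sumr; apply: eq_bigr => i _.
  by rewrite -scalemxAl dotZr outer_dot.
apply: (le_trans (bilin_enorm _ _ _)); rewrite -mulrA.
by apply: ler_wpM2r => //; rewrite mulr_ge0 ?enorm_ge0.
Qed.

(** Expand the ratio of weights and the mean at [b0]. The residuals multiply the slopes of
    that ratio ([Phi1], [Phi2]) and its remainders ([abs_gram]); the mean
    discrepancies contribute [- H] up to a remainder controlled by [gram]. *)
Lemma pair_score_expand j k b b' v : enorm (b - b0) <= r -> enorm (b' - b0) <= r ->
  `|dot v (pair_score y j k b - pair_score y j k b') + Hjk j k v (b - b')|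
    <= score_slack * (enorm v * enorm (b - b')).
Proof.
move=> br br'; set u := b - b'.
pose Ds i := eta b i j - eta b' i j; pose Dt i := eta b i k - eta b' i k.
have DsE i : Ds i = dot (x i j) u by rewrite /Ds -dotBr.
have DtE i : Dt i = dot (x i k) u by rewrite /Dt -dotBr.
(* remainders of the expansions of the weight and of the weighted mean *)
pose e1 i := s (eta b i j) / s (eta b i k) - s (eta b' i j) / s (eta b' i k) -
  (slope1 i j k * Ds i + slope2 i j k * Dt i).
pose e2 i := s (eta b i j) / s (eta b i k) * (mu (eta b0 i k) - mu (eta b i k)) -
  s (eta b' i j) / s (eta b' i k) * (mu (eta b0 i k) - mu (eta b' i k)) +
  s (eta b0 i j) * s (eta b0 i k) * Dt i.
have e1P i : `|e1 i| <= 2 * K ^+ 2 * rho * (`|Ds i| + `|Dt i|).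
  exact: (weight_expand d1 d2 c0 M0 (@tameX i j) (@tameX i k) (rX i j) (rX i k)
    (@etar i j b br) (@etar i j b' br') (@etar i k b br) (@etar i k b' br')).
have e2P i : `|e2 i| <= L * rho * (`|Ds i| + `|Dt i|).
  exact: (mean_expand d0 d1 c0 M0 (@tameX i j) (@tameX i k) (rX i j) (rX i k)
    (@etar i j b br) (@etar i j b' br') (@etar i k b br) (@etar i k b' br')).
have -> : dot v (pair_score y j k b - pair_score y j k b') + Hjk j k v u =
    (\sum_i (eps i k * slope1 i j k) * (dot (x i j) v * dot (x i j) u) +
     \sum_i (eps i k * slope2 i j k) * (dot (x i j) v * dot (x i k) u)) +
    \sum_i (eps i k * e1 i + e2 i) * dot (x i j) v.
  rewrite /pair_score dotBr !dot_sumr -sumrB -!big_split/=; apply: eq_bigr => i _.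
  rewrite /e1 /e2 !dotZr -DsE -DtE (dotC v).
  by ring.
have K0 : 0 <= K := weight_const_ge0 C c0 M0.
have L0 : 0 <= L by rewrite !addr_ge0 ?mulr_ge0 ?exprn_ge0.
have rho0 : 0 <= rho by exact: mulr_ge0.
have nuv : 0 <= enorm v * enorm u by rewrite mulr_ge0 ?enorm_ge0.
have I1 := fro_le v u (Phi1 j k); have I2 := fro_le v u (Phi2 j k).
have I3 : `|\sum_i (eps i k * e1 i + e2 i) * dot (x i j) v| <=
    (4 * K ^+ 2 * rho * Ge + 2 * L * rho * G) * (enorm v * enorm u).
  apply: (@le_trans _ _ (\sum_i ((2 * K ^+ 2 * rho) *
      (`|eps i k| * `|dot (x i j) v| * `|dot (x i j) u| +
       `|eps i k| * `|dot (x i j) v| * `|dot (x i k) u|) +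
      (L * rho) * (1 * `|dot (x i j) v| * `|dot (x i j) u| +
       1 * `|dot (x i j) v| * `|dot (x i k) u|)))).
    apply: (le_trans (ler_norm_sum _ _ _)); apply: ler_sum => i _.
    rewrite normrM.
    have -> : 2 * K ^+ 2 * rho *
      (`|eps i k| * `|dot (x i j) v| * `|dot (x i j) u| +
       `|eps i k| * `|dot (x i j) v| * `|dot (x i k) u|) +
      L * rho * (1 * `|dot (x i j) v| * `|dot (x i j) u| +
       1 * `|dot (x i j) v| * `|dot (x i k) u|) =
      (`|eps i k| * (2 * K ^+ 2 * rho * (`|Ds i| + `|Dt i|)) +
       L * rho * (`|Ds i| + `|Dt i|)) * `|dot (x i j) v|.
      by rewrite DsE DtE; ring.
    rewrite ler_wpM2r//; apply: (le_trans (ler_normD _ _)); apply: lerD => //.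
    by rewrite normrM ler_wpM2l.
  rewrite big_split/= -!mulr_sumr !big_split/=.
  have gram1 j' u' : \sum_i 1 * dot (x i j') u' ^+ 2 <= G * dot u' u'.
    by under eq_bigr do rewrite mul1r.
  have S1 := @sum_le (fun i => `|eps i k|) j j v u Ge (fun=> normr_ge0 _) Ge0 (fun j' u' => abs_gram j' k u').
  have S2 := @sum_le (fun i => `|eps i k|) j k v u Ge (fun=> normr_ge0 _) Ge0 (fun j' u' => abs_gram j' k u').
  have S3 := @sum_le (fun=> 1) j j v u G (fun=> ler01) G0 gram1.
  have S4 := @sum_le (fun=> 1) j k v u G (fun=> ler01) G0 gram1.
  have -> : (4 * K ^+ 2 * rho * Ge + 2 * L * rho * G) * (enorm v * enorm u) =
    2 * K ^+ 2 * rho * (Ge * (enorm v * enorm u) + Ge * (enorm v * enorm u)) +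
    L * rho * (G * (enorm v * enorm u) + G * (enorm v * enorm u)) by ring.
  by apply: lerD; apply: ler_wpM2l; rewrite ?mulr_ge0 ?exprn_ge0//; exact: lerD.
apply: (le_trans (ler_normD _ _)).
have -> : score_slack * (enorm v * enorm u) =
  (Phi * (enorm v * enorm u) + Phi * (enorm v * enorm u)) +
  (4 * K ^+ 2 * rho * Ge + 2 * L * rho * G) * (enorm v * enorm u).
  by rewrite /score_slack; ring.
apply: lerD => //; apply: (le_trans (ler_normD _ _)); exact: lerD.
Qed.

Lemma pair_info_le j k v u : `|Hjk j k v u| <= K ^+ 2 * G * (enorm v * enorm u).
Proof.
have K0 : 0 <= K := weight_const_ge0 C c0 M0.
have eta0 i l : `|eta b0 i l - eta b0 i l| <= r * enorm (x i l).
  by rewrite subrr normr0 mulr_ge0 ?enorm_ge0.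
have sK i l : `|s (eta b0 i l)| <= K.
  have h := eta0 i l.
  rewrite gtr0_norm; last exact: (sd_gt0 c0 (@tameX i l) h).
  have /andP[_ h1] := sd_bounds (@tameX i l) h.
  by have [h2 _ _] := weight_const_ge C c0 M0; exact: le_trans h1 h2.
apply: (@le_trans _ _ (\sum_i K ^+ 2 * (1 * `|dot (x i j) v| * `|dot (x i k) u|))).
  apply: (le_trans (ler_norm_sum _ _ _)); apply: ler_sum => i _.
  by rewrite mul1r expr2; apply: norm_mul_le; [exact: norm_mul_le|rewrite normrM].
rewrite -mulr_sumr -mulrA ler_wpM2l ?exprn_ge0//.
apply: sum_le => // j' u'.
by under eq_bigr do rewrite mul1r.
Qed.

Lemma pair_score_lip j k b b' v : enorm (b - b0) <= r -> enorm (b' - b0) <= r ->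
  `|dot v (pair_score y j k b - pair_score y j k b')|
    <= (score_slack + K ^+ 2 * G) * (enorm v * enorm (b - b')).
Proof.
move=> br br'; have h1 := @pair_score_expand j k b b' v br br'.
have h2 := pair_info_le j k v (b - b').
rewrite -[dot v _](addrK (Hjk j k v (b - b'))).
apply: (le_trans (ler_normB _ _)); rewrite mulrDl; exact: lerD.
Qed.

Section WorkingMatrix.
Variables (W V : 'M[R]_m) (tau kappa : R).
Hypothesis WV : enorm (invmx W - invmx V) <= tau.
Hypothesis Vk : enorm (invmx V) <= kappa.

Let S b := gee_score mu X W y b.

Let WVjk j k : `|invmx W j k - invmx V j k| <= tau.
Proof.
have := entry_le_enorm (invmx W - invmx V) j k; rewrite !mxE => h.
exact: le_trans h WV.
Qed.

Let Vjk j k : `|invmx V j k| <= kappa.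
Proof. exact: le_trans (entry_le_enorm _ _ _) Vk. Qed.

Let sum_const_le (f : 'I_m -> 'I_m -> R) B : (forall j k, `|f j k| <= B) ->
  `|\sum_j \sum_k f j k| <= m%:R ^+ 2 * B.
Proof.
move=> fB; apply: (@le_trans _ _ (\sum_(j < m) \sum_(k < m) B)).
  apply: (le_trans (ler_norm_sum _ _ _)); apply: ler_sum => j _.
  by apply: (le_trans (ler_norm_sum _ _ _)); apply: ler_sum => k _.
by rewrite !sumr_const !card_ord -(mulr_natl B) -(mulr_natl (_ * _)) mulrA -expr2.
Qed.

Definition score_err :=
  m%:R ^+ 2 * (kappa * score_slack + tau * (score_slack + K ^+ 2 * G)).

(** The estimating function is, up to a small Lipschitz error, the linear map [- Hbar].
    The error of the working matrix multiplies full increments of the pair scores, not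
    only the remainders, hence the term [weight_const ^+ 2 * G] in [score_err]. *)
Lemma score_expand b b' : enorm (b - b0) <= r -> enorm (b' - b0) <= r ->
  forall v, `|dot v (S b - S b' + Hbar mu X V b0 *m (b - b'))|
    <= score_err * (enorm v * enorm (b - b')).
Proof.
move=> br br' v; set u := b - b'.
have -> : dot v (S b - S b' + Hbar mu X V b0 *m u) = \sum_j \sum_k
  (invmx V j k * (dot v (pair_score y j k b - pair_score y j k b') + Hjk j k v u) +
   (invmx W j k - invmx V j k) * dot v (pair_score y j k b - pair_score y j k b')).
  rewrite dotDr dotBr Hbar_pairs /S !gee_score_pairs !dot_sumr -sumrB -big_split/=.
  apply: eq_bigr => j _; rewrite !dot_sumr -sumrB -big_split/=.
  by apply: eq_bigr => k _; rewrite !dotZr !dotBr; ring.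
rewrite /score_err -mulrA; apply: sum_const_le => j k.
have -> : (kappa * score_slack + tau * (score_slack + K ^+ 2 * G)) * (enorm v * enorm u) =
  kappa * (score_slack * (enorm v * enorm u)) +
  tau * ((score_slack + K ^+ 2 * G) * (enorm v * enorm u)) by ring.
apply: (le_trans (ler_normD _ _)); apply: lerD; apply: norm_mul_le => //.
  exact: pair_score_expand.
exact: pair_score_lip.
Qed.

Lemma score_start_diff v :
  `|dot v (S b0 - gee_score mu X V y b0)| <= m%:R ^+ 2 * (tau * T0) * enorm v.
Proof.
have -> : dot v (S b0 - gee_score mu X V y b0) =
    \sum_j \sum_k (invmx W j k - invmx V j k) * dot v (pair_score y j k b0).
  rewrite dotBr /S !gee_score_pairs !dot_sumr -sumrB; apply: eq_bigr => j _.
  rewrite !dot_sumr -sumrB; apply: eq_bigr => k _.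
  by rewrite !dotZr; ring.
rewrite -mulrA; apply: sum_const_le => j k.
rewrite -mulrA; apply: norm_mul_le => //.
by apply: (le_trans (dot_CS _ _)); rewrite mulrC ler_wpM2r ?enorm_ge0.
Qed.

Lemma score_start_le v :
  `|dot v (S b0)| <= m%:R ^+ 2 * ((kappa + tau) * T0) * enorm v.
Proof.
have -> : dot v (S b0) =
    \sum_j \sum_k invmx W j k * dot v (pair_score y j k b0).
  rewrite /S !gee_score_pairs !dot_sumr; apply: eq_bigr => j _.
  by rewrite !dot_sumr; apply: eq_bigr => k _; rewrite !dotZr.
rewrite -mulrA; apply: sum_const_le => j k.
rewrite -mulrA; apply: norm_mul_le.
  rewrite -[invmx W j k](subrK (invmx V j k)) addrC (addrC kappa).
  by rewrite addrC; apply: (le_trans (ler_normD _ _)); apply: lerD.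
by apply: (le_trans (dot_CS _ _)); rewrite mulrC ler_wpM2r ?enorm_ge0.
Qed.

(** The map [b + H^-1 (S b)] contracts the ball by one half because [S] is close to
    [- H], and maps the ball to itself because [S b0] is small; its fixed point is a root. *)
Lemma score_root (h : R) : 0 < h ->
  (forall u, h * dot u u <= dot u (Hbar mu X V b0 *m u)) ->
  score_err <= h / 2 ->
  m%:R ^+ 2 * ((kappa + tau) * T0) <= h / 2 * r ->
  exists2 b, S b = 0 & enorm (b - b0) <= r.
Proof.
move=> h0 hH herr hstart; pose H := Hbar mu X V b0.
have Hlow (u : 'cV[R]_p) : h * enorm u <= enorm (H *m u).
  have [->|u0] := eqVneq (enorm u) 0; first by rewrite mulr0 enorm_ge0.
  have u1 : 0 < enorm u by rewrite lt_neqAle eq_sym u0 enorm_ge0.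
  rewrite -(ler_pM2l u1); have := hH u; rewrite -sqr_enorm => hu.
  apply: (@le_trans _ _ (dot u (H *m u))); first by rewrite mulrCA -expr2.
  by apply: le_trans (dot_CS u _); exact: ler_norm.
have uH : H \in unitmx.
  apply: unitmx_of_ker0 => z Hz; apply: enorm_eq0.
  have := Hlow z; rewrite Hz enorm0 pmulr_rle0// => hz.
  by apply/eqP; rewrite eq_le hz enorm_ge0.
have invH (z : 'cV[R]_p) : enorm (invmx H *m z) <= enorm z / h.
  rewrite ler_pdivlMr// mulrC; apply: (le_trans (Hlow _)).
  by rewrite mulKVmx.
(* a Newton step with the limiting derivative [- H] *)
pose f b := b + invmx H *m S b.
have fE b b' : f b - f b' = invmx H *m (S b - S b' + H *m (b - b')).
  by rewrite mulmxDr mulKmx// mulmxBr /f opprD addrACA addrC.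
have fc b b' : enorm (b - b0) <= r -> enorm (b' - b0) <= r ->
    enorm (f b - f b') <= 2^-1 * enorm (b - b').
  move=> br br'; rewrite fE; apply: (le_trans (invH _)); rewrite ler_pdivrMr//.
  apply: enorm_le_dot => [|v]; first by rewrite !mulr_ge0 ?enorm_ge0 ?(ltW h0).
  apply: (le_trans (score_expand br br' v)).
  rewrite (_ : 2^-1 * _ * h * _ = (h / 2) * (enorm v * enorm (b - b'))); last by ring.
  by rewrite ler_wpM2r// mulr_ge0 ?enorm_ge0.
have b0r : enorm (b0 - b0) <= r by rewrite subrr enorm0.
have f0 : enorm (f b0 - b0) <= 2^-1 * r.
  rewrite /f addrAC subrr add0r; apply: (le_trans (invH _)); rewrite ler_pdivrMr//.
  apply: enorm_le_dot => [|v]; first by rewrite !mulr_ge0 ?(ltW h0).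
  apply: (le_trans (score_start_le v)); rewrite ler_wpM2r ?enorm_ge0//.
  by rewrite (_ : 2^-1 * r * h = h / 2 * r)//; ring.
have [|b br fb] := @contraction_fixpoint R p b0 r f r0 _ fc.
  move=> b br; have -> : f b - b0 = (f b - f b0) + (f b0 - b0).
    by rewrite addrA subrK.
  apply: (le_trans (enormD _ _)); have := fc _ _ br b0r; lra.
exists b => //.
have : invmx H *m S b = 0 by apply: (addrI b); rewrite addr0.
by move=> /(congr1 (mulmx H)); rewrite mulKVmx// mulmx0.
Qed.

End WorkingMatrix.
End Lipschitz.
End Score.

(** * Events of large probability *)

Section Events.
Context d (T : measurableType d) (R : realType) (P : probability T R).

Lemma prob_geW E F r : E `<=` F -> prob_ge P E r -> prob_ge P F r.
Proof. by move=> EF [A [mA AE PA]]; exists A; split => // w /AE/EF. Qed.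

Lemma prob_ge_le E r s : s <= r -> prob_ge P E r -> prob_ge P E s.
Proof. by move=> sr [A [mA AE PA]]; exists A; split => //; rewrite (le_trans _ PA)// lee_fin. Qed.

Lemma prob_ge_compl A a : measurable A -> (P A <= a%:E)%E -> prob_ge P (~` A) (1 - a).
Proof.
move=> mA PA; exists (~` A); split => //; first exact: measurableC.
rewrite probability_setC// EFinB leeB//.
Qed.

Lemma prob_geI E F a b : prob_ge P E (1 - a) -> prob_ge P F (1 - b) ->
  prob_ge P (E `&` F) (1 - (a + b)).
Proof.
move=> [A [mA AE PA]] [B [mB BF PB]]; exists (A `&` B); split.
- exact: measurableI.
- by move=> w [/AE ? /BF ?].
have cA : (P (~` A) <= a%:E)%E.
  rewrite probability_setC//; move: PA; rewrite -[P A]fineK ?fin_num_measure//.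
  by rewrite lee_fin -[1%E]/(1%:E) -EFinB lee_fin; lra.
have cB : (P (~` B) <= b%:E)%E.
  rewrite probability_setC//; move: PB; rewrite -[P B]fineK ?fin_num_measure//.
  by rewrite lee_fin -[1%E]/(1%:E) -EFinB lee_fin; lra.
have mU : measurable (~` A `|` ~` B) by apply: measurableU; exact: measurableC.
have : (P (~` A `|` ~` B) <= (a + b)%:E)%E.
  apply: (@le_trans _ _ (P (~` A) + P (~` B))%E).
    by apply: measureU2; exact: measurableC.
  by rewrite EFinD leeD.
rewrite -setCI probability_setC; last exact: measurableI.
rewrite -[P (A `&` B)]fineK ?fin_num_measure//; last exact: measurableI.
by rewrite -[1%E]/(1%:E) -EFinB !lee_fin; lra.
Qed.

(** Markov's inequality is applied to the sum of the variables, which dominates each. *)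
Lemma prob_ge_markov (I : finType) (Q : I -> T -> R) (B : R) (th : R) : 0 < B -> 0 < th ->
  (forall e, integ P (Q e)) -> (forall e w, 0 <= Q e w) -> (forall e, Ex P (Q e) <= B) ->
  prob_ge P [set w | forall e, Q e w <= th * B] (1 - #|I|%:R / th).
Proof.
move=> B0 th0 IQ Q0 QB.
pose Qs w := \sum_e Q e w.
have IQs : integ P Qs by exact: integ_sum.
have Qs0 w : 0 <= Qs w by exact: sumr_ge0.
apply: (@prob_geW (~` [set w | th * B <= Qs w])).
  move=> w /negP; rewrite -ltNge => /ltW h e; apply: le_trans h.
  by rewrite /Qs (bigD1 e)//= lerDl sumr_ge0.
apply: prob_ge_compl.
  have -> : [set w | th * B <= Qs w] = Qs @^-1` `[th * B, +oo[%classic.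
    by apply/seteqP; split => w; rewrite /= in_itv/= andbT.
  by apply: preim_measurable; [exact: integ_measurable IQs|exact: measurable_itv].
apply: markov_ge => //; first exact: mulr_gt0.
rewrite Ex_sum//; apply: (@le_trans _ _ (\sum_(e : I) B)); first exact: ler_sum.
have -> : th * B * (#|I|%:R / th) = #|I|%:R * B by field; rewrite gt_eqF.
by rewrite sumr_const mulr_natl.
Qed.

End Events.

Section Model.
Context d (T : measurableType d) (R : realType) (P : probability T R).

Lemma centered_moments (U : {RV P >-> R}) (e v : R) :
  ('E_P[U] = e%:E)%E -> ('V_P[U] = v%:E)%E ->
  [/\ integ P (fun w => (U w - e) ^+ 2), Ex P (fun w => (U w - e) ^+ 2) = v &
      Ex P (fun w => U w - e) = 0].
Proof.
move=> EU VU.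
have mU : measurable_fun setT U by [].
have [IU E1] : integ P U /\ Ex P U = e.
  by apply: integral_fin_integ => //; rewrite -EU unlock.
have mUe : measurable_fun setT (fun w => U w - e) by exact: measurable_funB.
have [I2 E2] : integ P (fun w => (U w - e) ^+ 2) /\ Ex P (fun w => (U w - e) ^+ 2) = v.
  apply: integral_fin_integ; first exact: measurable_funX.
  rewrite -VU /variance unlock EU unlock.
  by apply: eq_integral => w _; rewrite expr2.
split => //; rewrite ExB// ?E1 ?Ex_cst ?subrr//; exact: integ_cst.
Qed.

Lemma cross_moment (U V : {RV P >-> R}) (e f r s t : R) :
  ('E_P[U] = e%:E)%E -> ('E_P[V] = f%:E)%E -> ('V_P[U] = s%:E)%E -> ('V_P[V] = t%:E)%E ->
  0 < s -> 0 < t -> correlation P U V = r ->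
  Ex P (fun w => (U w - e) * (V w - f)) = r * (Num.sqrt s * Num.sqrt t).
Proof.
move=> EU EV VU VV s0 t0 <-.
have [IU _ _] := centered_moments EU VU; have [IV _ _] := centered_moments EV VV.
rewrite /correlation VU VV/= divfK; last by rewrite mulf_neq0// gt_eqF// sqrtr_gt0.
rewrite unlock EU EV unlock /Ex /Rintegral; congr fine.
Qed.

End Model.

(** * Fluctuations of residual sums *)

Section Frobenius.
Context {R : realType}.

Lemma enorm_outer p q (a : 'cV[R]_p) (b : 'cV[R]_q) :
  enorm (a *m b^T) = enorm a * enorm b.
Proof.
apply/eqP; rewrite -(@eqrXn2 _ 2) ?mulr_ge0 ?enorm_ge0//; apply/eqP.
rewrite exprMn sqr_enorm_mx !sqr_enorm /dot mulr_suml; apply: eq_bigr => i _.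
rewrite mulr_sumr; apply: eq_bigr => j _.
by rewrite mxE big_ord1 !mxE; ring.
Qed.

Lemma enormZ_mx p q a (A : 'M[R]_(p, q)) : enorm (a *: A) = `|a| * enorm A.
Proof.
apply/eqP; rewrite -(@eqrXn2 _ 2) ?mulr_ge0 ?enorm_ge0//; apply/eqP.
rewrite exprMn !sqr_enorm_mx real_normK ?num_real// mulr_sumr; apply: eq_bigr => i _.
by rewrite mulr_sumr; apply: eq_bigr => j _; rewrite mxE exprMn.
Qed.

End Frobenius.

Section FrobeniusEvent.
Context d (T : measurableType d) (R : realType) (P : probability T R).

(** A centred independent sum has the variance of its terms, so that its norm is of
    order [sqrt n * a]; Markov's inequality serves all the indices [e] at once. *)
Lemma prob_ge_frobenius (I : finType) n p q (U : I -> 'I_n -> T -> R)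
    (A : I -> 'I_n -> 'M[R]_(p, q)) (S a th : R) :
  (0 < n)%N -> 0 < S -> 0 < a -> 0 < th ->
  (forall e i, measurable_fun setT (U e i)) -> (forall e, indep_seq P (U e)) ->
  (forall e i, integ P (fun w => U e i w ^+ 2)) -> (forall e i, Ex P (U e i) = 0) ->
  (forall e i, Ex P (fun w => U e i w ^+ 2) <= S) -> (forall e i, enorm (A e i) <= a) ->
  prob_ge P [set w | forall e, enorm (\sum_i U e i w *: A e i) <=
     Num.sqrt (th * (n%:R * S)) * a] (1 - #|I|%:R / th).
Proof.
move=> n0 S0 a0 th0 mU iU U2 U0 US Aa.
have B0 : 0 < n%:R * S * a ^+ 2 by rewrite !mulr_gt0 ?ltr0n ?exprn_gt0.
have := @prob_ge_markov _ _ _ P I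
  (fun e w => enorm (\sum_i U e i w *: A e i) ^+ 2) _ th B0 th0.
move=> H; apply: prob_geW (H _ _ _).
- move=> w /= Hw e; rewrite -ler_sqr ?nnegrE ?enorm_ge0//; last first.
    by rewrite mulr_ge0 ?sqrtr_ge0// ltW.
  rewrite exprMn (@sqr_sqrtr _ (th * (n%:R * S))); last by rewrite mulr_ge0 ?(ltW th0)// mulr_ge0 ?(ltW S0).
  by rewrite -mulrA; exact: Hw.
- by move=> e; exact: integ_sq_sum_mx.
- by move=> e w; exact: sqr_ge0.
- move=> e; rewrite Ex_sq_sum_mx//; apply: (@le_trans _ _ (\sum_(i < n) S * a ^+ 2)).
    apply: ler_sum => i _; apply: ler_pM => //; rewrite ?sqr_ge0//.
      by apply: Ex_ge0 => w; exact: sqr_ge0.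
    by rewrite ler_sqr ?nnegrE ?enorm_ge0 ?(ltW a0).
  by rewrite sumr_const card_ord -(mulr_natl (_ * _)) mulrA.
Qed.

End FrobeniusEvent.

Section Residuals.
Context d (T : measurableType d) (R : realType) (P : probability T R).
Variables (mu : R -> R) (m p n : nat) (X : 'I_n -> 'M[R]_(m, p)).
Variables (Y : 'I_n -> 'I_m -> {RV P >-> R}) (b0 : 'cV[R]_p).
Local Notation x := (covar X).
Local Notation eta0 i j := (dot (x i j) b0).
Local Notation s := (sd mu^`()%classic).

Hypothesis iY : independent_vectors P (fun i j => Y i j).
Hypothesis EY : forall i j, ('E_P[Y i j] = (mu (linpred (X i) b0 j))%:E)%E.
Hypothesis VY : forall i j, ('V_P[Y i j] = (mu^`()%classic (linpred (X i) b0 j))%:E)%E.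

Definition noise i k w := Y i k w - mu (eta0 i k).
Local Notation eps := noise.

Let moments i k : [/\ integ P (fun w => eps i k w ^+ 2),
  Ex P (fun w => eps i k w ^+ 2) = mu^`()%classic (eta0 i k) & Ex P (eps i k) = 0].
Proof. by rewrite -linpredE; apply: centered_moments; rewrite ?EY ?VY ?linpredE. Qed.

Lemma measurable_noise i k : measurable_fun setT (eps i k).
Proof. exact: measurable_funB. Qed.

Lemma integ_noise_sq i k : integ P (fun w => eps i k w ^+ 2).
Proof. by have [] := moments i k. Qed.

Lemma Ex_noise_sq i k : Ex P (fun w => eps i k w ^+ 2) = mu^`()%classic (eta0 i k).
Proof. by have [] := moments i k. Qed.

Lemma Ex_noise i k : Ex P (eps i k) = 0.
Proof. by have [] := moments i k. Qed.

Lemma integ_noise i k : integ P (eps i k).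
Proof. by apply: integ_sq; [exact: measurable_noise|exact: integ_noise_sq]. Qed.

Lemma adapted_noise i k : adapted (fun j => Y i j) (eps i k).
Proof.
apply: measurable_funB; last exact: measurable_cst.
exact: (@adapted_coord _ _ _ _ (fun j => Y i j : T -> R) k).
Qed.

Lemma indep_noise (k : 'I_m) : indep_seq P (fun i => eps i k).
Proof. by apply: (independent_vectors_seq iY) => i; exact: adapted_noise. Qed.

Let absm i k := Ex P (fun w => `|eps i k w|).
Let aeps i k w := `|eps i k w| - absm i k.

Let maeps i k : measurable_fun setT (aeps i k).
Proof.
apply: measurable_funB => //; apply: measurableT_comp => //.
exact: measurable_noise.
Qed.

Let indep_aeps (k : 'I_m) : indep_seq P (fun i => aeps i k).
Proof.
apply: (independent_vectors_seq iY) => i; apply: measurable_funB; last exact: measurable_cst.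
by apply: measurableT_comp => //; exact: adapted_noise.
Qed.

Let Iabs i k : integ P (fun w => `|eps i k w|).
Proof. by apply: integ_norm; exact: integ_noise. Qed.

Let sq_abs i k w : `|eps i k w| ^+ 2 = eps i k w ^+ 2.
Proof. by rewrite real_normK ?num_real. Qed.

Let aeps2E i k : (fun w => aeps i k w ^+ 2) =
  (fun w => (eps i k w ^+ 2 + (- 2 * absm i k) * `|eps i k w|) + absm i k ^+ 2).
Proof. by apply/funext => w; rewrite /aeps -sq_abs; ring. Qed.

Let I1 i k : integ P (fun w => eps i k w ^+ 2 + (- 2 * absm i k) * `|eps i k w|).
Proof. by apply: integD; [exact: integ_noise_sq|exact: integZ]. Qed.

Let aeps2 i k : integ P (fun w => aeps i k w ^+ 2).
Proof. by rewrite aeps2E; apply: integD => //; exact: integ_cst. Qed.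

Let aeps0 i k : Ex P (aeps i k) = 0.
Proof. by rewrite ExB ?Ex_cst ?subrr//; exact: integ_cst. Qed.

Let aeps2_le i k : Ex P (fun w => aeps i k w ^+ 2) <= mu^`()%classic (eta0 i k).
Proof.
rewrite aeps2E ExD//; last exact: integ_cst.
rewrite ExD ?Ex_cst ?ExZ//; [|exact: integ_noise_sq|exact: integZ].
rewrite Ex_noise_sq -/(absm i k) -addrA gerDl.
have -> : -2 * absm i k * absm i k + absm i k ^+ 2 = - absm i k ^+ 2 by ring.
by rewrite oppr_le0 sqr_ge0.
Qed.

Let absm_le i k : absm i k <= 1 + mu^`()%classic (eta0 i k).
Proof.
rewrite -Ex_noise_sq -[X in X + _](@Ex_cst _ _ _ P) -ExD; [|exact: integ_cst|exact: integ_noise_sq].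
apply: le_Ex => //; first by apply: integD; [exact: integ_cst|exact: integ_noise_sq].
move=> w; rewrite -sq_abs; have := sqr_ge0 (`|eps i k w| - 1); have := normr_ge0 (eps i k w); nra.
Qed.

Variables (m2 : R -> R) (C1 KT KP Xb G th : R).
Local Notation slope1 i j k := (dsd mu^`()%classic m2 (eta0 i j) * isd mu^`()%classic (eta0 i k)).
Local Notation slope2 i j k := (s (eta0 i j) * disd mu^`()%classic m2 (eta0 i k)).
Hypotheses (n0 : (0 < n)%N) (C10 : 0 < C1) (KT0 : 0 < KT) (KP1 : 1 <= KP) (Xb0 : 0 < Xb)
  (th0 : 0 < th).
Hypothesis vC : forall i j, mu^`()%classic (eta0 i j) <= C1.
Hypothesis sT : forall i j k, `|s (eta0 i j) / s (eta0 i k)| <= KT.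
Hypothesis s1P : forall i j k, `|slope1 i j k| <= KP.
Hypothesis s2P : forall i j k, `|slope2 i j k| <= KP.
Hypothesis normX : forall i j, enorm (x i j) <= Xb.
Hypothesis gram : forall j u, \sum_i dot (x i j) u ^+ 2 <= G * dot u u.

Definition fluct := Num.sqrt (th * (n%:R * C1)).
Let Phi := fluct * (KP * Xb ^+ 2).
Let T0 := fluct * (KT * Xb).
Let KP0 : 0 < KP. Proof. exact: lt_le_trans KP1. Qed.

Let outer_le i j k : enorm (x i j *m (x i k)^T) <= Xb ^+ 2.
Proof. by rewrite enorm_outer expr2; apply: ler_pM; rewrite ?enorm_ge0. Qed.

(** Four families of [m ^ 2] sums, each family with exceptional probability at most
    [m ^ 2 / th]. For the first one [|noise|] is centred by its mean, which is at
    most [1 + C1], and the mean part is bounded by the Gram matrix. *)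
Lemma score_good_event : prob_ge P
  [set w | let y := fun i => \col_j Y i j w in
    [/\ forall j k u, \sum_i `|y i k ord0 - mu (eta0 i k)| * dot (x i j) u ^+ 2 <=
          ((1 + C1) * G + Phi) * dot u u,
        forall j k, enorm (\sum_i ((y i k ord0 - mu (eta0 i k)) * slope1 i j k) *:
          (x i j *m (x i j)^T)) <= Phi,
        forall j k, enorm (\sum_i ((y i k ord0 - mu (eta0 i k)) * slope2 i j k) *:
          (x i j *m (x i k)^T)) <= Phi &
        forall j k, enorm (pair_score mu X y j k b0) <= T0]]
  (1 - 4 * (m%:R ^+ 2 / th)).
Proof.
pose I := ('I_m * 'I_m)%type.
have cI : #|{: I}|%:R = m%:R ^+ 2 :> R by rewrite card_prod !card_ord natrM expr2.
have aP0 : 0 < KP * Xb ^+ 2 by rewrite mulr_gt0 ?exprn_gt0.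
have aT0 : 0 < KT * Xb by rewrite mulr_gt0.
have XP : Xb ^+ 2 <= KP * Xb ^+ 2 by rewrite ler_peMl ?sqr_ge0.
have A1 := @prob_ge_frobenius _ _ _ P I n p p (fun e i => aeps i e.2)
  (fun e i => x i e.1 *m (x i e.1)^T) _ _ _ n0 C10 aP0 th0 (fun e i => maeps i e.2)
  (fun e => indep_aeps e.2) (fun e i => aeps2 i e.2) (fun e i => aeps0 i e.2)
  (fun e i => le_trans (aeps2_le i e.2) (vC i e.2))
  (fun e i => le_trans (outer_le i e.1 e.1) XP).
have A2 := @prob_ge_frobenius _ _ _ P I n p p (fun e i => eps i e.2)
  (fun e i => slope1 i e.1 e.2 *: (x i e.1 *m (x i e.1)^T)) C1 _ _ n0 C10 aP0 th0
  (fun e i => measurable_noise i e.2)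
  (fun e => indep_noise e.2) (fun e i => integ_noise_sq i e.2) (fun e i => Ex_noise i e.2).
have A3 := @prob_ge_frobenius _ _ _ P I n p p (fun e i => eps i e.2)
  (fun e i => slope2 i e.1 e.2 *: (x i e.1 *m (x i e.2)^T)) C1 _ _ n0 C10 aP0 th0
  (fun e i => measurable_noise i e.2)
  (fun e => indep_noise e.2) (fun e i => integ_noise_sq i e.2) (fun e i => Ex_noise i e.2).
have A4 := @prob_ge_frobenius _ _ _ P I n p 1 (fun e i => eps i e.2)
  (fun e i => (s (eta0 i e.1) / s (eta0 i e.2)) *: x i e.1) C1 _ _ n0 C10 aT0 th0
  (fun e i => measurable_noise i e.2)
  (fun e => indep_noise e.2) (fun e i => integ_noise_sq i e.2) (fun e i => Ex_noise i e.2).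
have eC (e : I) i : Ex P (fun w => eps i e.2 w ^+ 2) <= C1 by rewrite Ex_noise_sq.
have {}A2 := A2 eC; have {}A3 := A3 eC; have {}A4 := A4 eC.
have B2 (e : I) i : enorm (slope1 i e.1 e.2 *: (x i e.1 *m (x i e.1)^T)) <= KP * Xb ^+ 2.
  by rewrite enormZ_mx; apply: ler_pM; rewrite ?enorm_ge0.
have B3 (e : I) i : enorm (slope2 i e.1 e.2 *: (x i e.1 *m (x i e.2)^T)) <= KP * Xb ^+ 2.
  by rewrite enormZ_mx; apply: ler_pM; rewrite ?enorm_ge0.
have B4 (e : I) i : enorm ((s (eta0 i e.1) / s (eta0 i e.2)) *: x i e.1) <= KT * Xb.
  by rewrite enormZ_mx; apply: ler_pM; rewrite ?enorm_ge0.
have {}A2 := A2 B2; have {}A3 := A3 B3; have {}A4 := A4 B4.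
rewrite cI in A1 A2 A3 A4.
have -> : 4 * (m%:R ^+ 2 / th) = ((m%:R ^+ 2 / th + m%:R ^+ 2 / th) +
  (m%:R ^+ 2 / th + m%:R ^+ 2 / th)) :> R by ring.
apply: prob_geW (prob_geI (prob_geI A1 A2) (prob_geI A3 A4)).
move=> w /= [[H1 H2] [H3 H4]].
have yE i k : (\col_j Y i j w) k ord0 - mu (eta0 i k) = eps i k w by rewrite mxE.
split.
- move=> j k u; under eq_bigr do rewrite yE.
  have -> : \sum_i `|eps i k w| * dot (x i j) u ^+ 2 =
      dot u ((\sum_i aeps i k w *: (x i j *m (x i j)^T)) *m u) +
      \sum_i absm i k * dot (x i j) u ^+ 2.
    rewrite mulmx_suml dot_sumr -big_split/=; apply: eq_bigr => i _.
    by rewrite -scalemxAl dotZr outer_dot /aeps; ring.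
  rewrite addrC mulrDl; apply: lerD.
    rewrite -mulrA; apply: (@le_trans _ _ ((1 + C1) * \sum_i dot (x i j) u ^+ 2)).
      rewrite mulr_sumr; apply: ler_sum => i _; rewrite ler_wpM2r ?sqr_ge0//.
      by apply: (le_trans (absm_le i k)); rewrite lerD2l.
    by rewrite ler_wpM2l// addr_ge0// ltW.
  apply: le_trans (ler_norm _) _; apply: (le_trans (bilin_enorm _ _ _)).
  rewrite -mulrA -expr2 sqr_enorm ler_wpM2r ?dot_ge0//.
  exact: (H1 (j, k)).
- move=> j k; under eq_bigr do rewrite yE -scalerA.
  exact: (H2 (j, k)).
- move=> j k; under eq_bigr do rewrite yE -scalerA.
  exact: (H3 (j, k)).
- move=> j k; rewrite /pair_score; under eq_bigr do rewrite yE mulrC -scalerA.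
  exact: (H4 (j, k)).
Qed.

End Residuals.

(** * The linear statistic and its Lindeberg sum *)

Section Truncation.
Context {R : realType}.

(** Split at [e = K] with [K = eta^(- 1 / delta)]: below it the minimum is at most
    [zeta * e], above it [e ^+ 2 <= eta * e `^ (2 + delta)]. *)
Lemma sq_min_le (delta eta : R) : 0 < delta -> 0 < eta -> exists2 K : R, 0 <= K &
  forall e zeta, 0 <= e -> 0 <= zeta ->
    e ^+ 2 * Num.min 1 (zeta * e) <= zeta * K + eta * e `^ (2 + delta).
Proof.
move=> d0 eta0; pose K := eta `^ (- delta^-1).
have K0 : 0 < K by exact: powR_gt0.
exists (K ^+ 3) => [|e zeta e0 z0]; first by rewrite exprn_ge0// ltW.
have [eK|Ke] := leP e K.
  apply: (@le_trans _ _ (zeta * K ^+ 3)); last first.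
    by rewrite lerDl mulr_ge0 ?powR_ge0// ltW.
  apply: (@le_trans _ _ (e ^+ 2 * (zeta * e))).
    by rewrite ler_wpM2l ?sqr_ge0// ge_min lexx orbT.
  have -> : e ^+ 2 * (zeta * e) = zeta * e ^+ 3 by ring.
  by rewrite ler_wpM2l// lerXn2r ?nnegrE// ltW.
apply: (@le_trans _ _ (e ^+ 2)).
  by rewrite ler_piMr ?sqr_ge0// ge_min lexx.
apply: (@le_trans _ _ (eta * e `^ (2 + delta))); last first.
  by rewrite lerDr mulr_ge0// exprn_ge0// ltW.
have e1 : 0 < e by exact: lt_trans Ke.
rewrite powRD; last by rewrite (gt_eqF e1) implybT.
rewrite -powR_mulrn// mulrCA ler_peMr ?powR_ge0//.
have : K `^ delta <= e `^ delta by apply: ge0_ler_powR; rewrite ?nnegrE ?ltW.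
have -> : K `^ delta = eta^-1.
  by rewrite /K -powRrM mulNr mulVf ?gt_eqF// powR_inv1// ltW.
by move=> h; rewrite -(mulfV (lt0r_neq0 eta0)) ler_wpM2l// ltW.
Qed.

Lemma le_1D_powR (delta e : R) : 0 < delta -> 0 <= e -> e <= 1 + e `^ (2 + delta).
Proof.
move=> d0 e0; have [e1|e1] := leP e 1.
  by apply: (le_trans e1); rewrite lerDl powR_ge0.
apply: (@le_trans _ _ (e `^ (2 + delta))); last by rewrite lerDr.
rewrite -{1}(powRr1 e0); apply: ler_powR; [exact: ltW|lra].
Qed.

End Truncation.

Section LinearStatistic.
Context d (T : measurableType d) (R : realType) (P : probability T R).
Variables (mu : R -> R) (m p n : nat) (X : 'I_n -> 'M[R]_(m, p)).
Variables (Y : 'I_n -> 'I_m -> {RV P >-> R}) (b0 : 'cV[R]_p).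
Local Notation x := (covar X).
Local Notation eta0 i j := (dot (x i j) b0).
Local Notation s := (sd mu^`()%classic).

Hypothesis iY : independent_vectors P (fun i j => Y i j).
Hypothesis EY : forall i j, ('E_P[Y i j] = (mu (linpred (X i) b0 j))%:E)%E.
Hypothesis VY : forall i j, ('V_P[Y i j] = (mu^`()%classic (linpred (X i) b0 j))%:E)%E.
Variables (R0 V : 'M[R]_m) (v : 'cV[R]_p).
Hypothesis corrY : forall i j k, correlation P (Y i j) (Y i k) = R0 j k.
Hypothesis v_gt0 : forall i j, 0 < mu^`()%classic (eta0 i j).
Hypothesis sV : V^T = V.

Local Notation eps := (noise mu X Y b0).
(** The coefficients with which the Pearson residuals of a cluster enter the estimating
    function in the direction [v]. *)
Definition loading i : 'cV[R]_m := invmx V *m (Ahalf mu (X i) b0 *m (X i *m v)).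
Definition pearson i w : 'cV[R]_m :=
  Ainvhalf mu (X i) b0 *m ((\col_j Y i j w) - meanvec mu (X i) b0).
Definition summand i w := dot (loading i) (pearson i w).

Lemma pearsonE i w k : pearson i w k ord0 = (s (eta0 i k))^-1 * eps i k w.
Proof. by rewrite /pearson /Ainvhalf mul_diag_mx !mxE !linpredE. Qed.

Lemma summandE i w : summand i w = \sum_k (loading i k ord0 / s (eta0 i k)) * eps i k w.
Proof. by apply: eq_bigr => k _; rewrite pearsonE mulrA. Qed.

Lemma score_summands w : dot v (gee_score mu X V (fun i => \col_j Y i j w) b0) =
  \sum_i summand i w.
Proof.
rewrite /gee_score dot_sumr; apply: eq_bigr => i _.
rewrite -!mulmxA dot_trmx trmxK dot_trmx Ahalf_sym dot_trmx trmx_inv sV.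
by [].
Qed.

Let s0 i k : 0 < s (eta0 i k). Proof. by rewrite sqrtr_gt0. Qed.

Lemma measurable_summand i : measurable_fun setT (summand i).
Proof.
rewrite (_ : summand i = fun w => \sum_k (loading i k ord0 / s (eta0 i k)) * eps i k w).
  by apply: measurable_sum => k; apply: measurable_funM => //; exact: measurable_noise.
by apply/funext => w; rewrite summandE.
Qed.

Lemma indep_summand : indep_seq P summand.
Proof.
apply: (independent_vectors_seq iY) => i.
rewrite /adapted (_ : summand i = fun w => \sum_k (loading i k ord0 / s (eta0 i k)) * eps i k w).
  apply: measurable_sum => k; apply: measurable_funM; first exact: measurable_cst.
  exact: adapted_noise.
by apply/funext => w; rewrite summandE.
Qed.

Lemma integ_summand_sq i : integ P (fun w => summand i w ^+ 2).
Proof.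
under eq_fun do rewrite summandE.
apply: integ_sq_sum => k.
  by apply: measurable_funM => //; exact: measurable_noise.
by apply: integ_sqZ; exact: integ_noise_sq.
Qed.

Lemma Ex_summand i : Ex P (summand i) = 0.
Proof.
rewrite (@eq_Ex _ _ _ _ _ _ (summandE i)) Ex_sum; last first.
  by move=> k _; apply: integZ; exact: integ_noise.
by rewrite big1// => k _; rewrite ExZ ?Ex_noise ?mulr0//; exact: integ_noise.
Qed.

(** Pearson residuals have the true correlation matrix as covariance matrix. *)
Lemma Ex_summand_sq i : Ex P (fun w => summand i w ^+ 2) = quad R0 (loading i).
Proof.
pose a k := loading i k ord0 / s (eta0 i k).
have Ikl k l : integ P (fun w => a k * a l * (eps i k w * eps i l w)).
  by apply: integZ; apply: integ_mul;
    (exact: measurable_noise || exact: integ_noise_sq).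
rewrite (@eq_Ex _ _ _ _ _ (fun w => \sum_k \sum_l a k * a l * (eps i k w * eps i l w))); last first.
  move=> w; rewrite summandE expr2 mulr_suml; apply: eq_bigr => k _.
  by rewrite mulr_sumr; apply: eq_bigr => l _; rewrite /a; ring.
rewrite Ex_sum; last by move=> k _; exact: integ_sum.
rewrite /quad /dot; apply: eq_bigr => k _.
rewrite Ex_sum// [(R0 *m loading i) k ord0]mxE mulr_sumr; apply: eq_bigr => l _.
rewrite ExZ; last by apply: integ_mul; (exact: measurable_noise || exact: integ_noise_sq).
rewrite /noise (@cross_moment _ _ _ P (Y i k) (Y i l) _ _ (R0 k l)
  (mu^`()%classic (eta0 i k)) (mu^`()%classic (eta0 i l)))// -?linpredE//.
have := s0 i k; have := s0 i l; rewrite /a -!linpredE -/(s _) -/(s _) => h1 h2.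
by field; rewrite !gt_eqF.
Qed.

Variables (delta M1 zeta Gam eta K0 : R).
Hypotheses (d0 : 0 < delta) (M10 : 0 < M1) (z0 : 0 <= zeta) (eta_gt0 : 0 < eta) (K00 : 0 <= K0).
Hypothesis trunc : forall e z, 0 <= e -> 0 <= z ->
    e ^+ 2 * Num.min 1 (z * e) <= z * K0 + eta * e `^ (2 + delta).
Hypothesis A5 : forall i,
  ('E_P[fun w => (enorm (pearson i w) `^ (2 + delta))%R] <= M1%:E)%E.
Hypothesis load_le : forall i, enorm (loading i) <= zeta.
Hypothesis load_sum : \sum_i enorm (loading i) ^+ 2 <= Gam.

Let ne i w := enorm (pearson i w).

Let mne i : measurable_fun setT (ne i).
Proof.
rewrite (_ : ne i = (fun t => Num.sqrt t) \o
   (fun w => \sum_k ((s (eta0 i k))^-1 * eps i k w) ^+ 2)).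
  apply: measurableT_comp; first by apply: continuous_measurable_fun; exact: sqrt_continuous.
  apply: measurable_sum => k; apply: measurable_funX; apply: measurable_funM => //.
  exact: measurable_noise.
apply/funext => w; rewrite /ne enormE /=; congr Num.sqrt.
by apply: eq_bigr => k _; rewrite pearsonE expr2.
Qed.

Let mpow i : measurable_fun setT (fun w => ne i w `^ (2 + delta)).
Proof. exact: (@measurableT_comp _ _ _ _ _ _ (fun t : R => t `^ (2 + delta)) _ (ne i) (measurable_powR (2 + delta)) (mne i)). Qed.

Let Ipow i : integ P (fun w => ne i w `^ (2 + delta)) /\
  Ex P (fun w => ne i w `^ (2 + delta)) <= M1.
Proof.
have := A5 i; rewrite unlock -/(ne i) => H.
have I : integ P (fun w => ne i w `^ (2 + delta)).
  apply/integrableP; split; first exact/measurable_EFinP.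
  under eq_integral do rewrite /= ger0_norm ?powR_ge0//.
  by apply: le_lt_trans H _; exact: ltry.
by split => //; rewrite -lee_fin -ExE.
Qed.

Let abs_summand i w : `|summand i w| <= enorm (loading i) * ne i w.
Proof. exact: dot_CS. Qed.

Let Itr i : integ P (fun w => Num.min 1 `|summand i w|).
Proof.
apply: (@integ_bounded _ _ _ _ _ 1) => [|w]; last first.
  by rewrite ger0_norm ?ge_min ?lexx// le_min ler01 normr_ge0.
by apply: measurable_minr => //; apply: measurableT_comp => //; exact: measurable_summand.
Qed.

Let Isqtr i : integ P (fun w => summand i w ^+ 2 * Num.min 1 `|summand i w|).
Proof.
have m0 w : 0 <= Num.min 1 `|summand i w| by rewrite le_min ler01 normr_ge0.
apply: (integ_le _ _ (integ_summand_sq i)).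
  apply: measurable_funM; first by apply: measurable_funX; exact: measurable_summand.
  exact: integ_measurable (Itr i).
by move=> w; rewrite normrM ler_piMr// ger0_norm// ge_min lexx.
Qed.

(** By [|summand| <= |loading| * |pearson|] and [|loading| <= zeta], the truncated third
    moments are those of [sq_min_le], integrated against the moment of order
    [2 + delta]. The unit variance absorbs the second part of the Lindeberg sum. *)
Lemma lindeberg_summand : \sum_i Ex P (fun w => summand i w ^+ 2) = 1 ->
  lindeberg_sum P summand <= Gam * (zeta * K0 + eta * M1) + zeta * (1 + M1).
Proof.
move=> s1; apply: lerD.
  apply: (@le_trans _ _ (\sum_i enorm (loading i) ^+ 2 * (zeta * K0 + eta * M1))); last first.
    by rewrite -mulr_suml ler_wpM2r// addr_ge0// mulr_ge0// ltW.
  apply: ler_sum => i _.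
  have [Ip Ep] := Ipow i.
  apply: (@le_trans _ _ (Ex P (fun w => enorm (loading i) ^+ 2 *
      (zeta * K0 + eta * ne i w `^ (2 + delta))))).
    apply: le_Ex => [//||w].
      by apply: integZ; apply: integD; [exact: integ_cst|exact: integZ].
    apply: (@le_trans _ _ (enorm (loading i) ^+ 2 * (ne i w ^+ 2 * Num.min 1 (zeta * ne i w)))); last first.
      by rewrite ler_wpM2l ?sqr_ge0//; apply: trunc => //; exact: enorm_ge0.
    rewrite mulrA -exprMn; apply: ler_pM; rewrite ?sqr_ge0//.
    - rewrite -[summand i w ^+ 2]real_normK ?num_real//.
      by rewrite ler_sqr ?nnegrE ?mulr_ge0 ?enorm_ge0.
    - rewrite le_min !ge_min lexx/=; apply/orP; right.
      by apply: (le_trans (abs_summand i w)); rewrite ler_wpM2r ?enorm_ge0.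
  rewrite ExZ; last by apply: integD; [exact: integ_cst|exact: integZ].
  rewrite ExD; [|exact: integ_cst|exact: integZ].
  by rewrite Ex_cst ExZ// ler_wpM2l ?sqr_ge0// lerD2l ler_wpM2l// ltW.
have -> : zeta * (1 + M1) = \sum_i Ex P (fun w => summand i w ^+ 2) * (zeta * (1 + M1)).
  by rewrite -mulr_suml s1 mul1r.
apply: ler_sum => i _; rewrite ler_wpM2l//.
  by apply: Ex_ge0 => w; exact: sqr_ge0.
have [Ip Ep] := Ipow i.
apply: (@le_trans _ _ (Ex P (fun w => zeta * (1 + ne i w `^ (2 + delta))))).
  apply: le_Ex => // [|w].
    by apply: integZ; apply: integD => //; exact: integ_cst.
  rewrite ge_min; apply/orP; right; apply: (le_trans (abs_summand i w)).
  by apply: ler_pM; rewrite ?enorm_ge0//; apply: le_1D_powR => //; exact: enorm_ge0.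
rewrite ExZ; last by apply: integD => //; exact: integ_cst.
rewrite ExD//; last exact: integ_cst.
by rewrite Ex_cst ler_wpM2l// lerD2l.
Qed.

End LinearStatistic.

(** * Lower and upper bounds for the design *)

Section PosDef.
Context {R : realType}.
Variables (m : nat) (S : 'M[R]_m) (c C : R).
Hypotheses (sS : S^T = S) (c0 : 0 < c).
Hypothesis lowS : forall u, c * dot u u <= quad S u.
Hypothesis upS : forall u, quad S u <= C * dot u u.

Lemma coercive_posdef : posdefmx S.
Proof.
split=> // u u0; rewrite quadE; apply: lt_le_trans (lowS u).
rewrite mulr_gt0// lt_neqAle dot_ge0 andbT eq_sym.
by apply: contraNneq u0 => /dot_eq0 ->.
Qed.

Lemma coercive_inv_le (u : 'cV[R]_m) : enorm (invmx S *m u) <= enorm u / c.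
Proof.
have uS := posdef_unitmx coercive_posdef.
set z := invmx S *m u; have zE : S *m z = u by rewrite mulKVmx.
have [->|z0] := eqVneq (enorm z) 0; first by rewrite divr_ge0 ?enorm_ge0// ltW.
have z1 : 0 < enorm z by rewrite lt_neqAle eq_sym z0 enorm_ge0.
rewrite ler_pdivlMr// -(ler_pM2l z1).
have := lowS z; rewrite /quad zE -sqr_enorm => h.
apply: (@le_trans _ _ (dot z u)); first by rewrite mulrA -expr2 mulrC.
by apply: le_trans (dot_CS z u); exact: ler_norm.
Qed.

Let S0 u : 0 <= quad S u.
Proof. by apply: le_trans (lowS u); rewrite mulr_ge0 ?dot_ge0// ltW. Qed.

(** Cauchy-Schwarz for the form [S], applied to [S u] and [u]. *)
Lemma quad_mul_le u : dot (S *m u) (S *m u) <= C * quad S u.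
Proof.
have [E|E] := eqVneq (dot (S *m u) (S *m u)) 0.
  rewrite E; have [->|q0] := eqVneq (quad S u) 0; first by rewrite mulr0.
  have := upS u; have := S0 u; have := dot_ge0 u => h1 h2 h3.
  have q1 : 0 < quad S u by rewrite lt_neqAle eq_sym q0 h2.
  have C0 : 0 < C.
    rewrite ltNge; apply/negP => C0.
    by have := lt_le_trans q1 (le_trans h3 (mulr_le0_ge0 C0 h1)); rewrite ltxx.
  by rewrite mulr_ge0// ltW.
have e0 : 0 < dot (S *m u) (S *m u) by rewrite lt_neqAle eq_sym E dot_ge0.
rewrite -(ler_pM2l e0) -expr2.
apply: (le_trans (psd_CS (S *m u) u sS S0)).
rewrite mulrCA mulrA ler_wpM2r//.
Qed.

(** [quad_mul_le] at [invmx S *m u]. *)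
Lemma quad_inv_ge u : 0 < C -> dot u u / C <= quad (invmx S) u.
Proof.
move=> C0; have uS := posdef_unitmx coercive_posdef.
rewrite ler_pdivrMr// mulrC.
have := quad_mul_le (invmx S *m u); rewrite mulKVmx// => h.
by apply: (le_trans h); rewrite /quad mulKVmx// dotC.
Qed.

Lemma enorm_mul_le u : 0 < C -> dot (S *m u) (S *m u) <= C ^+ 2 * dot u u.
Proof.
move=> C0; apply: (le_trans (quad_mul_le u)); rewrite expr2 -mulrA.
by rewrite ler_wpM2l// ltW.
Qed.

(** Each column of the inverse has norm at most [c^-1]. *)
Lemma enorm_inv_le : enorm (invmx S) <= Num.sqrt m%:R / c.
Proof.
rewrite -ler_sqr ?nnegrE ?enorm_ge0//; last by rewrite divr_ge0 ?sqrtr_ge0// ltW.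
rewrite exprMn (@sqr_sqrtr _ m%:R)// sqr_enorm_mx exchange_big/=.
apply: (@le_trans _ _ (\sum_(k < m) (c^-1) ^+ 2)); last by rewrite sumr_const card_ord mulr_natl.
apply: ler_sum => k _.
have -> : \sum_i invmx S i k ^+ 2 = enorm (invmx S *m (delta_mx k ord0 : 'cV[R]_m)) ^+ 2.
  by rewrite -colE sqr_enorm; apply: eq_bigr => i _; rewrite mxE expr2.
have d1 : enorm (delta_mx k ord0 : 'cV[R]_m) = 1.
  rewrite enormE /dot (bigD1 k)//= !mxE !eqxx mul1r big1 ?addr0 ?sqrtr1// => i /negbTE ik.
  by rewrite mxE ik mul0r.
rewrite ler_sqr ?nnegrE ?enorm_ge0 ?invr_ge0 ?(ltW c0)//.
by apply: (le_trans (coercive_inv_le _)); rewrite d1 mul1r.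
Qed.

End PosDef.

Section Design.
Context {R : realType}.
Variables (mu : R -> R) (m p n : nat) (X : 'I_n -> 'M[R]_(m, p)) (b0 : 'cV[R]_p).
Variables (V R0 : 'M[R]_m).
Local Notation x := (covar X).
Local Notation eta0 i j := (dot (x i j) b0).
Local Notation s := (sd mu^`()%classic).
Variables (c1 C1 cV CV cR b3 b4 : R).
Hypotheses (n0 : (0 < n)%N) (c10 : 0 < c1) (cV0 : 0 < cV) (CV0 : 0 < CV) (cR0 : 0 < cR).
Hypotheses (b30 : 0 < b3) (b40 : 0 < b4).
Hypothesis var0 : forall i j, c1 <= mu^`()%classic (eta0 i j) <= C1.
Hypotheses (sV : V^T = V) (lowV : forall u, cV * dot u u <= quad V u)
  (upV : forall u, quad V u <= CV * dot u u).
Hypotheses (sR : R0^T = R0) (lowR : forall u, cR * dot u u <= quad R0 u).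
Hypothesis lowG : b3 <= lambda_min (n%:R^-1 *: \sum_(i < n) (X i)^T *m X i).
Hypothesis upG : lambda_max (n%:R^-1 *: \sum_(i < n) (X i)^T *m X i) <= b4.

Let Gmx := n%:R^-1 *: \sum_(i < n) (X i)^T *m X i.

Let sG : Gmx^T = Gmx.
Proof.
rewrite /Gmx linearZ/= raddf_sum/=; congr (_ *: _); apply: eq_bigr => i _.
by rewrite trmx_mul trmxK.
Qed.

Let quadG u : n%:R * quad Gmx u = \sum_i \sum_j dot (x i j) u ^+ 2.
Proof.
rewrite /quad /Gmx -scalemxAl dotZr mulrA divff ?mul1r; last by rewrite pnatr_eq0 -lt0n.
rewrite mulmx_suml dot_sumr; apply: eq_bigr => i _.
rewrite -mulmxA dot_trmx trmxK /dot; apply: eq_bigr => j _.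
by rewrite -/(linpred (X i) u j) linpredE expr2.
Qed.

Lemma gram_total_ge u : b3 * n%:R * dot u u <= \sum_i \sum_j dot (x i j) u ^+ 2.
Proof.
rewrite -quadG -mulrA mulrCA ler_wpM2l//.
apply: le_trans (lambda_min_le u sG); by rewrite ler_wpM2r ?dot_ge0.
Qed.

Lemma gram_total_le u : \sum_i \sum_j dot (x i j) u ^+ 2 <= b4 * n%:R * dot u u.
Proof.
rewrite -quadG -mulrA mulrCA ler_wpM2l//.
by apply: (le_trans (lambda_max_ge u sG)); rewrite ler_wpM2r ?dot_ge0.
Qed.

Lemma gram_le j u : \sum_i dot (x i j) u ^+ 2 <= b4 * n%:R * dot u u.
Proof.
apply: le_trans (gram_total_le u); apply: ler_sum => i _.
by rewrite (bigD1 j)//= lerDl sumr_ge0// => k _; exact: sqr_ge0.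
Qed.

Local Notation AX i u := (Ahalf mu (X i) b0 *m (X i *m u)).

Let sqr_s i j : s (eta0 i j) ^+ 2 = mu^`()%classic (eta0 i j).
Proof. by have /andP[h _] := var0 i j; rewrite sqr_sqrtr// (le_trans (ltW c10)). Qed.

Let dotAX i u : dot (AX i u) (AX i u) =
  \sum_j mu^`()%classic (eta0 i j) * dot (x i j) u ^+ 2.
Proof. by apply: eq_bigr => j _; rewrite Ahalf_mulX -sqr_s; ring. Qed.

Let AX_ge i u : c1 * \sum_j dot (x i j) u ^+ 2 <= dot (AX i u) (AX i u).
Proof.
rewrite dotAX mulr_sumr; apply: ler_sum => j _; rewrite ler_wpM2r ?sqr_ge0//.
by case/andP: (var0 i j).
Qed.

Let AX_le i u : dot (AX i u) (AX i u) <= C1 * \sum_j dot (x i j) u ^+ 2.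
Proof.
rewrite dotAX mulr_sumr; apply: ler_sum => j _; rewrite ler_wpM2r ?sqr_ge0//.
by case/andP: (var0 i j).
Qed.

Definition Hbar_floor := c1 * b3 / CV.

(** Composition of three lower bounds: the inverse working matrix, the variances and the
    Gram matrix. *)
Lemma Hbar_coercive u : Hbar_floor * n%:R * dot u u <= dot u (Hbar mu X V b0 *m u).
Proof.
rewrite Hbar_dot.
apply: (@le_trans _ _ (\sum_i c1 * (\sum_j dot (x i j) u ^+ 2) / CV)).
  rewrite -mulr_suml -mulr_sumr ler_pdivlMr// /Hbar_floor.
  have -> : c1 * b3 / CV * n%:R * dot u u * CV = c1 * (b3 * n%:R * dot u u).
    by field; rewrite gt_eqF.
  by rewrite ler_wpM2l ?gram_total_ge// ltW.
apply: ler_sum => i _.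
apply: le_trans (quad_inv_ge sV cV0 lowV upV _ CV0).
by rewrite ler_wpM2r ?invr_ge0 ?(ltW CV0).
Qed.

Definition Mbar_floor := cR * c1 * b3 / CV ^+ 2.

Lemma Mbar_floor_gt0 : 0 < Mbar_floor.
Proof. by rewrite /Mbar_floor divr_gt0 ?exprn_gt0// !mulr_gt0. Qed.

Local Notation Mb := (Mbar mu X V R0 b0).

Lemma Mbar_coercive u : Mbar_floor * n%:R * dot u u <= quad Mb u.
Proof.
rewrite Mbar_quad//.
apply: (@le_trans _ _ (\sum_i cR * (c1 * (\sum_j dot (x i j) u ^+ 2) / CV ^+ 2))).
  rewrite -mulr_sumr -mulr_suml -mulr_sumr /Mbar_floor.
  have -> : cR * c1 * b3 / CV ^+ 2 * n%:R * dot u u = cR * (c1 * (b3 * n%:R * dot u u) / CV ^+ 2).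
    by field; rewrite gt_eqF.
  rewrite ler_wpM2l ?(ltW cR0)// ler_wpM2r ?invr_ge0 ?exprn_ge0 ?(ltW CV0)//.
  by rewrite ler_wpM2l ?gram_total_ge// ltW.
apply: ler_sum => i _; apply: le_trans (lowR _); rewrite ler_wpM2l ?(ltW cR0)//.
rewrite ler_pdivrMr ?exprn_gt0// [X in _ <= X]mulrC; apply: (le_trans (AX_ge i u)).
have := enorm_mul_le sV cV0 lowV upV (invmx V *m AX i u) CV0.
by rewrite mulKVmx//; exact: posdef_unitmx (coercive_posdef sV cV0 lowV).
Qed.

Lemma Mbar_posdef : posdefmx Mb.
Proof.
apply: (@coercive_posdef _ _ _ (Mbar_floor * n%:R)).
- exact: Mbar_sym.
- by rewrite mulr_gt0 ?Mbar_floor_gt0 ?ltr0n.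
- exact: Mbar_coercive.
Qed.

Variable a : 'cV[R]_p.
Hypothesis a1 : enorm a = 1.
(** The statistic is the linear form given by this vector applied to [Hbar (b - b0)]. *)
Definition direction := invmx (sqrtmx Mb) *m a.
Local Notation v := direction.

Lemma quad_direction : quad Mb v = 1.
Proof.
rewrite quad_sqrtmx_inv; last exact: Mbar_posdef.
by rewrite -sqr_enorm a1 expr1n.
Qed.

Lemma direction_le : n%:R * dot v v <= Mbar_floor^-1.
Proof.
have := Mbar_coercive v; rewrite quad_direction => h.
by rewrite -[Mbar_floor^-1]mul1r ler_pdivlMr ?Mbar_floor_gt0// mulrC mulrA.
Qed.

Lemma statisticE (u : 'cV[R]_p) :
  (a^T *m invmx (sqrtmx Mb) *m Hbar mu X V b0 *m u) ord0 ord0 = dot v (Hbar mu X V b0 *m u).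
Proof.
rewrite -dotE /direction trmx_mul sqrtmx_inv_sym; last exact: Mbar_posdef.
by rewrite !mulmxA.
Qed.

Lemma sum_quad_loading : \sum_i quad R0 (loading mu X b0 V v i) = 1.
Proof. by rewrite -quad_direction Mbar_quad. Qed.

Let loading_sq_le i : enorm (loading mu X b0 V v i) ^+ 2 <=
  C1 / cV ^+ 2 * \sum_j dot (x i j) v ^+ 2.
Proof.
apply: (@le_trans _ _ ((enorm (AX i v) / cV) ^+ 2)).
  rewrite ler_sqr ?nnegrE ?enorm_ge0 ?divr_ge0 ?enorm_ge0 ?(ltW cV0)//.
  exact: coercive_inv_le.
rewrite exprMn sqr_enorm exprVn mulrAC ler_wpM2r ?invr_ge0 ?exprn_ge0 ?(ltW cV0)//.
Qed.

(** In the case [m = 0], where [C1] has no sign, the Gram matrix is 0, so that the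
    direction would vanish, against its unit [Mbar]-norm. *)
Lemma loading_sum_le : \sum_i enorm (loading mu X b0 V v i) ^+ 2 <= C1 / cV ^+ 2 * (b4 / Mbar_floor).
Proof.
have [i0 C10] : exists _ : 'I_n, 0 <= C1 \/ m = 0%N.
  exists (Ordinal n0); have [m0|m0] := posnP m; [by right|left].
  have /andP[h1 h2] := var0 (Ordinal n0) (Ordinal m0).
  exact: le_trans (le_trans (ltW c10) h1) h2.
have [C1_ge0|m0] := C10; last first.
  have E i : \sum_j dot (x i j) v ^+ 2 = 0.
    by rewrite big1// => j _; have := ltn_ord j; rewrite [X in (_ < X)%N]m0.
  have := gram_total_ge v; rewrite big1 => [h|i _]; last exact: E.
  have v0 : dot v v = 0.
    apply/eqP; rewrite eq_le dot_ge0 andbT.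
    by move: h; rewrite pmulr_rle0// mulr_gt0// ltr0n.
  have := quad_direction; rewrite (dot_eq0 v0) quad0 => /eqP.
  by rewrite eq_sym oner_eq0.
apply: (@le_trans _ _ (C1 / cV ^+ 2 * \sum_i \sum_j dot (x i j) v ^+ 2)).
  by rewrite mulr_sumr; apply: ler_sum => i _.
rewrite ler_wpM2l ?divr_ge0 ?exprn_ge0 ?(ltW cV0)//.
apply: (le_trans (gram_total_le v)); rewrite -mulrA ler_wpM2l ?(ltW b40)//.
exact: direction_le.
Qed.

Variable Xb : R.
Hypothesis normX : forall i j, enorm (x i j) <= Xb.

(** No cluster dominates: its loading is at most of order [Xb / sqrt n]. *)
Lemma loading_max_le i : 0 <= C1 ->
  enorm (loading mu X b0 V v i) <= Num.sqrt (C1 / cV ^+ 2 * (m%:R * (Xb ^+ 2 / n%:R) / Mbar_floor)).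
Proof.
move=> C1_ge0; have hM0 := Mbar_floor_gt0.
rewrite -ler_sqr ?nnegrE ?enorm_ge0 ?sqrtr_ge0// (@sqr_sqrtr _ (C1 / cV ^+ 2 * _)); last first.
  apply: mulr_ge0; first by rewrite divr_ge0 ?exprn_ge0 ?(ltW cV0).
  apply: divr_ge0; last exact: ltW.
  by apply: mulr_ge0 => //; apply: divr_ge0; rewrite ?sqr_ge0.
apply: (le_trans (loading_sq_le i)).
rewrite ler_wpM2l ?divr_ge0 ?exprn_ge0 ?(ltW cV0)//.
apply: (@le_trans _ _ (\sum_(j < m) Xb ^+ 2 * dot v v)).
  apply: ler_sum => j _.
  rewrite -[dot (x i j) v ^+ 2]real_normK ?num_real// -sqr_enorm -exprMn.
  rewrite ler_sqr ?nnegrE ?mulr_ge0 ?enorm_ge0//; last first.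
    exact: le_trans (enorm_ge0 _) (normX i j).
  by apply: (le_trans (dot_CS _ _)); rewrite ler_wpM2r ?enorm_ge0.
rewrite sumr_const card_ord -(mulr_natl (_ * _)) -mulrA ler_wpM2l//.
have nn : 0 < n%:R :> R by rewrite ltr0n.
have -> : Xb ^+ 2 / n%:R / Mbar_floor = Xb ^+ 2 * (Mbar_floor^-1 / n%:R) by field; rewrite !gt_eqF.
rewrite ler_wpM2l ?sqr_ge0// ler_pdivlMr// mulrC; exact: direction_le.
Qed.

End Design.

(** * Roots and linearisation on one row of the array *)

Section Tame.
Context {R : realType}.
Variables (mu m2 m3 : R -> R) (m p n : nat) (X : 'I_n -> 'M[R]_(m, p)) (b0 : 'cV[R]_p).
Variables (c C M r : R).
Hypothesis ball : forall b, enorm (b - b0) <= r -> forall i j,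
  [/\ c <= mu^`()%classic (linpred (X i) b j) <= C, `|m2 (linpred (X i) b j)| <= M &
      `|m3 (linpred (X i) b j)| <= M].

(** Moving the parameter along the covariate itself reaches every linear predictor
    within the radius times the norm of the covariate, so bounds on a ball of
    parameters are bounds on an interval of predictors. *)
Lemma tame_of_ball i j : 0 <= r ->
  tame mu^`()%classic m2 m3 c C M (dot (covar X i j) b0) (r * enorm (covar X i j)).
Proof.
move=> r0 z; set x := covar X i j => zr.
have [x0|x0] := eqVneq (enorm x) 0.
  have -> : z = linpred (X i) b0 j.
    apply/eqP; rewrite linpredE -subr_eq0 -normr_eq0 eq_le normr_ge0 andbT.
    by move: zr; rewrite x0 mulr0.
  by apply: ball; rewrite subrr enorm0.
have x1 : 0 < enorm x by rewrite lt_neqAle eq_sym x0 enorm_ge0.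
pose b := b0 + ((z - dot x b0) / enorm x ^+ 2) *: x.
have -> : z = linpred (X i) b j.
  rewrite linpredE dotDr dotZr -/x -sqr_enorm divfK ?expf_neq0//.
  by rewrite addrC subrK.
apply: ball; rewrite /b addrAC subrr add0r enormZ normrM normfV.
rewrite (ger0_norm (sqr_ge0 _)) expr2 invfM mulrA divfK//.
by rewrite ler_pdivrMr.
Qed.

End Tame.

Section GoodOutcome.
Context d (T : measurableType d) (R : realType) (P : probability T R).
Variables (mu : R -> R) (m p n : nat) (X : 'I_n -> 'M[R]_(m, p)).
Variables (Y : 'I_n -> 'I_m -> {RV P >-> R}) (b0 : 'cV[R]_p).
Local Notation x := (covar X).
Local Notation eta0 i j := (dot (x i j) b0).
Hypothesis iY : independent_vectors P (fun i j => Y i j).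
Hypothesis EY : forall i j, ('E_P[Y i j] = (mu (linpred (X i) b0 j))%:E)%E.
Hypothesis VY : forall i j, ('V_P[Y i j] = (mu^`()%classic (linpred (X i) b0 j))%:E)%E.
Variables (V R0 : 'M[R]_m) (W : T -> 'M[R]_m).
Variables (c1 C1 cV CV cR b3 b4 CX c C M Delta tau0 th eps2 : R).
Hypotheses (n0 : (0 < n)%N) (p0 : (0 < p)%N) (pn : p%:R <= Num.sqrt n%:R :> R).
Hypotheses (c10 : 0 < c1) (C10 : 0 < C1) (cV0 : 0 < cV) (CV0 : 0 < CV) (cR0 : 0 < cR)
  (b30 : 0 < b3) (b40 : 0 < b4) (CX0 : 0 < CX) (c0 : 0 < c) (C0 : 0 <= C) (M0 : 0 <= M)
  (D0 : 0 < Delta) (t0 : 0 <= tau0) (th0 : 0 < th).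
Hypothesis d0 : forall z, is_derive z (1 : R) mu (mu^`()%classic z).
Hypothesis d1 : forall z, is_derive z (1 : R) (mu^`()%classic) (mu^`(2)%classic z).
Hypothesis d2 : forall z, is_derive z (1 : R) (mu^`(2)%classic) (mu^`(3)%classic z).
Hypothesis var0 : forall i j, c1 <= mu^`()%classic (eta0 i j) <= C1.
Let Q := Num.sqrt p%:R : R.
Let N := Num.sqrt n%:R : R.
Hypothesis normX : forall i j, enorm (x i j) <= CX * Q.
Let r := Delta * (Q / N).
Hypothesis ball : forall b, enorm (b - b0) <= r -> forall i j,
  [/\ c <= mu^`()%classic (linpred (X i) b j) <= C,
      `|mu^`(2)%classic (linpred (X i) b j)| <= M &
      `|mu^`(3)%classic (linpred (X i) b j)| <= M].
Hypotheses (sV : V^T = V) (lowV : forall u, cV * dot u u <= quad V u)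
  (upV : forall u, quad V u <= CV * dot u u).
Hypotheses (sR : R0^T = R0) (lowR : forall u, cR * dot u u <= quad R0 u).
Hypothesis lowG : b3 <= lambda_min (n%:R^-1 *: \sum_(i < n) (X i)^T *m X i).
Hypothesis upG : lambda_max (n%:R^-1 *: \sum_(i < n) (X i)^T *m X i) <= b4.
Hypothesis WV : prob_ge P [set w | enorm (invmx (W w) - invmx V) <= tau0 * (Q / N)] (1 - eps2).

Definition noise_scale := Num.sqrt (th * C1).
Definition start_const := noise_scale * (Num.sqrt C1 / Num.sqrt c1) * CX.
Let f := noise_scale.
Let K := weight_const c C M.
Let L := mean_const c C M.
Let KP := 1 + K ^+ 2.
Definition slack_const := let KP := 1 + weight_const c C M ^+ 2 in
  2 * (noise_scale * KP * CX ^+ 2) +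
  4 * weight_const c C M ^+ 2 * (Delta * CX) * ((1 + C1) * b4 + noise_scale * KP * CX ^+ 2) +
  2 * mean_const c C M * (Delta * CX) * b4.
Let kappa := Num.sqrt m%:R / cV.
Definition err_const := m%:R ^+ 2 *
  (Num.sqrt m%:R / cV * slack_const + tau0 * (slack_const + weight_const c C M ^+ 2 * b4)).

Let Q1 : 1 <= Q. Proof. by rewrite -sqrtr1 ler_wsqrtr// ler1n. Qed.
Let N1 : 1 <= N. Proof. by rewrite -sqrtr1 ler_wsqrtr// ler1n. Qed.
Let N0 : 0 < N. Proof. exact: lt_le_trans N1. Qed.
Let Q0 : 0 < Q. Proof. exact: lt_le_trans Q1. Qed.
Let Q2 : Q ^+ 2 = p%:R. Proof. by rewrite sqr_sqrtr. Qed.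
Let N2 : N ^+ 2 = n%:R. Proof. by rewrite sqr_sqrtr. Qed.
Let QN : Q ^+ 2 <= N. Proof. by rewrite Q2. Qed.
Let QN1 : Q <= N.
Proof. by apply: le_trans QN; rewrite expr2 ler_peMr// ltW. Qed.
Let r0 : 0 <= r. Proof. by rewrite mulr_ge0 ?divr_ge0 ?(ltW D0) ?(ltW Q0) ?(ltW N0). Qed.
Let f0 : 0 < f. Proof. by rewrite sqrtr_gt0 mulr_gt0. Qed.
Let fluctE : fluct n C1 th = f * N.
Proof. by rewrite /fluct mulrCA mulrC sqrtrM// mulr_ge0// ltW. Qed.
Let K0 : 0 <= K. Proof. exact: weight_const_ge0. Qed.
Let L0 : 0 <= L. Proof. by rewrite !addr_ge0 ?mulr_ge0 ?exprn_ge0. Qed.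
Let KP1 : 1 <= KP. Proof. by rewrite lerDl exprn_ge0. Qed.
Let KP0 : 0 < KP. Proof. exact: lt_le_trans KP1. Qed.

Let tameX i j : tame mu^`()%classic mu^`(2)%classic mu^`(3)%classic c C M (eta0 i j)
  (r * enorm (x i j)).
Proof. by apply: tame_of_ball. Qed.

Let G := b4 * n%:R.
Let Phi := fluct n C1 th * (KP * (CX * Q) ^+ 2).
Let Ge := (1 + C1) * G + Phi.
Let T0 := fluct n C1 th * (Num.sqrt C1 / Num.sqrt c1 * (CX * Q)).
Let tau := tau0 * (Q / N).

Definition good_outcome := [set w | let y := fun i => \col_j Y i j w in
    [/\ forall j k u, \sum_i `|y i k ord0 - mu (eta0 i k)| * dot (x i j) u ^+ 2 <=
          Ge * dot u u,
        forall j k, enorm (\sum_i ((y i k ord0 - mu (eta0 i k)) *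
          (dsd mu^`()%classic mu^`(2)%classic (eta0 i j) * isd mu^`()%classic (eta0 i k))) *:
          (x i j *m (x i j)^T)) <= Phi,
        forall j k, enorm (\sum_i ((y i k ord0 - mu (eta0 i k)) *
          (sd mu^`()%classic (eta0 i j) * disd mu^`()%classic mu^`(2)%classic (eta0 i k))) *:
          (x i j *m (x i k)^T)) <= Phi,
        forall j k, enorm (pair_score mu X y j k b0) <= T0 &
        enorm (invmx (W w) - invmx V) <= tau]].

Lemma prob_good_outcome : prob_ge P good_outcome (1 - (4 * (m%:R ^+ 2 / th) + eps2)).
Proof.
have x0 i j : `|eta0 i j - eta0 i j| <= r * enorm (x i j).
  by rewrite subrr normr0 mulr_ge0 ?enorm_ge0.
have H := @score_good_event _ _ _ P mu m p n X Y b0 iY EY VY mu^`(2)%classic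
  C1 (Num.sqrt C1 / Num.sqrt c1) KP (CX * Q) G th n0 C10.
have {}H := H (divr_gt0 _ _) KP1 (mulr_gt0 CX0 Q0) th0.
apply: prob_geW (prob_geI (H _ _ _ _ _ _ _ _) WV); rewrite ?sqrtr_gt0//.
- by move=> w /= [[]].
- by move=> i j; case/andP: (var0 i j).
- move=> i j k; apply: norm_div_le; rewrite ?sqrtr_gt0//.
    by rewrite ler_wsqrtr//; case/andP: (var0 i k).
  by rewrite ger0_norm ?sqrtr_ge0// ler_wsqrtr//; case/andP: (var0 i j).
- move=> i j k; apply: (@le_trans _ _ (K ^+ 2)); last by rewrite lerDr.
  exact: (slope1_le c0 M0 (@tameX i j) (@tameX i k) (x0 i j) (x0 i k)).
- move=> i j k; apply: (@le_trans _ _ (K ^+ 2)); last by rewrite lerDr.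
  exact: (slope2_le c0 M0 (@tameX i j) (@tameX i k) (x0 i j) (x0 i k)).
- by move=> j u; exact: gram_le.
Qed.

Let NQ2 : 0 <= N * Q ^+ 2.
Proof. by apply: mulr_ge0; [exact: ltW|exact: sqr_ge0]. Qed.
Let Q2N : Q ^+ 2 / N <= 1. Proof. by rewrite ler_pdivrMr// mul1r. Qed.
Let Phi0 : 0 <= f * KP * CX ^+ 2.
Proof. by rewrite mulr_ge0 ?sqr_ge0// mulr_ge0 ?ltW. Qed.

Let score_slack_le : score_slack c C M r (CX * Q) G Ge Phi <= slack_const * (N * Q ^+ 2).
Proof.
have K2 := sqr_ge0 K; have DX : 0 <= Delta * CX by rewrite mulr_ge0 ?ltW.
have -> : score_slack c C M r (CX * Q) G Ge Phi =
  (2 * (f * KP * CX ^+ 2) + 4 * K ^+ 2 * (Delta * CX) *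
   ((1 + C1) * b4 + f * KP * CX ^+ 2 * (Q ^+ 2 / N)) + 2 * L * (Delta * CX) * b4) * (N * Q ^+ 2).
  rewrite /score_slack /Ge /G /Phi fluctE -N2 -/K -/L /r.
  by field; rewrite gt_eqF.
rewrite /slack_const/= -/K -/L -/KP -/f ler_wpM2r//.
rewrite lerD2r lerD2l ler_wpM2l//; first by apply: mulr_ge0 => //; exact: mulr_ge0.
by rewrite lerD2l ler_piMr.
Qed.

Let slack_const0 : 0 <= slack_const.
Proof.
rewrite /slack_const/= -/K -/L -/KP -/f.
have DX : 0 <= Delta * CX by rewrite mulr_ge0 ?ltW.
have C11 : 0 <= (1 + C1) * b4 by rewrite mulr_ge0 ?ltW// addr_gt0.
apply: addr_ge0; first apply: addr_ge0.
- exact: mulr_ge0.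
- apply: mulr_ge0; last exact: addr_ge0.
  by apply: mulr_ge0 => //; apply: mulr_ge0 => //; exact: sqr_ge0.
- by apply: mulr_ge0; [apply: mulr_ge0 => //; exact: mulr_ge0|exact: ltW].
Qed.

Let kappa0 : 0 <= kappa. Proof. by rewrite divr_ge0 ?sqrtr_ge0 ?ltW. Qed.

(** With [p = Q ^+ 2 <= N = sqrt n], each of the terms of [score_err] is at most a constant
    times [N * Q ^+ 2]. *)
Lemma score_err_le : score_err m c C M r (CX * Q) G Ge Phi tau kappa <=
  err_const * (N * Q ^+ 2).
Proof.
rewrite /score_err /err_const -/kappa -/K -mulrA; apply: ler_wpM2l; first exact: sqr_ge0.
rewrite mulrDl; have s := score_slack_le; set sl := score_slack _ _ _ _ _ _ _ _ in s *.
apply: lerD; first by rewrite -mulrA ler_wpM2l.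
rewrite /tau -2!(mulrA tau0); apply: ler_wpM2l => //; rewrite mulrDr mulrDl; apply: lerD.
  apply: (@le_trans _ _ (Q / N * (slack_const * (N * Q ^+ 2)))).
    by rewrite ler_wpM2l// divr_ge0 ?(ltW Q0) ?(ltW N0).
  by apply: ler_piMl; [exact: mulr_ge0|rewrite ler_pdivrMr// mul1r].
rewrite /G -N2; have -> : Q / N * (K ^+ 2 * (b4 * N ^+ 2)) = K ^+ 2 * b4 * (N * Q).
  by field; rewrite gt_eqF.
apply: ler_wpM2l; first by apply: mulr_ge0; [exact: sqr_ge0|exact: ltW].
by apply: ler_wpM2l; [exact: ltW|rewrite expr2 ler_peMr ?(ltW Q0)].
Qed.

Let T0E : T0 = start_const * (N * Q).
Proof. by rewrite /T0 fluctE /start_const -/f; ring. Qed.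

Let tau_le : tau <= tau0.
Proof. by rewrite /tau ler_piMr// ler_pdivrMr// mul1r. Qed.

Let Vk : enorm (invmx V) <= kappa. Proof. exact: (enorm_inv_le sV cV0 lowV). Qed.
Let G0 : 0 <= G. Proof. by rewrite mulr_ge0 ?(ltW b40). Qed.
Let Ge0 : 0 <= Ge.
Proof.
have Phi1 : 0 <= Phi.
  by rewrite mulr_ge0 ?sqrtr_ge0// mulr_ge0 ?sqr_ge0// ltW.
by rewrite addr_ge0// mulr_ge0 ?addr_ge0// ltW.
Qed.
Let Xb0 : 0 <= CX * Q. Proof. by rewrite mulr_ge0 ?ltW. Qed.
Let gram j u : \sum_i dot (x i j) u ^+ 2 <= G * dot u u.
Proof. exact: gram_le. Qed.
Let sc0 : 0 <= start_const.
Proof. by rewrite /start_const !mulr_ge0 ?invr_ge0 ?sqrtr_ge0 ?(ltW CX0). Qed.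

Local Notation y w := (fun i => \col_j Y i j w).

Lemma good_root w : good_outcome w ->
  err_const * p%:R <= Hbar_floor c1 CV b3 / 2 * N ->
  m%:R ^+ 2 * ((kappa + tau0) * start_const) <= Hbar_floor c1 CV b3 / 2 * Delta ->
  exists2 b, gee_score mu X (W w) (y w) b = 0 & enorm (b - b0) <= r.
Proof.
move=> [g1 g2 g3 g4 g5] small1 small2.
have hH0 : 0 < Hbar_floor c1 CV b3 by rewrite divr_gt0 ?mulr_gt0.
apply: (score_root d0 d1 d2 c0 C0 M0 r0 Xb0 tameX normX G0 gram Ge0 g1 g2 g3 g4 g5 Vk
  (h := Hbar_floor c1 CV b3 * n%:R)).
- by rewrite mulr_gt0 ?ltr0n.
- exact: (Hbar_coercive n0 c10 cV0 CV0 var0 sV lowV upV lowG).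
- apply: (le_trans score_err_le); rewrite -N2 Q2.
  have -> : Hbar_floor c1 CV b3 * N ^+ 2 / 2 = Hbar_floor c1 CV b3 / 2 * N * N by ring.
  by rewrite (mulrC N p%:R) mulrA ler_wpM2r// ltW.
- rewrite T0E -N2 /r.
  have -> : Hbar_floor c1 CV b3 * N ^+ 2 / 2 * (Delta * (Q / N)) = Hbar_floor c1 CV b3 / 2 * Delta * (N * Q).
    by field; rewrite gt_eqF.
  apply: (@le_trans _ _ (m%:R ^+ 2 * ((kappa + tau0) * start_const) * (N * Q))); last first.
    by rewrite ler_wpM2r// mulr_ge0 ?ltW.
  have -> : m%:R ^+ 2 * ((kappa + tau0) * start_const) * (N * Q) =
    m%:R ^+ 2 * ((kappa + tau0) * (start_const * (N * Q))) by rewrite !mulrA.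
  apply: ler_wpM2l; first exact: sqr_ge0.
  apply: ler_wpM2r; last by rewrite lerD2l.
  by apply: mulr_ge0 => //; rewrite mulr_ge0 ?ltW.
Qed.

Variable a : 'cV[R]_p.
Hypothesis a1 : enorm a = 1.
Local Notation v := (direction mu X b0 V R0 a).

Definition linear_const := let g := Num.sqrt (Mbar_floor c1 CV cR b3)^-1 in
  err_const * Delta * g + m%:R ^+ 2 * tau0 * start_const * g.

(** The expansion at a root, with [b' = b0], and the replacement of the estimated working
    matrix by its limit at [b0]; both errors carry the factor [|v| = O(1 / sqrt n)]. *)
Lemma good_linearization w b : good_outcome w ->
  gee_score mu X (W w) (y w) b = 0 -> enorm (b - b0) <= r ->
  `|dot v (Hbar mu X V b0 *m (b - b0)) - \sum_i summand mu X Y b0 V v i w| <=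
    linear_const * (Q * p%:R / N).
Proof.
move=> [g1 g2 g3 g4 g5] Sb br.
have hM0 : 0 < Mbar_floor c1 CV cR b3 by exact: Mbar_floor_gt0.
set g := Num.sqrt (Mbar_floor c1 CV cR b3)^-1.
have vle : enorm v <= g / N.
  rewrite ler_pdivlMr// -ler_sqr ?nnegrE ?mulr_ge0 ?enorm_ge0 ?sqrtr_ge0//.
  rewrite exprMn sqr_enorm N2 (@sqr_sqrtr _ (Mbar_floor c1 CV cR b3)^-1) ?invr_ge0 ?(ltW hM0)//.
  rewrite mulrC; exact: (direction_le n0 c10 cV0 CV0 cR0 b30 var0 sV lowV upV sR lowR lowG a1).
have b00 : enorm (b0 - b0) <= r by rewrite subrr enorm0.
have E1 := score_expand d0 d1 d2 c0 C0 M0 r0 Xb0 tameX normX G0 gram Ge0 g1 g2 g3 g5 Vk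
  br b00 v.
have E2 := score_start_diff g4 g5 v.
rewrite -score_summands//.
have -> : dot v (Hbar mu X V b0 *m (b - b0)) - dot v (gee_score mu X V (y w) b0) =
    dot v (gee_score mu X (W w) (y w) b - gee_score mu X (W w) (y w) b0 +
      Hbar mu X V b0 *m (b - b0)) +
    dot v (gee_score mu X (W w) (y w) b0 - gee_score mu X V (y w) b0).
  by rewrite Sb dotDr !dotBr (dotC v 0) dot0l; ring.
apply: (le_trans (ler_normD _ _)); rewrite /linear_const -/g mulrDl.
have ec0 : 0 <= err_const.
  rewrite /err_const; apply: mulr_ge0; first exact: sqr_ge0.
  apply: addr_ge0; apply: mulr_ge0 => //; apply: addr_ge0 => //.
  by apply: mulr_ge0; [exact: sqr_ge0|exact: ltW].
have g0 : 0 <= g := sqrtr_ge0 _.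
apply: lerD.
  apply: (le_trans E1).
  apply: (@le_trans _ _ (err_const * (N * Q ^+ 2) * (g / N * r))).
    apply: (@le_trans _ _ (err_const * (N * Q ^+ 2) * (enorm v * enorm (b - b0)))).
      by apply: ler_wpM2r; [rewrite mulr_ge0 ?enorm_ge0|exact: score_err_le].
    apply: ler_wpM2l; first exact: mulr_ge0.
    by apply: ler_pM; rewrite ?enorm_ge0.
  rewrite le_eqVlt; apply/orP; left; apply/eqP.
  by rewrite /r -Q2; field; rewrite gt_eqF.
apply: (le_trans E2); rewrite T0E /tau.
apply: (@le_trans _ _ (m%:R ^+ 2 * (tau0 * (Q / N) * (start_const * (N * Q))) * (g / N))).
  by rewrite ler_wpM2l// !mulr_ge0 ?invr_ge0 ?sqr_ge0// ltW.
have -> : m%:R ^+ 2 * (tau0 * (Q / N) * (start_const * (N * Q))) * (g / N) =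
   m%:R ^+ 2 * tau0 * start_const * g * (1 * Q ^+ 2 / N) by field; rewrite gt_eqF.
rewrite -Q2; apply: ler_wpM2l.
  by apply: mulr_ge0 => //; apply: mulr_ge0 => //; apply: mulr_ge0 => //; exact: sqr_ge0.
apply: ler_wpM2r; first by rewrite invr_ge0 ltW.
by apply: ler_wpM2r; [exact: sqr_ge0|].
Qed.

End GoodOutcome.

(** * Rates, derivatives and comparison of distribution functions *)

Section Rates.
Context {R : realType}.
Variable p : nat -> nat.

Lemma sqrt_ratio (q n : nat) : Num.sqrt (q%:R / n%:R) = Num.sqrt q%:R / Num.sqrt n%:R :> R.
Proof. by rewrite sqrtrM// sqrtrV. Qed.

Lemma rate_square (e : R) : (n%:R^-1 * (p n)%:R ^+ 2 : R) @[n --> \oo] --> (0 : R) -> 0 < e ->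
  \forall n \near \oo, (p n)%:R <= e * Num.sqrt n%:R.
Proof.
move=> h e0; have e2 : 0 < e ^+ 2 by rewrite exprn_gt0.
move/cvgr0Pnorm_le: h => /(_ _ e2) h.
near=> n.
have n0 : (0 < n)%N by near: n; exact: nbhs_infty_gt.
have nR : 0 < n%:R :> R by rewrite ltr0n.
rewrite -ler_sqr ?nnegrE ?mulr_ge0 ?sqrtr_ge0 ?(ltW e0)//.
rewrite exprMn (@sqr_sqrtr _ n%:R)// -ler_pdivrMr// mulrC.
have : `|n%:R^-1 * (p n)%:R ^+ 2| <= e ^+ 2 by near: n.
exact: le_trans (ler_norm _).
Unshelve. all: by end_near. Qed.

Lemma rate_cube (e : R) : (n%:R^-1 * (p n)%:R ^+ 3 : R) @[n --> \oo] --> (0 : R) -> 0 < e ->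
  \forall n \near \oo, Num.sqrt (p n)%:R * (p n)%:R / Num.sqrt n%:R <= e.
Proof.
move=> h e0; have e2 : 0 < e ^+ 2 by rewrite exprn_gt0.
move/cvgr0Pnorm_le: h => /(_ _ e2) h.
near=> n.
rewrite -ler_sqr ?nnegrE ?mulr_ge0 ?invr_ge0 ?sqrtr_ge0 ?(ltW e0)//.
rewrite exprMn exprVn (@sqr_sqrtr _ n%:R)// exprMn (@sqr_sqrtr _ (p n)%:R)//.
have : `|n%:R^-1 * (p n)%:R ^+ 3| <= e ^+ 2 by near: n.
have -> : (p n)%:R * (p n)%:R ^+ 2 / n%:R = n%:R^-1 * (p n)%:R ^+ 3 :> R by ring.
exact: le_trans (ler_norm _).
Unshelve. all: by end_near. Qed.

End Rates.

Section Derivatives.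
Context {R : realType}.
Variable mu : R -> R.
Hypothesis mu_derivable : forall (k : nat) (x : R), (k < 3)%N ->
  derivable (mu^`(k)%classic) x 1.

Lemma is_derive_derive1n (k : nat) (z : R) : (k < 3)%N ->
  is_derive z (1 : R) (mu^`(k)%classic) (mu^`(k.+1)%classic z).
Proof.
by move=> k3; rewrite derive1nS derive1E; apply: derivableP; exact: mu_derivable.
Qed.

End Derivatives.

Section Sandwich.
Context d (T : measurableType d) (R : realType) (P : probability T R).
Variables (U W : T -> R) (eta b : R).
Hypotheses (mU : measurable_fun setT U) (mW : measurable_fun setT W).
Hypothesis close : prob_ge P [set w | `|U w - W w| <= eta] (1 - b).

Let half_line (f : T -> R) s : measurable_fun setT f -> measurable [set w | f w <= s].
Proof.
move=> mf; have -> : [set w | f w <= s] = f @^-1` `]-oo, s].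
  by apply/seteqP; split => w; rewrite /= in_itv.
exact: preim_measurable.
Qed.

Let transfer (E F A : set T) : measurable E -> measurable F -> measurable A ->
  ((1 - b)%:E <= P A)%E -> E `&` A `<=` F -> fine (P E) <= fine (P F) + b.
Proof.
move=> mE mF mA PA EF.
have mC : measurable (~` A) by exact: measurableC.
have PC : (P (~` A) <= b%:E)%E.
  rewrite probability_setC//; move: PA; rewrite -[P A]fineK ?fin_num_measure//.
  by rewrite lee_fin -[1%E]/(1%:E) -EFinB lee_fin; lra.
rewrite -lee_fin EFinD !fineK ?fin_num_measure//.
apply: (@le_trans _ _ (P (F `|` ~` A))).
  apply: le_measure; rewrite ?inE//; first exact: measurableU.
  by move=> w Ew; have [Aw|] := pselect (A w); [left; apply: EF|right].
apply: (le_trans (measureU2 _ mF mC)); by rewrite leeD2l.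
Qed.

Lemma distribution_sandwich t :
  fine (P [set w | W w <= t - eta]) - b <= fine (P [set w | U w <= t]) <=
  fine (P [set w | W w <= t + eta]) + b.
Proof.
have [A [mA AE PA]] := close; apply/andP; split.
  rewrite lerBlDr; apply: (@transfer _ _ A) => //; try exact: half_line.
  by move=> w /= [Ww /AE/ler_normlP[]]; lra.
apply: (@transfer _ _ A) => //; try exact: half_line.
by move=> w /= [Uw /AE/ler_normlP[]]; lra.
Qed.

(** A statistic within [eta] of [W] off an event of probability [b] inherits the normal
    approximation of [W] at [t - eta] and [t + eta]; going back from there to [t] costs
    at most the maximal slope of the normal distribution function. *)
Lemma normal_cdf_transfer t a : 0 <= eta ->
  normal_cdf (t - eta - eta) - a <= fine (P [set w | W w <= t - eta]) ->
  fine (P [set w | W w <= t + eta]) <= normal_cdf (t + eta + eta) + a ->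
  `|normal_cdf t - fine (P [set w | U w <= t])| <= normal_peak 1 * (2 * eta) + a + b.
Proof.
move=> eta0 lo up; have /andP[slo sup] := distribution_sandwich t.
have st : t <= t + eta + eta by lra.
have ts : t - eta - eta <= t by lra.
have := normal_cdf_lip st; have := normal_cdf_lip ts.
have -> : t - (t - eta - eta) = 2 * eta by ring.
have -> : t + eta + eta - t = 2 * eta by ring.
by rewrite ler_distlC => h1 h2; apply/andP; split; lra.
Qed.

End Sandwich.

(** * The asymptotic statement *)

(** What the assumptions give at one sample size, with constants that do not depend on
    the sample size nor on the radius of a ball of parameters. *)
Record regular_row (R : realType) (mu : R -> R) m p n (X : 'I_n -> 'M[R]_(m, p))
    (b0 : 'cV[R]_p) (V R0 : 'M[R]_m) (c1 C1 cV CV cR b3 b4 CX : R) : Prop := RegularRow {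
  row_size : (0 < n)%N;
  row_dim : (0 < p)%N;
  row_rate : p%:R <= Num.sqrt n%:R :> R;
  row_covar : forall i j, enorm (covar X i j) <= CX * Num.sqrt p%:R;
  row_var : forall i j, c1 <= mu^`()%classic (dot (covar X i j) b0) <= C1;
  row_sV : V^T = V;
  row_lowV : forall u, cV * dot u u <= quad V u;
  row_upV : forall u, quad V u <= CV * dot u u;
  row_sR : R0^T = R0;
  row_lowR : forall u, cR * dot u u <= quad R0 u;
  row_lowG : b3 <= lambda_min (n%:R^-1 *: \sum_(i < n) (X i)^T *m X i);
  row_upG : lambda_max (n%:R^-1 *: \sum_(i < n) (X i)^T *m X i) <= b4 }.

Theorem theorem5p1 (R : realType) (m : nat) (p : nat -> nat)
  (* mu is three times differentiable *)
  (mu : R -> R)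
  (mu_derivable : forall (k : nat) (x : R), (k < 3)%N ->
     derivable (mu^`(k)%classic) x 1)
  (* one probability space for each number n of clusters *)
  (d : nat -> measure_display) (T : forall n, measurableType (d n))
  (P : forall n, probability (T n) R)
  (X : forall n, 'I_n -> 'M[R]_(m, p n))
  (Y : forall n, 'I_n -> 'I_m -> {RV (P n) >-> R})
  (beta0 : forall n, 'cV[R]_(p n))
  (B : forall n, set 'cV[R]_(p n))
  (R0 Rbar : nat -> 'M[R]_m)
  (Rhat : forall n, T n -> 'M[R]_m)
  (Rhat_measurable : forall n (j k : 'I_m),
     measurable_fun [set: T n] (fun w => Rhat n w j k))
  (p_infty : p @ \oo --> \oo)
  (* the marginal model *)
  (Y_independent : forall n, independent_vectors (P n) (fun i j => Y n i j))
  (Y_mean : forall n (i : 'I_n) (j : 'I_m),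
     ('E_(P n)[Y n i j] = (mu (linpred (X n i) (beta0 n) j))%:E)%E)
  (Y_variance : forall n (i : 'I_n) (j : 'I_m),
     ('V_(P n)[Y n i j] = (mu^`()%classic (linpred (X n i) (beta0 n) j))%:E)%E)
  (Y_correlation : forall n (i : 'I_n) (j k : 'I_m),
     correlation (P n) (Y n i j) (Y n i k) = R0 n j k)
  (A1 : exists C : R, \forall n \near \oo, forall (i : 'I_n) (j : 'I_m),
     enorm (row j (X n i)) <= C * Num.sqrt (p n)%:R)
  (A2_compact : forall n, compact (B n))
  (A2_interior : forall n, (B n)° (beta0 n))
  (A2_logistic : exists b1 b2 : R, [/\ 0 < b1, b2 < 1 &
     \forall n \near \oo, forall (i : 'I_n) (j : 'I_m),
       b1 <= logistic (linpred (X n i) (beta0 n) j) <= b2])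
  (A3 : exists b3 b4 : R, [/\ 0 < b3, 0 < b4 &
     \forall n \near \oo,
       let G := n%:R^-1 *: \sum_(i < n) (X n i)^T *m X n i in
       b3 <= lambda_min G /\ lambda_max G <= b4])
  (A4_R0 : exists c C : R, 0 < c /\
     \forall n \near \oo, c <= lambda_min (R0 n) /\ lambda_max (R0 n) <= C)
  (A4_Rbar_posdef : forall n, posdefmx (Rbar n))
  (A4_Rbar : exists c C : R, 0 < c /\
     \forall n \near \oo, c <= lambda_min (Rbar n) /\ lambda_max (Rbar n) <= C)
  (A4_Rhat : is_Op P (fun n w => enorm (invmx (Rhat n w) - invmx (Rbar n)))
     (fun n => Num.sqrt ((p n)%:R / n%:R)))
  (A5 : exists M1 delta : R, [/\ 0 < M1, 0 < delta &
     \forall n \near \oo, forall i : 'I_n,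
       ('E_(P n)[fun w => (enorm (Ainvhalf mu (X n i) (beta0 n) *m
          ((\col_j Y n i j w) - meanvec mu (X n i) (beta0 n)))
            `^ (2 + delta))%R] <= M1%:E)%E])
  (A6 : forall Delta : R, 0 < Delta -> exists c C M2 : R,
     [/\ 0 < c, 0 < M2 & \forall n \near \oo, forall b : 'cV[R]_(p n),
       enorm (b - beta0 n) <= Delta * Num.sqrt ((p n)%:R / n%:R) ->
       forall (i : 'I_n) (j : 'I_m),
         [/\ c <= mu^`()%classic (linpred (X n i) b j) <= C,
             `|mu^`(2)%classic (linpred (X n i) b j)| <= M2 &
             `|mu^`(3)%classic (linpred (X n i) b j)| <= M2]])
  (rate2 : (n%:R^-1 * (p n)%:R ^+ 2 : R) @[n --> \oo] --> (0 : R)) :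
  (* existence of a root-(n/p_n)-consistent root *)
  (forall eps : R, 0 < eps -> exists2 Delta : R, 0 < Delta &
     \forall n \near \oo, prob_ge (P n)
       [set w | exists2 b : 'cV[R]_(p n),
          gee_score mu (X n) (Rhat n w) (fun i => \col_j Y n i j w) b = 0 &
          enorm (b - beta0 n) <= Delta * Num.sqrt ((p n)%:R / n%:R)]
       (1 - eps))
  /\
  (* asymptotic normality of every such sequence of roots *)
  ((n%:R^-1 * (p n)%:R ^+ 3 : R) @[n --> \oo] --> (0 : R) ->
   forall betahat : forall n, T n -> 'cV[R]_(p n),
     (forall n (k : 'I_(p n)),
        measurable_fun [set: T n] (fun w => betahat n w k ord0)) ->
     (forall eps : R, 0 < eps -> exists2 Delta : R, 0 < Delta &
        \forall n \near \oo, prob_ge (P n)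
          [set w |
             gee_score mu (X n) (Rhat n w) (fun i => \col_j Y n i j w)
               (betahat n w) = 0 /\
             enorm (betahat n w - beta0 n)
               <= Delta * Num.sqrt ((p n)%:R / n%:R)]
          (1 - eps)) ->
     forall alpha : forall n, 'cV[R]_(p n),
       (\forall n \near \oo, enorm (alpha n) = 1) ->
       cvg_in_distribution P
         (fun n w => ((alpha n)^T
            *m invmx (sqrtmx (Mbar mu (X n) (Rbar n) (R0 n) (beta0 n)))
            *m Hbar mu (X n) (Rbar n) (beta0 n)
            *m (betahat n w - beta0 n)) ord0 ord0)
         (normal_prob 0 1)).
Proof.
have dmu0 z : is_derive z (1 : R) mu (mu^`()%classic z) :=
  is_derive_derive1n mu_derivable z (isT : 0 < 3)%N.
have dmu1 z : is_derive z (1 : R) mu^`()%classic (mu^`(2)%classic z) :=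
  is_derive_derive1n mu_derivable z (isT : 1 < 3)%N.
have dmu2 z : is_derive z (1 : R) mu^`(2)%classic (mu^`(3)%classic z) :=
  is_derive_derive1n mu_derivable z (isT : 2 < 3)%N.
pose tame_ball Delta c C M n := forall b : 'cV[R]_(p n),
  enorm (b - beta0 n) <= Delta * (Num.sqrt (p n)%:R / Num.sqrt n%:R) ->
  forall (i : 'I_n) (j : 'I_m),
    [/\ c <= mu^`()%classic (linpred (X n i) b j) <= C,
        `|mu^`(2)%classic (linpred (X n i) b j)| <= M &
        `|mu^`(3)%classic (linpred (X n i) b j)| <= M].
have ball Delta : 0 < Delta -> exists c C M : R, [/\ 0 < c, 0 < C, 0 <= M &
    \forall n \near \oo, tame_ball Delta c C M n].
  move=> D0; have [c [C [M [c0 M0 H]]]] := A6 _ D0.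
  (* without any coordinate the upper bound has no sign, hence the maximum with 1 *)
  exists c, (Num.max C 1), M; split; rewrite ?lt_max ?ltr01 ?orbT ?ltW//.
  apply: filterS H => n Hn b br i j.
  have [|/andP[h1 h2] h3 h4] := Hn b _ i j; first by rewrite sqrt_ratio.
  by split; rewrite // h1 le_max h2.
have R0_sym n : (0 < n)%N -> (R0 n)^T = R0 n.
  move=> n0; apply/matrixP => j k; rewrite mxE -!(Y_correlation n (Ordinal n0)).
  by rewrite /correlation covarianceC mulrC [X in _ * X^-1]mulrC mulrC.
have [c1 [C1 [cV [CV [cR [b3 [b4 [CX [c10 C10 cV0 [CV0 cR0 b30 [b40 CX0 rows]]]]]]]]]]] :
    exists c1 C1 cV CV cR b3 b4 CX : R, [/\ 0 < c1, 0 < C1, 0 < cV & [/\ 0 < CV, 0 < cR, 0 < b3 &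
      [/\ 0 < b4, 0 < CX & \forall n \near \oo,
      regular_row mu (X n) (beta0 n) (Rbar n) (R0 n) c1 C1 cV CV cR b3 b4 CX]]].
  have [c1 [C1 [M1 [c10 C10 _ H6]]]] := ball _ ltr01.
  have [cR [CR [cR0 HR]]] := A4_R0; have [cV [CV [cV0 HV]]] := A4_Rbar.
  have [b3 [b4 [b30 b40 H3]]] := A3; have [CX H1] := A1.
  have rate1 := rate_square rate2 ltr01.
  have p0 := p_infty _ (nbhs_infty_gt 0).
  exists c1, C1, cV, (Num.max CV 1), cR, b3, b4, (Num.max CX 1).
  split=> //; split; rewrite ?lt_max ?ltr01 ?orbT//; split; rewrite ?lt_max ?ltr01 ?orbT//.
  near=> n.
  have n0 : (0 < n)%N by near: n; exact: nbhs_infty_gt.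
  have [hR1 hR2] : cR <= lambda_min (R0 n) /\ lambda_max (R0 n) <= CR by near: n.
  have [hV1 hV2] : cV <= lambda_min (Rbar n) /\ lambda_max (Rbar n) <= CV by near: n.
  have [sV _] := A4_Rbar_posdef n; have sR := R0_sym n n0.
  have [hG1 hG2] : b3 <= lambda_min (n%:R^-1 *: \sum_(i < n) (X n i)^T *m X n i) /\
    lambda_max (n%:R^-1 *: \sum_(i < n) (X n i)^T *m X n i) <= b4 by near: n.
  split=> //.
  - by near: n.
  - by rewrite -[leRHS]mul1r; near: n.
  - move=> i j; apply: (@le_trans _ _ (CX * Num.sqrt (p n)%:R)); last first.
      by rewrite ler_wpM2r ?sqrtr_ge0// le_max lexx.
    have -> : enorm (covar (X n) i j) = enorm (row j (X n i)).
      rewrite /enorm; congr Num.sqrt; rewrite big_ord1 exchange_big/= big_ord1.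
      by apply: eq_bigr => k _; rewrite mxE.
    by move: i j; near: n.
  - move=> i j; rewrite -linpredE.
    have B0 : tame_ball 1 c1 C1 M1 n by near: n.
    have [|//] := B0 (beta0 n) _ i j.
    by rewrite subrr enorm0 mul1r divr_ge0 ?sqrtr_ge0.
  - by move=> u; exact: le_trans (ler_wpM2r (dot_ge0 u) hV1) (lambda_min_le u sV).
  - move=> u; apply: (le_trans (lambda_max_ge u sV)).
    by rewrite ler_wpM2r ?dot_ge0// le_max hV2.
  - by move=> u; exact: le_trans (ler_wpM2r (dot_ge0 u) hR1) (lambda_min_le u sR).
pose regular n := regular_row mu (X n) (beta0 n) (Rbar n) (R0 n) c1 C1 cV CV cR b3 b4 CX.
have {rows} regular_near : \forall n \near \oo, regular n := rows.
have theta e : 0 < e -> exists2 th : R, 0 < th & 4 * (m%:R ^+ 2 / th) <= e.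
  move=> e0; have m0 : 0 <= 4 * m%:R ^+ 2 / e :> R by rewrite divr_ge0 ?(ltW e0)// mulr_ge0 ?sqr_ge0.
  exists (4 * m%:R ^+ 2 / e + 1); first by rewrite ltr_wpDl.
  rewrite mulrA ler_pdivrMr ?ltr_wpDl//.
  have -> : e * (4 * m%:R ^+ 2 / e + 1) = 4 * m%:R ^+ 2 + e by field; rewrite gt_eqF.
  by rewrite lerDl ltW.
have weights e : 0 < e -> exists2 tau0 : R, 0 < tau0 & \forall n \near \oo, prob_ge (P n)
    [set w | enorm (invmx (Rhat n w) - invmx (Rbar n)) <=
      tau0 * (Num.sqrt (p n)%:R / Num.sqrt n%:R)] (1 - e).
  move=> e0; have [K K0 H] := A4_Rhat _ e0; exists K => //.
  apply: filterS H => n; apply: prob_geW => w /=.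
  by rewrite sqrt_ratio ger0_norm ?enorm_ge0.
split.
  move=> eps eps0; have e2 : 0 < eps / 2 by rewrite divr_gt0.
  have [th th0 thE] := theta _ e2; have [tau0 tau00 HW] := weights _ e2.
  pose h := Hbar_floor c1 CV b3 / 2.
  have h0 : 0 < h by rewrite divr_gt0// divr_gt0// mulr_gt0.
  pose lhs := m%:R ^+ 2 * ((Num.sqrt m%:R / cV + tau0) * start_const c1 C1 CX th).
  have lhs0 : 0 <= lhs.
    apply: mulr_ge0; first exact: sqr_ge0.
    apply: mulr_ge0; first by rewrite addr_ge0 ?divr_ge0 ?sqrtr_ge0 ?ltW.
    by rewrite !mulr_ge0 ?invr_ge0 ?sqrtr_ge0// ltW.
  (* the radius is chosen after the constant of the starting score, and before the
     constants of the bounds on the ball of that radius *)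
  pose Delta := lhs / h + 1.
  have D0 : 0 < Delta by rewrite ltr_wpDl// divr_ge0// ltW.
  have small2 : lhs <= h * Delta.
    have -> : h * Delta = lhs + h by rewrite /Delta; field; rewrite gt_eqF.
    by rewrite lerDl ltW.
  have [c [C [M [c0 C0 M0 HB]]]] := ball _ D0.
  pose ec := err_const m C1 cV b4 CX c C M Delta tau0 th.
  have ec1 : 0 < `|ec| + 1 by rewrite ltr_wpDl.
  have rate := rate_square rate2 (divr_gt0 h0 ec1).
  exists Delta => //; near=> n.
  have [n0 p0 pn nX v0 sV lV uV sR lR lG uG] : regular n by near: n.
  have B0 : tame_ball Delta c C M n by near: n.
  have W0 : prob_ge (P n) [set w | enorm (invmx (Rhat n w) - invmx (Rbar n)) <=
      tau0 * (Num.sqrt (p n)%:R / Num.sqrt n%:R)] (1 - eps / 2) by near: n.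
  have rn : (p n)%:R <= h / (`|ec| + 1) * Num.sqrt n%:R by near: n.
  have := prob_good_outcome (Y_independent n) (Y_mean n) (Y_variance n) n0 p0 c10 C10 CX0 c0 M0
    D0 th0 v0 nX B0 uG W0.
  move=> good; apply: prob_ge_le (prob_geW _ good).
    by rewrite lerD2l lerN2 [leRHS]splitr lerD2r.
  move=> w gw /=; rewrite sqrt_ratio.
  apply: (good_root n0 p0 pn c10 C10 cV0 CV0 b30 b40 CX0 c0 (ltW C0) M0 D0 (ltW tau00) th0
    dmu0 dmu1 dmu2 v0 nX B0 sV lV uV lG uG gw) => //.
  rewrite -/ec -/h; apply: (@le_trans _ _ ((`|ec| + 1) * (p n)%:R)).
    by rewrite ler_wpM2r// (le_trans (ler_norm _))// lerDl.
  by rewrite mulrC -ler_pdivlMr// mulrAC.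
move=> rate3 betahat mb hb alpha ha t _.
pose v n := direction mu (X n) (beta0 n) (Rbar n) (R0 n) (alpha n).
pose S n := summand mu (X n) (Y n) (beta0 n) (Rbar n) (v n).
pose Z n w := ((alpha n)^T *m invmx (sqrtmx (Mbar mu (X n) (Rbar n) (R0 n) (beta0 n)))
  *m Hbar mu (X n) (Rbar n) (beta0 n) *m (betahat n w - beta0 n)) ord0 ord0.
suff H : P n [set w | Z n w <= t] @[n --> \oo] --> normal_prob 0 1 [set x | x <= t].
  exact: H.
have mZ n : measurable_fun [set: T n] (Z n).
  rewrite (_ : Z n = fun w => \sum_k ((alpha n)^T
      *m invmx (sqrtmx (Mbar mu (X n) (Rbar n) (R0 n) (beta0 n)))
      *m Hbar mu (X n) (Rbar n) (beta0 n)) ord0 k * (betahat n w k ord0 - beta0 n k ord0)).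
    apply: measurable_sum => k; apply: measurable_funM => //.
    by apply: measurable_funB => //; exact: mb.
  by apply/funext => w; rewrite /Z mxE; apply: eq_bigr => k _; rewrite !mxE.
have mS n : measurable_fun [set: T n] (fun w => \sum_i S n i w).
  by apply: measurable_sum => i; exact: measurable_summand.
have variance1 n : regular n -> enorm (alpha n) = 1 ->
    \sum_i Ex (P n) (fun w => S n i w ^+ 2) = 1.
  move=> [n0 _ _ _ v0 sV lV uV sR lR lG _] a1.
  have vpos i j : 0 < mu^`()%classic (dot (covar (X n) i j) (beta0 n)).
    by have /andP[h _] := v0 i j; exact: lt_le_trans h.
  under eq_bigr do rewrite (Ex_summand_sq (Y_mean n) (Y_variance n) _ _ (Y_correlation n) vpos).
  exact: (sum_quad_loading n0 c10 cV0 CV0 cR0 b30 v0 sV lV uV sR lR lG a1).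
have lindeberg e : 0 < e -> \forall n \near \oo, lindeberg_sum (P n) (S n) <= e.
  move=> e0; have [M1 [delta [M10 delta0 A5']]] := A5.
  pose Gam := C1 / cV ^+ 2 * (b4 / Mbar_floor c1 CV cR b3).
  have hM0 : 0 < Mbar_floor c1 CV cR b3 by exact: Mbar_floor_gt0.
  have cV2 : 0 < cV ^+ 2 by rewrite exprn_gt0.
  have Gam0 : 0 <= Gam by apply: mulr_ge0; apply: divr_ge0; apply: ltW.
  have e4 : 0 < e / 2 by rewrite divr_gt0.
  have GM : 0 < Gam * M1 + 1 by rewrite ltr_wpDl// mulr_ge0// ltW.
  pose eta := e / 2 / (Gam * M1 + 1).
  have eta0 : 0 < eta by rewrite divr_gt0.
  have [K0 K00 trunc] := sq_min_le delta0 eta0.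
  have GK : 0 < Gam * K0 + 1 + M1 by rewrite ltr_wpDl// addr_ge0// mulr_ge0.
  pose zeta := e / 2 / (Gam * K0 + 1 + M1).
  have z0 : 0 < zeta by rewrite divr_gt0.
  pose k := C1 / cV ^+ 2 * (m%:R * CX ^+ 2 / Mbar_floor c1 CV cR b3).
  have k0 : 0 <= k.
    apply: mulr_ge0; first by rewrite divr_ge0 ?ltW.
    by apply: divr_ge0; [apply: mulr_ge0 => //; exact: sqr_ge0|exact: ltW].
  have k1 : 0 < k + 1 by rewrite ltr_wpDl.
  have rate := rate_square rate2 (divr_gt0 (exprn_gt0 2 z0) k1).
  near=> n.
  have [n0 p0 pn nX v0 sV lV uV sR lR lG uG] : regular n by near: n.
  have a1 : enorm (alpha n) = 1 by near: n.
  have M5 : forall i : 'I_n,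
     ('E_(P n)[fun w => (enorm (pearson mu (X n) (Y n) (beta0 n) i w)
        `^ (2 + delta))%R] <= M1%:E)%E by near: n.
  have rn : (p n)%:R <= zeta ^+ 2 / (k + 1) * Num.sqrt n%:R by near: n.
  have nR : 0 < n%:R :> R by rewrite ltr0n.
  have load i : enorm (loading mu (X n) (beta0 n) (Rbar n) (v n) i) <= zeta.
    have := loading_max_le n0 c10 cV0 CV0 cR0 b30 v0 sV lV uV sR lR lG a1 nX i (ltW C10).
    move/le_trans; apply; rewrite -[leRHS]ger0_norm ?(ltW z0)// -sqrtr_sqr ler_wsqrtr//.
    rewrite exprMn (@sqr_sqrtr _ (p n)%:R)//.
    have -> : C1 / cV ^+ 2 * (m%:R * (CX ^+ 2 * (p n)%:R / n%:R) / Mbar_floor c1 CV cR b3) =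
      k * ((p n)%:R / n%:R) by rewrite /k; field; rewrite !gt_eqF.
    apply: (@le_trans _ _ ((k + 1) * (zeta ^+ 2 / (k + 1)))); last first.
      by rewrite mulrCA divff ?mulr1// gt_eqF.
    have q0 : 0 <= (p n)%:R / n%:R :> R by rewrite divr_ge0.
    apply: ler_pM => //; first by rewrite lerDl.
    rewrite ler_pdivrMr//; apply: (le_trans rn); rewrite ler_wpM2l ?divr_ge0 ?sqr_ge0 ?(ltW k1)//.
    rewrite -[leRHS](@sqr_sqrtr _ n%:R)// expr2 ler_peMr ?sqrtr_ge0//.
    by rewrite -[leLHS]sqrtr1 ler_wsqrtr// ler1n.
  have s1 : \sum_i Ex (P n) (fun w => S n i w ^+ 2) = 1 by apply: variance1 => //; near: n.
  have ls := loading_sum_le n0 c10 cV0 CV0 cR0 b30 b40 v0 sV lV uV sR lR lG uG a1.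
  have := lindeberg_summand (Y_mean n) (Y_variance n) delta0 M10 (ltW z0) eta0 K00 trunc M5
    load ls s1.
  rewrite -/Gam => /le_trans; apply.
  have E1 : zeta * (Gam * K0 + 1 + M1) = e / 2 by rewrite /zeta divfK// gt_eqF.
  have E2 : eta * (Gam * M1 + 1) = e / 2 by rewrite /eta divfK// gt_eqF.
  have -> : Gam * (zeta * K0 + eta * M1) + zeta * (1 + M1) =
    zeta * (Gam * K0 + 1 + M1) + (eta * (Gam * M1 + 1) - eta) by ring.
  by rewrite E1 E2 addrA -splitr gerBl ltW.
rewrite normal_cdfE; apply/fine_cvgP; split.
  apply: nearW => n; rewrite fin_num_measure//.
  rewrite (_ : [set w | _] = Z n @^-1` `]-oo, t]); first exact: preim_measurable.
  by apply/seteqP; split => w; rewrite /= in_itv.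
apply/cvgrPdist_le => eps eps0.
(* a third of [eps] each for the Lindeberg sum, the exceptional event and the
   displacement of [t]; the exceptional event consists of three parts *)
have e9 : 0 < eps / 9 by rewrite divr_gt0.
have e3 : 0 < eps / 3 by rewrite divr_gt0.
pose peak : R := normal_peak 1.
have peak0 : 0 <= peak := normal_peak_ge0 1.
have peak1 : 0 < 2 * peak + 1 by rewrite ltr_wpDl// mulr_ge0.
pose eta := eps / 3 / (2 * peak + 1).
have eta0 : 0 < eta by rewrite divr_gt0.
have peak_eta : peak * (2 * eta) <= eps / 3.
  rewrite -[leRHS](@divfK _ (2 * peak + 1)) ?gt_eqF// -/eta.
  have -> : peak * (2 * eta) = eta * (2 * peak) by ring.
  by rewrite ler_wpM2l ?(ltW eta0)// lerDl.
have [K1 K10 H1] := clt_bound (t - eta) eta0; have [K2 K20 H2] := clt_bound (t + eta) eta0.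
have K1' : 0 < K1 + K2 + 1 by rewrite ltr_wpDl// addr_ge0.
have Lsmall := lindeberg _ (divr_gt0 e3 K1').
have [Delta D0 good_hat] := hb _ e9.
have [th th0 thE] := theta _ e9; have [tau0 tau00 HW] := weights _ e9.
have [c [C [M [c0 C0 M0 HB]]]] := ball _ D0.
pose lc := linear_const m c1 C1 cV CV cR b3 b4 CX c C M Delta tau0 th.
have lc1 : 0 < `|lc| + 1 by rewrite ltr_wpDl.
have rate := rate_cube rate3 (divr_gt0 eta0 lc1).
near=> n.
have [n0 p0 pn nX v0 sV lV uV sR lR lG uG] : regular n by near: n.
have a1 : enorm (alpha n) = 1 by near: n.
have B0 : tame_ball Delta c C M n by near: n.
have W0 : prob_ge (P n) [set w | enorm (invmx (Rhat n w) - invmx (Rbar n)) <=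
    tau0 * (Num.sqrt (p n)%:R / Num.sqrt n%:R)] (1 - eps / 9) by near: n.
have hat : prob_ge (P n) [set w |
    gee_score mu (X n) (Rhat n w) (fun i => \col_j Y n i j w) (betahat n w) = 0 /\
    enorm (betahat n w - beta0 n) <= Delta * Num.sqrt ((p n)%:R / n%:R)] (1 - eps / 9).
  by near: n.
have rn : Num.sqrt (p n)%:R * (p n)%:R / Num.sqrt n%:R <= eta / (`|lc| + 1) by near: n.
have Ln : lindeberg_sum (P n) (S n) <= eps / 3 / (K1 + K2 + 1) by near: n.
have close : prob_ge (P n) [set w | `|Z n w - \sum_i S n i w| <= eta] (1 - eps / 3).
  have good := prob_good_outcome (Y_independent n) (Y_mean n) (Y_variance n) n0 p0 c10 C10 CX0
    c0 M0 D0 th0 v0 nX B0 uG W0.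
  apply: prob_ge_le (prob_geW _ (prob_geI good hat)).
    have -> : eps / 3 = eps / 9 + eps / 9 + eps / 9 by field.
    by rewrite lerD2l lerN2 2!lerD2r.
  move=> w [gw [S0]] /=; rewrite sqrt_ratio => br.
  rewrite /Z (statisticE n0 c10 cV0 CV0 cR0 b30 v0 sV lV uV sR lR lG) /S.
  apply: (le_trans (good_linearization n0 p0 pn c10 C10 cV0 CV0 cR0 b30 b40 CX0 c0 (ltW C0) M0 D0
    (ltW tau00) th0 dmu0 dmu1 dmu2 v0 nX B0 sV lV uV sR lR lG uG a1 gw S0 br)).
  rewrite -/lc; apply: (@le_trans _ _ ((`|lc| + 1) * (eta / (`|lc| + 1)))); last first.
    by rewrite mulrCA divff ?mulr1// gt_eqF.
  apply: (@le_trans _ _ ((`|lc| + 1) * (Num.sqrt (p n)%:R * (p n)%:R / Num.sqrt n%:R))).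
    rewrite ler_wpM2r ?divr_ge0 ?mulr_ge0 ?sqrtr_ge0//.
    by rewrite (le_trans (ler_norm _))// lerDl.
  by rewrite ler_wpM2l// ltW.
have s1 : \sum_i Ex (P n) (fun w => S n i w ^+ 2) = 1 by apply: variance1 => //; near: n.
have iS : indep_seq (P n) (S n) by exact: (indep_summand mu (X n) (beta0 n) (Y_independent n)).
have mSi i : measurable_fun [set: T n] (S n i) by exact: measurable_summand.
have S2 i := integ_summand_sq (Y_mean n) (Y_variance n) (Rbar n) (v n) i.
have S0 i := Ex_summand (Y_mean n) (Y_variance n) (Rbar n) (v n) i.
have /andP[lo _] := H1 _ _ (P n) _ (S n) mSi iS S2 S0 s1.
have /andP[_ up] := H2 _ _ (P n) _ (S n) mSi iS S2 S0 s1.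
have Lle K : 0 <= K -> K <= K1 + K2 + 1 -> K * lindeberg_sum (P n) (S n) <= eps / 3.
  move=> Kp Kle; apply: (le_trans (ler_wpM2l Kp Ln)).
  by rewrite mulrA ler_pdivrMr// mulrC ler_wpM2l// ltW.
have L1 := Lle K1 K10 (le_trans (ler_wpDr K20 (lexx K1)) (ler_wpDr ler01 (lexx _))).
have L2 := Lle K2 K20 (le_trans (ler_wpDl K10 (lexx K2)) (ler_wpDr ler01 (lexx _))).
have lo' := le_trans (lerB (lexx _) L1) lo; have up' := le_trans up (lerD (lexx _) L2).
apply: (le_trans (normal_cdf_transfer (mZ n) (mS n) close (ltW eta0) lo' up')).
rewrite [leRHS](_ : eps = eps / 3 + eps / 3 + eps / 3); last by field.
by rewrite 2!lerD2r.
Unshelve. all: by end_near. Qed.
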